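(* Let $K/k$ be an extension of algebraically closed analytic fields such that $K$ is non-trivially valued, $\mathrm{tr.c}(K/k)=1$ and $\mathrm{char}(\widetilde k)>0$. Let $\{F_i\}_{i\in I}$ be the family of all intermediate algebraically closed analytic fields $k\subsetneq F_i\subsetneq K$, with $I$ ordered by inclusion of the fields. Then the following conditions are equivalent: (1) The extension $K/k$ is large. (2) $\mathrm{Tr.c}(K/k)\ge\aleph_1$. (3) $\mathrm{Tr.c}(K/k)=\aleph_1$. (4) The family $\{F_i\}_{i\in I}$ has uncountable cofinality. (5) The family $\{F_i\}_{i\in I}$ has cofinality $\aleph_1$. (6) $\omega_1$ is the only uncountable ordinal that can be embedded (as an ordered set) into $I$. (7) $K$ is the (uncompleted) union of the fields $F_i$. (8) $K$ is a maximal extension of $k$ of topological transcendence degree one, i.e. there is no extension of analytic fields $K\subsetneq L$ with $\mathrm{tr.c}(L/k)=1$. (9) Any $k$-endomorphism of $K$ is an automorphism.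
   Context: An analytic field is a field complete with respect to a real-valued (rank at most one, possibly trivial) multiplicative non-archimedean absolute value $|\ |$; $\widetilde k$ denotes the residue field. An extension of analytic fields is a field extension in which the absolute value of the larger field restricts to that of the smaller one; $k$-endomorphisms of analytic fields are isometric $k$-homomorphisms. An intermediate analytic field is an intermediate field complete with respect to the induced absolute value. $K^a$ denotes an algebraic closure with the extended absolute value, $\widehat{\ \cdot\ }$ denotes completion. For an extension $K/k$ and a subset $S\subset K$, $\widehat{k(S)^a}$ denotes the closure in $\widehat{K^a}$ of the algebraic closure of $k(S)$. A set $S\subset K$ is t.a. (topologically-algebraically) independent over $k$ if $\widehat{k(S')^a}\subsetneq\widehat{k(S)^a}$ for any $S'\subsetneq S$, and it is t.a. generating for $K/k$ if $\widehat{K^a}=\widehat{k(S)^a}$. The topological generating degree $\mathrm{Tr.c}(K/k)$ is the minimum of the cardinalities of t.a. generating sets, and the topological transcendence degree $\mathrm{tr.c}(K/k)$ is the supremum of the cardinalities of t.a. independent sets. The extension is small if $\mathrm{Tr.c}(K/k)$ is finite and large otherwise. When $\mathrm{tr.c}(K/k)=1$ the set of algebraically closed analytic intermediate fields is known to be totally ordered by inclusion. *)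

(* Defs.v *)
From HB Require Import structures.
From mathcomp Require Import all_boot all_order all_algebra.
From mathcomp Require Import all_classical wochoice reals topology.

Set Implicit Arguments.
Unset Strict Implicit.
Unset Printing Implicit Defensive.

Import Order.TTheory GRing.Theory Num.Theory.

Local Open Scope classical_set_scope.
Local Open Scope card_scope.
Local Open Scope ring_scope.
Local Open Scope quotient_scope.

(* MathComp's normed structures cannot be reused for the absolute value: they
   require `|x *+ n| = `|x| *+ n, which fails in the non-archimedean case.  The
   topology and the uniformity are those of the metric (x, y) |-> absv (x - y). *)
HB.mixin Record isNonArchimedean (R : realType) K
    of GRing.Field K & Metric R K := {
  absv : K -> R;
  absv_ge0 : forall x, 0 <= absv x;
  absv_eq0 : forall x, absv x = 0 <-> x = 0;
  absvM : forall x y, absv (x * y) = absv x * absv y;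
  absvD : forall x y, absv (x + y) <= Num.max (absv x) (absv y);
  mdist_absv : forall x y : K, mdist x y = absv (x - y)
}.

#[short(type="analyticFieldType")]
HB.structure Definition AnalyticField (R : realType) :=
  { K of GRing.Field K & Metric R K & Complete K & isNonArchimedean R K }.

Arguments absv {R K} : rename.

Section AbsoluteValue.
Context {R : realType} {K : analyticFieldType R}.
Implicit Types x y : K.

Lemma absv0 : absv (0 : K) = 0.
Proof. exact/absv_eq0. Qed.

Lemma absv1 : absv (1 : K) = 1.
Proof.
have n0 : absv (1 : K) != 0.
  by apply/eqP => /absv_eq0/eqP; rewrite oner_eq0.
by apply: (mulfI n0); rewrite -absvM !mulr1.
Qed.

Lemma absvN x : absv (- x) = absv x.
Proof.
have e : absv (-1 : K) ^+ 2 = 1 by rewrite expr2 -absvM mulrNN mulr1 absv1.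
rewrite -mulN1r absvM; suff -> : absv (-1 : K) = 1 by rewrite mul1r.
by apply/eqP; rewrite -(@eqrXn2 _ 2) ?expr1n ?e ?absv_ge0.
Qed.

End AbsoluteValue.

Section ResidueField.
Context {R : realType}.
Variable K : analyticFieldType R.

Definition vring_pred : {pred K} := fun x => absv x <= 1.

Lemma vring_subring : subring_closed vring_pred.
Proof.
split=> [|x y|x y]; rewrite /vring_pred !unfold_in /=.
- by rewrite absv1.
- by move=> hx hy; rewrite (le_trans (absvD _ _))// absvN ge_max hx.
- by move=> hx hy; rewrite absvM mulr_ile1 ?absv_ge0.
Qed.

HB.instance Definition _ := GRing.isSubringClosed.Build K vring_pred
  vring_subring.

Definition vring := {x : K | x \in vring_pred}.

HB.instance Definition _ := SubType.on vring.
HB.instance Definition _ := Choice.on vring.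
HB.instance Definition _ := [SubChoice_isSubComNzRing of vring by <:].

Definition vmax : {pred vring} := fun x => absv (val x) < 1.

Lemma vmax_ideal : idealr_closed vmax.
Proof.
split; rewrite /vmax ?unfold_in /=.
- by rewrite absv0.
- by rewrite absv1 ltxx.
- move=> a x y; rewrite !unfold_in /= => hx hy.
  rewrite (le_lt_trans (absvD _ _))// gt_max hy andbT absvM.
  by apply: le_lt_trans hx; apply: ler_piMl; [exact: absv_ge0|exact: (valP a)].
Qed.

HB.instance Definition _ := isIdealr.Build vring vmax vmax_ideal.

Definition residue_field := Quotient.quot vmax.
HB.instance Definition _ := GRing.ComNzRing.on residue_field.

Definition residue_inv (q : residue_field) : residue_field :=
  xget 0 [set r | r * q = 1].

Lemma residue_mulVf (q : residue_field) : q != 0 -> residue_inv q * q = 1.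
Proof.
move=> q0; apply: (@xgetPex _ 0 [set r | r * q = 1]).
move: q0; rewrite -[q]reprK; move: (repr q) => x x0.
have x1 : absv (val x) = 1.
  apply/eqP; rewrite eq_le (valP x : _ <= _) leNgt; apply: contra x0 => x1.
  have := Quotient.idealrBE vmax x 0; rewrite subr0 => e.
  have : x \in vmax by [].
  by rewrite e rmorph0.
have nx : val x != 0.
  by apply/eqP => /absv_eq0; rewrite x1 => /eqP; rewrite oner_eq0.
have y1 : (val x)^-1 \in vring_pred.
  rewrite unfold_in -[absv _]mul1r -[X in X * _]x1 -absvM divff//.
  by rewrite absv1.
exists (\pi_(Quotient.quot vmax) (Sub (val x)^-1 y1 : vring)) => /=.
rewrite -rmorphM -(rmorph1 \pi_(Quotient.quot vmax)).
by congr (\pi _); apply: val_inj; rewrite /= mulVf.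
Qed.

Lemma residue_inv0 : residue_inv 0 = 0.
Proof.
apply: xgetPN => r; rewrite /= mulr0 => /esym/eqP.
by rewrite oner_eq0.
Qed.

HB.instance Definition _ := GRing.ComNzRing_isField.Build residue_field
  residue_mulVf residue_inv0.

End ResidueField.

Section TopologicalTranscendence.
Context {R : realType}.
Implicit Types k K L M : analyticFieldType R.

Definition isometric K L (f : K -> L) := forall x, absv (f x) = absv x.

Definition subfield K (F : set K) := GRing.divring_closed (mem F).

Definition complete_set K (F : set K) := forall u : nat -> K,
  (forall n, F (u n)) -> cauchy (u @ \oo) -> exists2 l, F l & u @ \oo --> l.

Definition alg_closed K (F : set K) := forall p : {poly K},
  p \is a polyOver (mem F) -> (1 < size p)%N -> exists2 x, F x & root p x.

Definition alg_closure_in K (F : set K) : set K :=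
  [set x | exists p : {poly K}, [/\ p \is a polyOver (mem F), p != 0 & root p x]].

Definition adjoin K (F S : set K) : set K := smallest (@subfield K) (F `|` S).

(* iota exhibits M as the completion of an algebraic closure of K equipped with
   the extended absolute value.  M is unique up to isometric K-isomorphism, so
   the notions below do not depend on its choice. *)
Definition completed_alg_closure K M (iota : {rmorphism K -> M}) :=
  [/\ isometric iota, alg_closed (alg_closure_in (range iota)) &
      dense (alg_closure_in (range iota))].

(* The closure in M of the algebraic closure of k(S), for S a subset of K. *)
Definition ta_closure k K M (i : {rmorphism k -> K})
    (iota : {rmorphism K -> M}) (S : set K) : set M :=
  closure (alg_closure_in (adjoin (range (iota \o i)) (iota @` S))).

Definition ta_independent k K (i : {rmorphism k -> K}) (S : set K) :=
  exists M (iota : {rmorphism K -> M}), completed_alg_closure iota /\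
    forall S', S' `<` S -> ta_closure i iota S' `<` ta_closure i iota S.

Definition ta_generating k K (i : {rmorphism k -> K}) (S : set K) :=
  exists M (iota : {rmorphism K -> M}), completed_alg_closure iota /\
    ta_closure i iota S = setT.

(* Cardinals are represented by sets, in an arbitrary type, up to #=:
   A has the least (resp. the supremum) of the cardinalities of the members of
   P. *)
Definition is_min_card T (P : set (set T)) U (A : set U) :=
  (exists2 S, P S & S #= A) /\ forall S, P S -> A #<= S.

Definition is_sup_card T (P : set (set T)) U (A : set U) :=
  (forall S, P S -> S #<= A) /\
  forall V (B : set V), (forall S, P S -> S #<= B) -> A #<= B.

Definition is_Trc k K (i : {rmorphism k -> K}) U (A : set U) :=
  is_min_card (ta_generating i) A.

Definition is_trc k K (i : {rmorphism k -> K}) U (A : set U) :=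
  is_sup_card (ta_independent i) A.

Definition small k K (i : {rmorphism k -> K}) := exists n, is_Trc i `I_n.

Definition large k K (i : {rmorphism k -> K}) := ~ small i.

Definition intermediate_acf k K (i : {rmorphism k -> K}) : set (set K) :=
  [set F | [/\ subfield F, complete_set F, alg_closed F,
               range i `<` F & F `<` setT]].

End TopologicalTranscendence.

(* In a fixed well-ordering of the power set of nat, the elements with countably
   many predecessors form an initial segment, whose order type is the first
   uncountable ordinal (see the lemmas below); its cardinality is aleph_1. *)
Definition pow_nat_le : rel (set nat) :=
  sval (well_ordering_principle (set nat)).

Definition omega1_set : set (set nat) :=
  [set x | countable [set y | pow_nat_le y x]].

Definition omega1 : Type := omega1_set.

Definition omega1_le : rel omega1 := fun x y => pow_nat_le (val x) (val y).

Lemma pow_nat_le_wo : well_order pow_nat_le.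
Proof. exact: svalP (well_ordering_principle (set nat)). Qed.

Lemma pow_nat_le_anti : antisymmetric pow_nat_le.
Proof.
move=> x y; apply: (wo_chain_antisymmetric (C := predT) _ (x := x) (y := y)) => //.
by move=> A _; exact: pow_nat_le_wo.
Qed.

Lemma omega1_le_wo : well_order omega1_le.
Proof.
apply: antisymmetric_well_order => [x y /pow_nat_le_anti/val_inj//|A [a Aa]].
have [|z [[/asboolP[w Aw <-] zmin] _]] :=
  pow_nat_le_wo (A := fun x => `[< exists2 w, w \in A & val w = x >]).
  by exists (val a); apply/asboolP; exists a.
by exists w; split => // v Av; apply: zmin; apply/asboolP; exists v.
Qed.

Lemma countable_omega1_segment (x : omega1) :
  countable [set y | omega1_le y x].
Proof.
have /set_mem cx := valP x.
apply: (sub_countable _ cx).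
rewrite -(card_le_eql (inj_card_eq (in2W val_inj))).
by apply: subset_card_le => _ [y yx <-].
Qed.

Lemma omega1_uncountable : ~ countable [set: omega1].
Proof.
rewrite (eq_countable (card_setT _)) => c1.
have [x x1] : exists x, ~ omega1_set x.
  apply: contrapT => h; have /countable_injP[f finj] : countable [set: set nat].
    apply: (sub_countable (subset_card_le _) c1) => x _.
    by apply: contrapT => ?; apply: h; exists x.
  pose D := [set n | exists2 A, f A = n & ~ A n].
  have [Df|nDf] := pselect (D (f D)).
    have [A fA nA] := Df; apply: nA.
    by rewrite (finj A D) ?inE.
  by apply: (nDf); exists D.
have [|z [[/asboolP z1 zmin] _]] :=
  pow_nat_le_wo (A := fun x => `[< ~ omega1_set x >]).
  by exists x; apply/asboolP.
apply: z1.
have : countable (\bigcup_(b : bool) (if b then omega1_set else [set z])).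
  by apply: bigcup_countable => // -[].
apply: sub_countable; apply: subset_card_le => y yz.
have [y1|/asboolP/zmin zy] := pselect (omega1_set y); first by exists true.
by exists false => //=; apply: pow_nat_le_anti; rewrite yz.
Qed.

(* Relations on ordinals are the reflexive ones (<=), as in well_order. *)
Definition order_iso V (rV : rel V) W (rW : rel W) :=
  exists2 f : V -> W, bijective f & {mono f : x y / rV x y >-> rW x y}.

Definition embeds_in W (rW : rel W) T (I : set (set T)) :=
  exists2 f : W -> set T, forall w, I (f w) &
    forall v w, rW v w <-> f v `<=` f w.

Definition cofinal_in T (I C : set (set T)) :=
  C `<=` I /\ forall F, I F -> exists2 G, C G & F `<=` G.

Definition is_cofinality T (I : set (set T)) U (A : set U) :=
  is_min_card (cofinal_in I) A.

(* Main.v *)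
Require Import Defs.
From HB Require Import structures.
From mathcomp Require Import all_boot all_order all_algebra.
From mathcomp Require Import all_classical wochoice reals topology.
From mathcomp Require Import ring lra.

Set Implicit Arguments.
Unset Strict Implicit.
Unset Printing Implicit Defensive.

Import Order.TTheory GRing.Theory Num.Theory.

Local Open Scope classical_set_scope.
Local Open Scope card_scope.
Local Open Scope ring_scope.

(** Write [<S>] for the closure of the algebraic closure of [k(S)].  As
    tr.c(K/k) = 1, of any two elements of [K] one lies in the field spanned by
    the other, so the closed algebraically closed intermediate fields form a
    chain.

    Inside [<x>] the distance [F |-> dist F x] is strictly decreasing in the
    intermediate field [F]: if [x] is equally far from [F0] and from [F], then
    [|P(x, y)|] is a Gauss norm of [P], for any polynomial [P] over [F0] and any
    [y] in [F] outside [F0], and this prevents [P(x, -)] from having a root close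
    to [y].  Hence well-ordered chains inside [<x>] are countable.  On the
    other hand, by Baire's theorem [K] is not covered by countably many proper
    closed subfields; if no [x] generates [K], transfinite recursion yields a
    strictly increasing chain [<f(w)>] indexed by [omega1], which must exhaust
    [K].  This gives the statements on cardinals and orders.  A proper extension
    [L] of tr.c one would put this chain inside [<x>], for [x] in [L] outside [K].

    It remains to find, when [K = <x>], an endomorphism that is not surjective.  Any
    [x'] with [|x - x'| < dist k x] is the image of [x] under an isometric
    endomorphism, and by the above every intermediate field contains such an [x'];
    so it suffices that there is some [y] outside [k] with [<y>] different from [K].
    Such a [y] is the limit of [u_n ^ (p^(2n))], where
    [u_0 = x] and [u_n = u_(n+1) ^ (p^2) + P_n(u_(n+1))] with a small perturbation
    [P_n]: the endomorphisms [u_n |-> u_n + e] move [y] very little for large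
    [n], but they move [x] by a definite amount, depending on [e], so [x] cannot be
    approximated by roots of polynomials over [k(y)]. *)

(** * Absolute values and their topology *)

(** The construction of [y] has to reconcile two demands. The endomorphisms must move [x] by an
    amount independent of [n], so the product of the factors [beta n] by which the successive steps
    scale distances must stay bounded below; this forces [beta n] to tend to 1 quickly, and it is
    taken to be the [p^n]-th root of [beta 0]. But the perturbations, of size up to [beta n], must
    disappear in the limit [y]. This is the reason for the exponent [p^2]: of the [2n] successive
    [p]-th powers in [u_n ^ (p^(2n))], the first [n] bring an error of size [beta n] down to
    [beta 0], and the other [n] bring it down to [beta 0 ^ (n+1)]. That [p]-th powers contract
    distances at all is where [|p| < 1], hence the positive residue characteristic, enters.

    The nine conditions are proved in a cycle, with the absence of a single generator as the pivot.
    As [K] is algebraically closed, it can serve as its own completed algebraic closure. The field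
    [L] in (8) is not assumed algebraically closed, so comparability is proved in an arbitrary
    completed algebraic closure [M]. *)

Section AbsvTheory.
Context {R : realType} {K : analyticFieldType R}.
Implicit Types (x y z : K) (F : set K).

Lemma absv_gt0 x : (0 < absv x) = (x != 0).
Proof.
rewrite lt0r absv_ge0 andbT; apply/idP/idP; apply: contra => /eqP.
  by move=> ->; rewrite absv0.
by move/absv_eq0 => ->.
Qed.

Lemma absvB x y : absv (x - y) <= Num.max (absv x) (absv y).
Proof. by rewrite -(absvN y) absvD. Qed.

Lemma absv_distC x y : absv (x - y) = absv (y - x).
Proof. by rewrite -absvN opprB. Qed.

Lemma absvX x n : absv (x ^+ n) = absv x ^+ n.
Proof. by elim: n => [|n IH]; rewrite ?expr0 ?absv1// !exprS absvM IH. Qed.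

Lemma absvV x : absv x^-1 = (absv x)^-1.
Proof.
have [->|x0] := eqVneq x 0; first by rewrite invr0 absv0 invr0.
have ax0 : absv x != 0 by rewrite gt_eqF// absv_gt0.
by apply: (mulfI ax0); rewrite -absvM !divff// absv1.
Qed.

Lemma absv_div x y : absv (x / y) = absv x / absv y.
Proof. by rewrite absvM absvV. Qed.

Lemma absv_prod I (r : seq I) (P : pred I) (f : I -> K) :
  absv (\prod_(i <- r | P i) f i) = \prod_(i <- r | P i) absv (f i).
Proof. exact: (big_morph _ absvM absv1). Qed.

Lemma absv_sum_le I (r : seq I) (P : pred I) (f : I -> K) (c : R) : 0 <= c ->
  (forall i, P i -> absv (f i) <= c) -> absv (\sum_(i <- r | P i) f i) <= c.
Proof.
move=> c0 h; apply: (big_ind (fun u => absv u <= c)) => //; first by rewrite absv0.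
by move=> u v hu hv; rewrite (le_trans (absvD _ _))// ge_max hu.
Qed.

Lemma absvD_le c x y : absv x <= c -> absv y <= c -> absv (x + y) <= c.
Proof. by move=> hx hy; rewrite (le_trans (absvD _ _))// ge_max hx. Qed.

Lemma absvB_le c x y : absv x <= c -> absv y <= c -> absv (x - y) <= c.
Proof. by move=> hx hy; rewrite absvD_le// absvN. Qed.

Lemma absvD_lt c x y : absv x < c -> absv y < c -> absv (x + y) < c.
Proof. by move=> hx hy; rewrite (le_lt_trans (absvD _ _))// gt_max hx. Qed.

Lemma absvB_lt c x y : absv x < c -> absv y < c -> absv (x - y) < c.
Proof. by move=> hx hy; rewrite absvD_lt// absvN. Qed.

Lemma absv_dist_le c x y z :
  absv (x - y) <= c -> absv (y - z) <= c -> absv (x - z) <= c.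
Proof. by move=> hx hy; rewrite -(subrK y x) -addrA absvD_le. Qed.

Lemma absv_dist_lt c x y z :
  absv (x - y) < c -> absv (y - z) < c -> absv (x - z) < c.
Proof. by move=> hx hy; rewrite -(subrK y x) -addrA absvD_lt. Qed.

Lemma absvDl x y : absv y < absv x -> absv (x + y) = absv x.
Proof.
move=> yx; apply/eqP; rewrite eq_le (absvD_le (lexx _) (ltW yx))/= leNgt; apply/negP => h.
suff : absv x < absv x by rewrite ltxx.
by rewrite -[in X in X < _](addrK y x) absvB_lt.
Qed.

Lemma absvDr x y : absv x < absv y -> absv (x + y) = absv y.
Proof. by rewrite addrC; exact: absvDl. Qed.

Lemma absv_near x y : absv (x - y) < absv x -> absv y = absv x.
Proof.
move=> h; have -> : y = x + - (x - y) by rewrite opprB addrC subrK.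
by rewrite absvDl// absvN.
Qed.

Lemma ball_absv x (e : R) : ball x e = [set y | absv (x - y) < e].
Proof. by rewrite ballEmdist; apply/seteqP; split => y /=; rewrite mdist_absv. Qed.

Lemma closure_absvP F x :
  closure F x <-> forall e : R, 0 < e -> exists2 a, F a & absv (x - a) < e.
Proof.
split=> [cl e e0|h].
  have [|a [Fa]] := cl (ball x e); first exact: nbhsx_ballx.
  by rewrite ball_absv; exists a.
move=> B /nbhs_ballP[e /= e0 eB].
have [a Fa xa] := h e e0; exists a; split=> //; apply: eB.
by rewrite ball_absv.
Qed.

Lemma closed_absvP F : closed F <->
  forall x, (forall e : R, 0 < e -> exists2 a, F a & absv (x - a) < e) -> F x.
Proof.
split=> [cF x /closure_absvP|h x /closure_absvP]; first exact: cF.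
exact: h.
Qed.

Lemma cvg_absvP (u : nat -> K) l : u @ \oo --> l <->
  forall e : R, 0 < e -> exists N, forall n, (N <= n)%N -> absv (u n - l) < e.
Proof.
split=> [/cvg_ballP ul e e0|h].
  have [N _ hN] := ul e e0; exists N => n Nn.
  by have := hN n Nn; rewrite /= ball_absv/= absv_distC.
apply/cvg_ballP => e e0; have [N hN] := h e e0; exists N => // n /= Nn.
by rewrite ball_absv/= absv_distC hN.
Qed.

Lemma cauchy_absvP (u : nat -> K) : cauchy (u @ \oo) <->
  forall e : R, 0 < e ->
    exists N, forall n m, (N <= n)%N -> (N <= m)%N -> absv (u n - u m) < e.
Proof.
split=> [/cauchy_ballP uc e e0|h].
  have [[A B] /= [[N _ hN] [M _ hM]] hAB] := uc e e0.
  exists (maxn N M) => n m; rewrite !geq_max => /andP[n1 _] /andP[_ m2].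
  have := hAB (u n, u m) => /=; rewrite ball_absv/=; apply.
  by split; [exact: hN|exact: hM].
apply/cauchy_ballP => e e0; have [N hN] := h e e0.
exists ([set u n | n in [set n | (N <= n)%N]],
        [set u n | n in [set n | (N <= n)%N]]) => /=.
  by split; exists N => // n /= Nn; exists n.
move=> [_ _] /= [[n Nn <-] [m Nm <-]].
by rewrite ball_absv; exact: hN.
Qed.

Lemma complete_absv (u : nat -> K) :
  (forall e : R, 0 < e ->
    exists N, forall n m, (N <= n)%N -> (N <= m)%N -> absv (u n - u m) < e) ->
  exists l, forall e : R, 0 < e ->
    exists N, forall n, (N <= n)%N -> absv (u n - l) < e.
Proof.
move=> /cauchy_absvP/cauchy_cvg => uc; exists (lim (u @ \oo)).
exact/cvg_absvP.
Qed.

Lemma small_inv (e : R) : 0 < e -> exists N, forall n, (N <= n)%N -> n.+1%:R^-1 < e.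
Proof.
move=> e0; exists (Num.truncn e^-1) => n Nn.
rewrite -[ltRHS]invrK ltf_pV2 ?posrE ?invr_gt0// ?ltr0n//.
apply: lt_le_trans (truncnS_gt _) _; by rewrite ler_nat.
Qed.

Lemma complete_closed F : complete_set F <-> closed F.
Proof.
split=> [cF|cF u Fu /cauchy_absvP/complete_absv[l ul]].
  apply/closed_absvP => x hx.
  have /choice[u hu] : forall n : nat, exists a, F a /\ absv (x - a) < n.+1%:R^-1.
    by move=> n; have [|a Fa xa] := hx n.+1%:R^-1; [rewrite invr_gt0 ltr0n|exists a].
  have ux : forall e : R, 0 < e ->
      exists N, forall n, (N <= n)%N -> absv (u n - x) < e.
    move=> e /small_inv[N hN]; exists N => n Nn; rewrite absv_distC.
    exact: lt_trans (hu n).2 (hN n Nn).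
  have [|l Fl /cvg_absvP ul] := cF u (fun n => (hu n).1).
    apply/cauchy_absvP => e /ux[N hN]; exists N => n m Nn Nm.
    by rewrite (@absv_dist_lt _ _ x)// ?hN// absv_distC hN.
  suff -> : x = l by [].
  apply/eqP; rewrite -subr_eq0 -[_ == _]negbK -absv_gt0; apply/negP => xl.
  have [N hN] := ux _ xl; have [M hM] := ul _ xl.
  suff : absv (x - l) < absv (x - l) by rewrite ltxx.
  apply: (@absv_dist_lt _ _ (u (maxn N M))).
    by rewrite absv_distC hN// leq_maxl.
  by rewrite hM// leq_maxr.
exists l; last exact/cvg_absvP.
move/closed_absvP: cF; apply => e /ul[N hN].
by exists (u N) => //; rewrite absv_distC hN.
Qed.

End AbsvTheory.

(** * Subfields and algebraic closures *)

(** The ambient ring need not be a field: besides subfields of [K], this covers graphs of partial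
    isometries, which are subfields of the ring [K * K]. *)
Record field_in (A : comUnitRingType) := FieldIn {
  field_set : set A;
  field_set_closed : divring_closed (mem field_set);
  field_set_unit : forall x, field_set x -> x != 0 -> x \is a GRing.unit }.

Section FieldIn.
Context {A : comUnitRingType} (D : field_in A).

Definition field_pred : {pred A} := mem (field_set D).

HB.instance Definition _ := GRing.isDivringClosed.Build A field_pred
  (field_set_closed D).

Definition field_type := {x : A | x \in field_pred}.

HB.instance Definition _ := SubType.on field_type.
HB.instance Definition _ := Choice.on field_type.
HB.instance Definition _ := [SubChoice_isSubComUnitRing of field_type by <:].

Lemma field_type_fieldP : GRing.field_axiom field_type.
Proof.
move=> x x0; have := @field_set_unit _ D (val x) (set_mem (valP x)).
rewrite -(rmorph0 (val : field_type -> A)) (inj_eq val_inj) => /(_ x0) ux.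
by rewrite unfold_in.
Qed.

HB.instance Definition _ := GRing.ComUnitRing_isField.Build field_type
  field_type_fieldP.

End FieldIn.

(** Presenting a subset as the range of a morphism from a field type gives access to division of
    polynomials and to algebraic elements over it. *)
Lemma field_of_set (A : comUnitRingType) (D : set A) :
  divring_closed (mem D) -> (forall x, D x -> x != 0 -> x \is a GRing.unit) ->
  exists (E : fieldType) (v : {rmorphism E -> A}), range v = D.
Proof.
move=> hD hu; pose F := FieldIn hD hu.
exists (field_type F), (val : {rmorphism field_type F -> A}).
apply/seteqP; split=> [_ [x _ <-]|x Dx]; first exact: set_mem (valP x).
by exists (Sub x (mem_set Dx : x \in field_pred F)).
Qed.

Section SetFields.
Context {R : realType} {K : analyticFieldType R}.
Implicit Types (x y z : K) (F G S : set K) (p q : {poly K}).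

Lemma polyOver_setP F p : F 0 ->
  p \is a polyOver (mem F) <-> forall n, F p`_n.
Proof.
move=> F0; split=> [/allP h n|h].
  have [np|np] := ltnP n (size p); last by rewrite nth_default.
  by apply: set_mem; apply: h; exact: mem_nth.
by apply/(all_nthP 0) => n _; apply: mem_set.
Qed.

Lemma subfieldP F : subfield F <->
  [/\ F 1, forall x y, F x -> F y -> F (x - y) &
      forall x y, F x -> F y -> F (x / y)].
Proof.
split=> -[h1 hB hV]; split.
- exact: set_mem h1.
- by move=> x y Fx Fy; apply: set_mem; apply: hB; apply: mem_set.
- by move=> x y Fx Fy; apply: set_mem; apply: hV; apply: mem_set.
- exact: mem_set.
- by move=> x y /set_mem Fx /set_mem Fy; apply: mem_set; exact: hB.
- by move=> x y /set_mem Fx /set_mem Fy; apply: mem_set; exact: hV.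
Qed.

Lemma field_of_subfield F : subfield F ->
  exists (E : fieldType) (v : {rmorphism E -> K}), range v = F.
Proof. by move=> sF; apply: field_of_set => // x _ x0; rewrite unitfE. Qed.

Lemma subfield_range (E : fieldType) (v : {rmorphism E -> K}) :
  subfield (range v).
Proof.
apply/subfieldP; split; first by exists 1; rewrite ?rmorph1.
  by move=> _ _ [x _ <-] [y _ <-]; exists (x - y); rewrite ?rmorphB.
by move=> _ _ [x _ <-] [y _ <-]; exists (x / y); rewrite ?fmorph_div.
Qed.

Lemma polyOver_range (E : fieldType) (v : {rmorphism E -> K}) p :
  p \is a polyOver (mem (range v)) <->
  exists q : {poly E}, p = map_poly v q.
Proof.
have v0 : range v 0 by exists 0; rewrite ?rmorph0.
split=> [/(polyOver_setP _ v0) h|[q ->]].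
  have /choice[b hb] : forall n, exists b, v b = p`_n.
    by move=> n; have [c _ <-] := h n; exists c.
exists (\poly_(i < size p) b i); apply/polyP => n.
  rewrite coef_map coef_poly; case: ltnP => [_|np]; first by rewrite -hb.
  by rewrite raddf0 nth_default.
by apply/(polyOver_setP _ v0) => n; rewrite coef_map; exists q`_n.
Qed.

End SetFields.

Section SubfieldTheory.
Context {R : realType} {K : analyticFieldType R}.
Variable (F : set K).
Hypothesis sF : subfield F.

Lemma subfield1 : F 1. Proof. by have [] := (subfieldP F).1 sF. Qed.

Lemma subfieldB x y : F x -> F y -> F (x - y).
Proof. by have [_ h _] := (subfieldP F).1 sF; exact: h. Qed.

Lemma subfield_div x y : F x -> F y -> F (x / y).
Proof. by have [_ _ h] := (subfieldP F).1 sF; exact: h. Qed.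

Lemma subfield0 : F 0. Proof. by rewrite -(subrr 1); apply: subfieldB; exact: subfield1. Qed.

Lemma subfieldN x : F x -> F (- x).
Proof. by rewrite -(sub0r x); apply: subfieldB; exact: subfield0. Qed.

Lemma subfieldD x y : F x -> F y -> F (x + y).
Proof. by move=> Fx Fy; rewrite -(opprK y); apply: subfieldB => //; exact: subfieldN. Qed.

Lemma subfieldV x : F x -> F x^-1.
Proof. by rewrite -(mul1r x^-1); apply: subfield_div; exact: subfield1. Qed.

Lemma subfieldM x y : F x -> F y -> F (x * y).
Proof. by move=> Fx Fy; rewrite -(invrK y); apply: subfield_div => //; exact: subfieldV. Qed.

Lemma subfieldX x n : F x -> F (x ^+ n).
Proof.
move=> Fx; elim: n => [|n IH]; first by rewrite expr0; exact: subfield1.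
by rewrite exprS; exact: subfieldM.
Qed.

Lemma subfield_sum I (r : seq I) (P : pred I) (f : I -> K) :
  (forall i, P i -> F (f i)) -> F (\sum_(i <- r | P i) f i).
Proof. by move=> h; apply: big_ind => //; [exact: subfield0|exact: subfieldD]. Qed.

Lemma subfield_horner (p : {poly K}) x :
  p \is a polyOver (mem F) -> F x -> F p.[x].
Proof.
move=> /(polyOver_setP _ subfield0) pF Fx; rewrite horner_coef.
by apply: subfield_sum => j _; apply: subfieldM => //; exact: subfieldX.
Qed.

Lemma polyOver_comp_XaddC (p : {poly K}) a :
  p \is a polyOver (mem F) -> F a -> p \Po ('X + a%:P) \is a polyOver (mem F).
Proof.
have [E [v vE]] := field_of_subfield sF; rewrite -vE => /polyOver_range[q ->].
by move=> [b _ <-]; apply/polyOver_range; exists (q \Po ('X + b%:P));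
  rewrite map_comp_poly rmorphD /= map_polyX map_polyC.
Qed.

Lemma alg_closed_factor (p : {poly K}) : alg_closed F ->
  p \is a polyOver (mem F) -> exists2 rs : seq K, (forall r, r \in rs -> F r) &
    p = lead_coef p *: \prod_(r <- rs) ('X - r%:P).
Proof.
move=> cF; have [E [v vE]] := field_of_subfield sF.
rewrite -{1}vE => /polyOver_range[q ->]; elim: {q}(size q) {-2}q (leqnn (size q)) => [|n IH] q.
  rewrite leqn0 size_poly_eq0 => /eqP ->; exists [::] => //.
  by rewrite rmorph0 lead_coef0 scale0r.
move=> qn; have [q1|q1] := leqP (size q) 1.
  exists [::] => //; rewrite big_nil alg_polyC.
  by rewrite [LHS]size1_polyC ?size_map_poly// lead_coefE size_map_poly;
   case: (size q) q1 => [|[|]].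
have vqF : map_poly v q \is a polyOver (mem F).
  by rewrite -vE; apply/polyOver_range; exists q.
have [|x] := cF _ vqF; first by rewrite size_map_poly.
rewrite -{1}vE => -[a _ <-]; rewrite fmorph_root => /factor_theorem[q' qE].
have q'0 : q' != 0 by apply: contraTneq q1 => q'0; rewrite qE q'0 mul0r size_poly0.
have [|rs rsF e] := IH q'.
  by rewrite -ltnS (leq_trans _ qn)// qE size_Mmonic ?monicXsubC// size_XsubC addn2.
exists (v a :: rs).
  by move=> r; rewrite inE => /predU1P[->|/rsF//]; rewrite -vE; exists a.
rewrite qE big_cons rmorphM /= lead_coefM rmorphB /= map_polyX map_polyC /=.
by rewrite lead_coefXsubC mulr1 scalerAr -e mulrC.
Qed.

Lemma alg_closed_root (p : {poly K}) z : alg_closed F ->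
  p \is a polyOver (mem F) -> p != 0 -> root p z -> F z.
Proof.
move=> cF pF p0; have [rs rsF ->] := alg_closed_factor cF pF.
rewrite rootZ ?lead_coef_eq0// root_prod_XsubC; exact: rsF.
Qed.

Lemma alg_closedP : alg_closed [set: K] ->
  (forall (p : {poly K}) z, p \is a polyOver (mem F) -> p != 0 -> root p z -> F z) ->
  alg_closed F.
Proof.
move=> cK h p pF p1; have [|x _ px] := cK p _ p1.
  by apply/(polyOver_setP _ _).
by exists x => //; apply: h px => //; rewrite -size_poly_gt0 ltnW.
Qed.

Lemma alg_closure_inP (E : fieldType) (v : {rmorphism E -> K}) z :
  range v = F -> alg_closure_in F z <-> algebraicOver v z.
Proof.
move=> vE; split=> [[p []]|[q q0 qz]].
  rewrite -{1}vE => /polyOver_range[q ->]; rewrite map_poly_eq0 => q0 qz.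
  by exists q.
by exists (map_poly v q); split; rewrite ?map_poly_eq0// -vE;
  apply/polyOver_range; exists q.
Qed.

Lemma sub_alg_closure_in : F `<=` alg_closure_in F.
Proof.
have [E [v vE]] := field_of_subfield sF.
move=> x; rewrite -{1}vE => -[a _ <-]; apply/(alg_closure_inP _ vE).
exact: algebraic_id.
Qed.

Lemma subfield_alg_closure_in : subfield (alg_closure_in F).
Proof.
have [E [v vE]] := field_of_subfield sF; apply/subfieldP; split.
- by apply: sub_alg_closure_in; exact: subfield1.
- move=> x y /(alg_closure_inP _ vE) hx /(alg_closure_inP _ vE) hy.
  by apply/(alg_closure_inP _ vE); exact: algebraic_sub.
- move=> x y /(alg_closure_inP _ vE) hx /(alg_closure_inP _ vE) hy.
  by apply/(alg_closure_inP _ vE); exact: algebraic_div.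
Qed.

End SubfieldTheory.

Lemma alg_closed_alg_closure_in (R : realType) (K : analyticFieldType R)
  (F : set K) : subfield F -> alg_closed [set: K] -> alg_closed (alg_closure_in F).
Proof.
move=> sF cK; have sF' := subfield_alg_closure_in sF.
have [E [v vE]] := field_of_subfield sF.
apply: (alg_closedP cK) => p z.
move=> /(polyOver_setP _ (subfield0 sF')) pF p0 pz.
apply/(alg_closure_inP z vE)/integral_algebraic.
apply: (integral_root p0 pz) => c /(nthP 0)[n _ <-].
by apply/integral_algebraic/(alg_closure_inP _ vE).
Qed.

(** * Ultrametric estimates for values and roots of polynomials *)

Section PolynomialEstimates.
Context {R : realType} {K : analyticFieldType R}.
Implicit Types (x y z : K) (F : set K) (p q : {poly K}) (rs : seq K).

Lemma exprn_leM (M a : R) i n : 1 <= M -> 0 <= a -> a <= M -> (i <= n)%N ->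
  a ^+ i <= M ^+ n.
Proof.
move=> M1 a0 aM ij; apply: (@le_trans _ _ (M ^+ i)).
  by rewrite lerXn2r// nnegrE// (le_trans _ M1).
by rewrite ler_weXn2l.
Qed.

Lemma absv_subr_near x y a b (e : R) : absv (x - a) < e -> absv (y - b) < e ->
  absv (x - y - (a - b)) < e.
Proof.
move=> xa yb; have -> : x - y - (a - b) = (x - a) - (y - b) by ring.
exact: absvB_lt.
Qed.

Lemma absv_mulr_near x y (e : R) : 0 < e -> exists2 d : R, 0 < d &
  forall a b, absv (x - a) < d -> absv (y - b) < d -> absv (x * y - a * b) < e.
Proof.
move=> e0; pose M := Num.max 1 (Num.max (absv x) (absv y)).
have M0 : 0 < M by rewrite lt_max ltr01.
exists (Num.min 1 (e / M)); first by rewrite lt_min ltr01 divr_gt0.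
move=> a b; rewrite !lt_min => /andP[_ xa] /andP[yb1 yb].
have -> : x * y - a * b = x * (y - b) + (x - a) * b by ring.
have hx : absv x <= M by rewrite !le_max lexx orbT.
have hb : absv b <= M.
  rewrite -(subKr y b) absvB_le// ?le_max ?lexx ?orbT//.
  by rewrite (ltW yb1).
apply: absvD_lt; rewrite absvM.
  apply: (@le_lt_trans _ _ (M * absv (y - b))); first by rewrite ler_wpM2r ?absv_ge0.
  by rewrite mulrC -ltr_pdivlMr.
apply: (@le_lt_trans _ _ (absv (x - a) * M)); first by rewrite ler_wpM2l ?absv_ge0.
by rewrite -ltr_pdivlMr.
Qed.

Lemma absv_invr_near y (e : R) : y != 0 -> 0 < e -> exists2 d : R, 0 < d &
  forall b, absv (y - b) < d -> absv (y^-1 - b^-1) < e.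
Proof.
move=> y0 e0; have ay : 0 < absv y by rewrite absv_gt0.
exists (Num.min (absv y) (e * (absv y) ^+ 2)).
  by rewrite lt_min ay mulr_gt0// exprn_gt0.
move=> b; rewrite lt_min => /andP[/absv_near bE yb].
have b0 : b != 0 by rewrite -absv_gt0 bE.
have -> : y^-1 - b^-1 = (b - y) / (y * b) by field; rewrite b0 y0.
by rewrite absv_div absvM bE absv_distC ltr_pdivrMr ?mulr_gt0// -expr2.
Qed.

Lemma horner_absv_le p z (d M : R) n : 0 <= d -> 1 <= M -> absv z <= M ->
  (size p <= n)%N -> (forall j, absv p`_j <= d) -> absv p.[z] <= d * M ^+ n.
Proof.
move=> d0 M1 zM pn pd; rewrite horner_coef.
apply: absv_sum_le => [|j _]; first by rewrite mulr_ge0// exprn_ge0// (le_trans _ M1).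
rewrite absvM absvX ler_pM ?exprn_ge0 ?absv_ge0// exprn_leM ?absv_ge0//.
by rewrite (leq_trans _ pn)// ltnW.
Qed.

Lemma absv_expB x y (M : R) n : 1 <= M -> absv x <= M -> absv y <= M ->
  absv (x ^+ n - y ^+ n) <= absv (x - y) * M ^+ n.
Proof.
move=> M1 xM yM; rewrite subrXX absvM ler_wpM2l ?absv_ge0//.
apply: absv_sum_le => [|j _]; first by rewrite exprn_ge0// (le_trans _ M1).
rewrite absvM !absvX; apply: (@le_trans _ _ (M ^+ (n.-1 - j) * M ^+ j)).
  by rewrite ler_pM ?exprn_ge0 ?absv_ge0// exprn_leM ?absv_ge0.
by rewrite -exprD ler_weXn2l// subnK ?leq_pred// -ltnS prednK//; case: n j => [[]|].
Qed.

Lemma poly_coef_bound p : exists2 c : R, 0 < c & forall j, absv p`_j <= c.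
Proof.
exists (\big[Num.max/1]_(j < size p) absv p`_j).
  by rewrite (lt_le_trans ltr01)// bigmax_ge_id.
move=> j; have [jp|jp] := ltnP j (size p).
  by apply: (@le_bigmax _ _ _ 1 (fun j : 'I_(size p) => absv p`_j) (Ordinal jp)).
by rewrite nth_default// absv0 (le_trans ler01)// bigmax_ge_id.
Qed.

Lemma horner_lipschitz p (M : R) : exists2 c : R, 0 < c &
  forall x y, absv x <= M -> absv y <= M -> absv (p.[x] - p.[y]) <= c * absv (x - y).
Proof.
have [c c0 pc] := poly_coef_bound p.
pose N := Num.max 1 M.
have N1 : 1 <= N by rewrite le_max lexx.
exists (c * N ^+ size p).
  by rewrite mulr_gt0// exprn_gt0// (lt_le_trans ltr01).
move=> x y xM yM; rewrite !horner_coef -sumrB.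
apply: absv_sum_le => [|j _].
  by rewrite mulr_ge0 ?absv_ge0// mulr_ge0 ?(ltW c0)// exprn_ge0// (le_trans ler01).
rewrite -mulrBr absvM -mulrA ler_pM ?absv_ge0// mulrC.
rewrite (le_trans (@absv_expB x y N j _ _ _))// ?le_max ?xM ?yM ?orbT//.
by rewrite ler_wpM2l ?absv_ge0// ler_weXn2l// ltnW.
Qed.

(** [|p(z)|] is [|c|] times the product of the [|z - r|], and these cannot all be at least [e]. *)
Lemma root_near p rs (c z : K) (e : R) : 0 <= e ->
  p = c *: \prod_(r <- rs) ('X - r%:P) ->
  absv p.[z] < absv c * e ^+ size rs -> exists2 r, r \in rs & absv (z - r) < e.
Proof.
move=> e0 -> ; rewrite hornerZ absvM horner_prod absv_prod => h.
apply: contrapT => hn; move: h; apply/negP; rewrite -leNgt ler_wpM2l ?absv_ge0//.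
elim: rs hn => [|r rs IH] hn; first by rewrite big_nil.
rewrite big_cons exprS ler_pM ?exprn_ge0//.
  rewrite hornerXsubC leNgt; apply/negP => h; apply: hn.
  by exists r; rewrite ?mem_head.
by apply: IH => -[s srs h]; apply: hn; exists s; rewrite ?inE ?srs ?orbT.
Qed.

Lemma size_prod_roots p rs (c : K) : c != 0 ->
  p = c *: \prod_(r <- rs) ('X - r%:P) -> size p = (size rs).+1.
Proof. by move=> c0 ->; rewrite size_scale// size_prod_XsubC. Qed.

(** For [|z| > M] the leading term would dominate all the others strictly. *)
Lemma root_absv_le p z (M : R) : (1 < size p)%N -> 1 <= M ->
  (forall j, absv p`_j <= absv (lead_coef p) * M) -> root p z -> absv z <= M.
Proof.
move=> p1 M1 pM pz.
rewrite leNgt; apply/negP => Mz; have z1 := le_lt_trans M1 Mz.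
have p0 : p != 0 by rewrite -size_poly_gt0 ltnW.
have [d dE] : exists d, size p = d.+2 by case: (size p) p1 => [|[|d]]// _; exists d.
have lE : lead_coef p = p`_d.+1 by rewrite lead_coefE dE.
have l0 : 0 < absv (lead_coef p) by rewrite absv_gt0 lead_coef_eq0.
move: pz; rewrite /root horner_coef dE big_ord_recr /= -lE addr_eq0 => /eqP/(congr1 absv).
rewrite absvN absvM absvX => e.
suff : absv (\sum_(j < d.+1) p`_j * z ^+ j) < absv (lead_coef p) * absv z ^+ d.+1.
  by rewrite e ltxx.
apply: (@le_lt_trans _ _ (absv (lead_coef p) * M * absv z ^+ d)).
  apply: absv_sum_le => [|j _].
    by rewrite !mulr_ge0 ?exprn_ge0 ?absv_ge0// (le_trans ler01 M1).
  rewrite absvM absvX ler_pM ?exprn_ge0 ?absv_ge0//.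
  by rewrite ler_weXn2l ?(ltW z1)// -ltnS.
by rewrite -mulrA ltr_pM2l// exprS ltr_pM2r// exprn_gt0// (lt_trans ltr01).
Qed.

End PolynomialEstimates.

Section ClosureOfSubfield.
Context {R : realType} {K : analyticFieldType R}.
Variable F : set K.
Hypothesis sF : subfield F.

Lemma subfield_closure : subfield (closure F).
Proof.
have cV y : closure F y -> closure F y^-1.
  have [->|y0] := eqVneq y 0; first by rewrite invr0.
  move/closure_absvP => cy; apply/closure_absvP => e e0.
  have [d d0 hd] := absv_invr_near y0 e0; have [b Fb /hd yb] := cy d d0.
  by exists b^-1; first exact: subfieldV.
have cM x y : closure F x -> closure F y -> closure F (x * y).
  move=> /closure_absvP cx /closure_absvP cy; apply/closure_absvP => e e0.
  have [d d0 hd] := absv_mulr_near x y e0.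
  have [b Fb yb] := cy d d0; have [a Fa xa] := cx d d0.
  by exists (a * b); [exact: subfieldM|exact: hd].
apply/subfieldP; split.
- by apply: subset_closure; exact: subfield1.
- move=> x y /closure_absvP cx /closure_absvP cy; apply/closure_absvP => e e0.
  have [a Fa xa] := cx e e0; have [b Fb yb] := cy e e0.
  by exists (a - b); [exact: subfieldB|exact: absv_subr_near].
- by move=> x y cx cy; apply: cM => //; exact: cV.
Qed.

(* Continuity of roots: approximating the coefficients by elements of [F] gives
   polynomials whose roots can be chosen to form a Cauchy sequence. *)
Lemma alg_closed_closure : alg_closed F -> alg_closed (closure F).
Proof.
move=> cF p /(polyOver_setP _ (subfield0 subfield_closure)) pF p1.
have [c c0 pc] := poly_coef_bound p.
have p0 : p != 0 by rewrite -size_poly_gt0 ltnW.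
have l0 : 0 < absv (lead_coef p) by rewrite absv_gt0 lead_coef_eq0.
pose l := absv (lead_coef p).
(* [M] bounds the roots of all the approximations [g n] below: their coefficients are at most
   [max(c, l)], and their leading coefficients have absolute value [l]. *)
pose M := Num.max 1 (Num.max c l / l).
have M1 : 1 <= M by rewrite le_max lexx.
have M0 : 0 < M := lt_le_trans ltr01 M1.
pose d := (size p).-1; have dE : size p = d.+1 by rewrite prednK// ltnW.
have d0 : (0 < d)%N by rewrite -ltnS -dE.
pose e n : R := n.+1%:R^-1.
have e0 n : 0 < e n by rewrite invr_gt0 ltr0n.
(* The bound [l / 2] preserves the absolute value of the leading coefficient. The other one makes
   [|p - g n|] smaller than [l * e n ^ d] on the ball of radius [M], so that each root of [g n] has
   a root of [g n.+1] closer than [e n]. *)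
pose del n := Num.min (l / 2) (l * e n ^+ d / M ^+ size p / 2).
have del0 n : 0 < del n.
  by rewrite lt_min !divr_gt0 ?mulr_gt0 ?exprn_gt0.
have /choice[g hg] : forall n, exists g : {poly K}, [/\ forall j, F g`_j,
    size g = size p, absv (lead_coef g) = l & forall j, absv (p - g)`_j <= del n].
  move=> n; have /choice[b hb] : forall j, exists b, F b /\ absv (p`_j - b) < del n.
    by move=> j; have /closure_absvP/(_ _ (del0 n))[b Fb hb] := pF j; exists b.
  have bl : absv (b d) = l.
    rewrite /l lead_coefE; apply: absv_near; rewrite (lt_trans (hb d).2)//.
    by rewrite gt_min -lead_coefE -/l ltr_pdivrMr// mulr_natr mulr2n ltrDl l0.
  have sg : size (\poly_(j < size p) b j) = size p.
    by rewrite size_poly_eq// -absv_gt0 bl.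
  exists (\poly_(j < size p) b j); split=> //.
  - move=> j; rewrite coef_poly; case: ifP => _; first exact: (hb j).1.
    exact: subfield0.
  - by rewrite lead_coefE sg coef_poly dE leqnn.
  - move=> j; rewrite coefB coef_poly; case: ltnP => [_|jp].
      by rewrite ltW// (hb j).2.
    by rewrite nth_default// subr0 absv0 ltW.
have gF n : g n \is a polyOver (mem F).
  by apply/(polyOver_setP _ (subfield0 sF)); have [] := hg n.
have groot n z : root (g n) z -> absv z <= M.
  have [_ sg lg hd] := hg n; apply: root_absv_le; rewrite ?sg// => j.
  rewrite lg; apply: (@le_trans _ _ (Num.max c l)).
    rewrite -(subKr p (g n)) coefB absvB_le// ?le_max ?pc//.
    apply/orP; right; rewrite (le_trans (hd j))//.
    by rewrite ge_min ler_pdivrMr// mulr_natr mulr2n lerDl ltW.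
  by rewrite -ler_pdivrMl// mulrC le_max lexx orbT.
have pg n z : absv z <= M -> absv (p - g n).[z] < l * e n ^+ d.
  move=> zM; have [_ sg lg hd] := hg n.
  apply: (@le_lt_trans _ _ (del n * M ^+ size p)).
    apply: horner_absv_le => //; first exact: ltW.
    by rewrite (leq_trans (size_polyD _ _))// size_polyN sg maxnn.
  apply: (@le_lt_trans _ _ (l * e n ^+ d / 2)).
    rewrite -ler_pdivlMr ?exprn_gt0// ge_min mulrAC; apply/orP; right.
    by rewrite lexx.
  by rewrite ltr_pdivrMr// mulr_natr mulr2n ltrDl mulr_gt0// exprn_gt0.
have e_le m n : (m <= n)%N -> l * e n ^+ d <= l * e m ^+ d.
  move=> mn; rewrite ler_pM2l// lerXn2r// ?nnegrE ?(ltW (e0 _))//.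
  by rewrite lef_pV2 ?posrE ?ltr0n// ler_nat.
have step n z : exists w, root (g n) z -> root (g n.+1) w /\ absv (z - w) < e n.
  have [gz|] := boolP (root (g n) z); last by exists 0.
  have [_ sg lg _] := hg n.+1.
  have [rs rsF gE] := alg_closed_factor sF cF (gF n.+1).
  have gn0 : lead_coef (g n.+1) != 0 by rewrite -absv_gt0 lg.
  have rsd : size rs = d.
    by apply: succn_inj; rewrite -(size_prod_roots gn0 gE) sg dE.
  have [||w wrs zw] := @root_near _ _ _ _ _ z (e n) _ gE; first exact: ltW.
    rewrite lg rsd -(subKr p (g n.+1)) hornerD hornerN.
    have -> : p.[z] = (p - g n).[z] by rewrite hornerD hornerN (rootP gz) subr0.
    have zM := groot _ _ gz; rewrite absvB_lt ?pg//.
    by rewrite (lt_le_trans (pg _ _ zM))// e_le.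
  exists w => _; split=> //.
  by rewrite gE rootZ// root_prod_XsubC.
have [z0 _ gz0] : exists2 z, F z & root (g 0%N) z.
  by apply: cF => //; have [_ ->] := hg 0%N.
have /choice[w hw] : forall nz : nat * K, exists w,
    root (g nz.1) nz.2 -> root (g nz.1.+1) w /\ absv (nz.2 - w) < e nz.1.
  by move=> [n z]; exact: step.
pose u := fix u n := if n is m.+1 then w (m, u m) else z0.
have gu n : root (g n) (u n).
  by elim: n => [//|n IH]; have [] := hw (n, u n) IH.
have us n : absv (u n - u n.+1) < e n by have [] := hw (n, u n) (gu n).
have uc n k : absv (u n - u (n + k)%N) < e n.
  elim: k => [|k IH]; first by rewrite addn0 subrr absv0.
  apply: (absv_dist_lt IH); rewrite addnS (lt_le_trans (us _))//.
  by rewrite lef_pV2 ?posrE ?ltr0n// ler_nat ltnS leq_addr.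
have [|v uv] := @complete_absv _ _ u.
  move=> eps /small_inv[N hN]; exists N => n m Nn Nm.
  rewrite (@absv_dist_lt _ _ _ _ (u N))//.
    by rewrite absv_distC -(subnKC Nn) (lt_trans (uc _ _))// hN.
  by rewrite -(subnKC Nm) (lt_trans (uc _ _))// hN.
have vM : absv v <= M.
  have [N hN] := uv 1 ltr01; rewrite -(subrK (u N) v) absvD_le ?(groot _ _ (gu N))//.
  by rewrite (le_trans _ M1)// absv_distC ltW// hN.
exists v.
  apply/closure_absvP => eps eps0.
  have [N hN] := uv eps eps0; exists (u N); last by rewrite absv_distC hN.
  apply: (alg_closed_root sF cF (gF N)) => //.
  by rewrite -lead_coef_eq0 -absv_gt0; have [_ _ -> _] := hg N.
apply/rootP/eqP; rewrite -[_ == 0]negbK -absv_gt0; apply/negP => pv.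
have [C C0 hC] := horner_lipschitz p M.
have [N1 hN1] := uv (absv p.[v] / C) (divr_gt0 pv C0).
have [N2 hN2] := small_inv (divr_gt0 pv l0).
suff : absv p.[v] < absv p.[v] by rewrite ltxx.
pose N := maxn N1 N2.
rewrite -[in X in X < _](subrK p.[u N] p.[v]) absvD_lt//.
  rewrite (le_lt_trans (hC _ _ _ _)) ?(groot _ _ (gu N))//.
  by rewrite absv_distC mulrC -ltr_pdivlMr// hN1// leq_maxl.
have -> : p.[u N] = (p - g N).[u N] by rewrite hornerD hornerN (rootP (gu N)) subr0.
rewrite (lt_trans (pg _ _ (groot _ _ (gu N))))//.
rewrite mulrC -ltr_pdivlMr// (le_lt_trans _ (hN2 N (leq_maxr _ _)))//.
rewrite -/(e N) -[leRHS]expr1 ler_wiXn2l ?(ltW (e0 _))//.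
by rewrite invf_le1 ?ltr0n// ler1n.
Qed.

End ClosureOfSubfield.

Definition acf (R : realType) (K : analyticFieldType R) (F : set K) :=
  [/\ subfield F, closed F & alg_closed F].

(* [ta_closure i idfun S] is [ta_span (range i) S]. *)
Definition ta_span (R : realType) (K : analyticFieldType R) (B S : set K) : set K :=
  closure (alg_closure_in (adjoin B S)).

Section Span.
Context {R : realType} {K : analyticFieldType R}.
Implicit Types (x y z : K) (B F S : set K) (p q : {poly K}).

Lemma subfieldT : subfield [set: K].
Proof. by apply/subfieldP; split. Qed.

Lemma acf_subfield F : acf F -> subfield F. Proof. by case. Qed.

Lemma acf_root F p z : acf F -> p \is a polyOver (mem F) -> p != 0 -> root p z -> F z.
Proof. by move=> [sF _ cF]; exact: alg_closed_root. Qed.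

Lemma acf_factor F p : acf F -> p \is a polyOver (mem F) ->
  exists2 rs : seq K, (forall r, r \in rs -> F r) &
    p = lead_coef p *: \prod_(r <- rs) ('X - r%:P).
Proof. by move=> [sF _ cF] pF; exact: alg_closed_factor. Qed.

Lemma acf_setT : alg_closed [set: K] -> acf [set: K].
Proof. by split; [exact: subfieldT|exact: closedT|]. Qed.

Lemma adjoin_subfield B S : subfield (adjoin B S).
Proof.
apply/subfieldP; split=> [|x y hx hy|x y hx hy] F [sF BSF].
- exact: subfield1.
- by apply: (subfieldB sF); [exact: hx|exact: hy].
- by apply: (subfield_div sF); [exact: hx|exact: hy].
Qed.

Lemma sub_adjoinl B S : B `<=` adjoin B S.
Proof. by move=> x Bx F [_]; apply; left. Qed.

Lemma sub_adjoinr B S : S `<=` adjoin B S.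
Proof. by move=> x Sx F [_]; apply; right. Qed.

Lemma adjoin_min B S F : subfield F -> B `<=` F -> S `<=` F -> adjoin B S `<=` F.
Proof. by move=> sF BF SF; apply: smallest_sub => // x [/BF|/SF]. Qed.

Lemma sub_span B S : adjoin B S `<=` ta_span B S.
Proof.
move=> x hx; apply: subset_closure; apply: sub_alg_closure_in => //.
exact: adjoin_subfield.
Qed.

Lemma sub_spanl B S : B `<=` ta_span B S.
Proof. exact: subset_trans (@sub_adjoinl B S) (@sub_span B S). Qed.

Lemma sub_spanr B S : S `<=` ta_span B S.
Proof. exact: subset_trans (@sub_adjoinr B S) (@sub_span B S). Qed.

Lemma mem_ta_span1 B x : ta_span B [set x] x.
Proof. exact: sub_spanr. Qed.

Lemma span_acf B S : alg_closed [set: K] -> acf (ta_span B S).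
Proof.
move=> cK; have sA := adjoin_subfield B S; split.
- exact: subfield_closure (subfield_alg_closure_in sA).
- exact: closed_closure.
- apply: alg_closed_closure; first exact: subfield_alg_closure_in.
  exact: alg_closed_alg_closure_in.
Qed.

Lemma span_min B S F : acf F -> B `<=` F -> S `<=` F -> ta_span B S `<=` F.
Proof.
move=> aF BF SF; have [sF clF cF] := aF.
rewrite [F in _ `<=` F](closure_id F).1//; apply: closureS => z [p [pA p0 pz]].
apply: (acf_root aF _ p0 pz); apply/(polyOver_setP _ (subfield0 sF)) => n.
apply: (adjoin_min sF BF SF); move: n.
by apply/polyOver_setP => //; apply: subfield0; exact: adjoin_subfield.
Qed.

Lemma span_sub B B' S S' : alg_closed [set: K] ->
  B `<=` ta_span B' S' -> S `<=` ta_span B' S' -> ta_span B S `<=` ta_span B' S'.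
Proof. by move=> cK; apply: span_min; exact: span_acf. Qed.

Lemma span1_sub B x F : acf F -> B `<=` F -> F x -> ta_span B [set x] `<=` F.
Proof. by move=> aF BF Fx; apply: span_min => // _ ->. Qed.

Lemma adjoin1_fraction F x z : subfield F -> adjoin F [set x] z ->
  exists g h : {poly K}, [/\ g \is a polyOver (mem F), h \is a polyOver (mem F),
    h.[x] != 0 & z = g.[x] / h.[x]].
Proof.
move=> sF; have [E [v vE]] := field_of_subfield sF.
suff sub : adjoin F [set x] `<=` [set z | exists g h : {poly E},
    (map_poly v h).[x] != 0 /\ z = (map_poly v g).[x] / (map_poly v h).[x]].
  move=> /sub[g [h [h0 ->]]]; exists (map_poly v g), (map_poly v h).
  by split=> //; rewrite -vE; apply/polyOver_range; eexists.
apply: adjoin_min.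
- apply/subfieldP; split.
  + by exists 1, 1; rewrite rmorph1 hornerC oner_neq0 divr1.
  + move=> _ _ [g [h [h0 ->]]] [g' [h' [h'0 ->]]].
    exists (g * h' - g' * h), (h * h'); rewrite rmorphB !rmorphM /= !hornerE.
    by split; [rewrite mulf_neq0|field; rewrite h0 h'0].
  + move=> _ _ [g [h [h0 ->]]] [g' [h' [h'0 ->]]].
    have [g'0|g'0] := eqVneq (map_poly v g').[x] 0.
      exists 0, 1; rewrite rmorph0 rmorph1 !hornerE oner_neq0 g'0.
      by rewrite !(mul0r, invr0, mulr0).
    exists (g * h'), (h * g'); rewrite !rmorphM /= !hornerE.
    by split; [rewrite mulf_neq0|field; rewrite h0 h'0 g'0].
- rewrite -vE => _ [a _ <-]; exists a%:P, 1.
  by rewrite rmorph1 map_polyC !hornerE oner_neq0 divr1.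
- by move=> _ ->; exists 'X, 1; rewrite rmorph1 map_polyX !hornerE oner_neq0 divr1.
Qed.

Lemma common_denominator F x (c : nat -> K) n : subfield F ->
  (forall j, adjoin F [set x] (c j)) ->
  exists h : {poly K}, [/\ h \is a polyOver (mem F), h.[x] != 0 &
    forall j, (j < n)%N -> exists2 g : {poly K},
      g \is a polyOver (mem F) & g.[x] = h.[x] * c j].
Proof.
move=> sF hc; have [E [v vE]] := field_of_subfield sF.
have MF p q : p \is a polyOver (mem F) -> q \is a polyOver (mem F) ->
    p * q \is a polyOver (mem F).
  rewrite -vE => /polyOver_range[p' ->] /polyOver_range[q' ->].
  by apply/polyOver_range; exists (p' * q'); rewrite rmorphM.
elim: n => [|n [h [hF h0 hn]]].
  exists 1; split=> //; last by rewrite hornerC oner_neq0.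
  by rewrite -vE; apply/polyOver_range; exists 1; rewrite rmorph1.
have [g' [h' [g'F h'F h'0 cE]]] := adjoin1_fraction sF (hc n).
exists (h * h'); split; [exact: MF|by rewrite hornerM mulf_neq0|].
move=> j; rewrite ltnS leq_eqVlt => /predU1P[->|/hn[g gF gE]].
  exists (h * g'); first exact: MF.
  by rewrite !hornerM cE -mulrA; congr (_ * _); rewrite mulrC divfK.
exists (g * h'); first exact: MF.
by rewrite !hornerM gE; ring.
Qed.

(** Denominators are cleared so that the relation between [x] and [z] is a polynomial in two
    variables over [F], which can be expanded around other centres and specialised at other values
    of [x]. *)
Lemma algebraic_adjoin1 F x z : subfield F ->
  alg_closure_in (adjoin F [set x]) z ->
  exists P : {poly {poly K}}, [/\ forall j, P`_j \is a polyOver (mem F),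
    map_poly (horner_eval x) P != 0 & root (map_poly (horner_eval x) P) z].
Proof.
move=> sF [p [/(polyOver_setP _ (subfield0 (adjoin_subfield _ _))) pA p0 pz]].
have [h [hF h0 hn]] := common_denominator (size p) sF pA.
have F0 := subfield0 sF.
have /choice[g hg] : forall j, exists g : {poly K},
    g \is a polyOver (mem F) /\ g.[x] = h.[x] * p`_j.
  move=> j; have [/hn[g gF gE]|jp] := ltnP j (size p); first by exists g.
  exists 0; rewrite nth_default// mulr0 horner0; split=> //.
  by apply/(polyOver_setP _ F0) => n; rewrite coef0.
exists (\poly_(j < size p) g j).
have -> : map_poly (horner_eval x) (\poly_(j < size p) g j) = h.[x] *: p.
  apply/polyP => j; rewrite coef_map coef_poly coefZ.
  case: ltnP => [_|jp]; first by rewrite /= /horner_eval (hg j).2.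
  by rewrite raddf0 nth_default// mulr0.
split=> [j||]; last by rewrite rootZ.
  rewrite coef_poly; case: ifP => _; first exact: (hg j).1.
  by apply/(polyOver_setP _ F0) => n; rewrite coef0.
by rewrite scaler_eq0 negb_or h0.
Qed.

End Span.

Arguments mem_ta_span1 {R K} B x.

Section Transport.
Context {R : realType} {K L : analyticFieldType R}.
Variable f : {rmorphism K -> L}.
Hypothesis fi : isometric f.

Lemma isometricB x y : absv (f x - f y) = absv (x - y).
Proof. by rewrite -rmorphB fi. Qed.

Lemma acf_image F : acf F -> acf (f @` F).
Proof.
move=> [sF clF cF].
have [E [v vE]] := field_of_subfield sF.
have fvE : range (f \o v) = f @` F.
  by rewrite -vE image_comp.
have sf : subfield (f @` F) by rewrite -fvE; exact: (subfield_range (f \o v)).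
split=> //.
  apply/complete_closed => u hu /cauchy_absvP uc.
  have /choice[w hw] : forall n, exists a, F a /\ f a = u n.
    by move=> n; have [a Fa <-] := hu n; exists a.
  have [|l lF /cvg_absvP ul] := (complete_closed F).2 clF w (fun n => (hw n).1).
    apply/cauchy_absvP => e e0; have [N hN] := uc e e0; exists N => n m Nn Nm.
    by rewrite -isometricB (hw n).2 (hw m).2 hN.
  exists (f l); first by exists l.
  apply/cvg_absvP => e e0; have [N hN] := ul e e0; exists N => n Nn.
  by rewrite -(hw n).2 isometricB hN.
move=> p; rewrite -fvE => /(polyOver_range (f \o v))[q ->].
rewrite map_poly_comp size_map_poly => q1.
have [|x Fx qx] := cF (map_poly v q) _ q1.
  by rewrite -vE; apply/polyOver_range; exists q.
by exists (f x); [rewrite fvE; exists x|rewrite fmorph_root].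
Qed.

Lemma acf_preimage F : alg_closed [set: K] -> acf F -> acf (f @^-1` F).
Proof.
move=> cK aF; have [sF clF cF] := aF.
have sf : subfield (f @^-1` F).
  apply/subfieldP; split; rewrite /preimage/=.
  - by rewrite rmorph1; exact: subfield1.
  - by move=> x y Fx Fy; rewrite rmorphB; exact: subfieldB.
  - by move=> x y Fx Fy; rewrite fmorph_div; exact: subfield_div.
split=> //.
  apply/closed_absvP => x hx; move/closed_absvP: clF; apply => e /hx[a Fa xa].
  by exists (f a); rewrite ?isometricB.
apply: (alg_closedP cK) => p z /(polyOver_setP _ (subfield0 sf)) pF p0 pz.
apply: (acf_root aF _ (p := map_poly f p)); rewrite ?map_poly_eq0 ?fmorph_root//.
by apply/(polyOver_setP _ (subfield0 sF)) => n; rewrite coef_map; exact: pF.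
Qed.

End Transport.

(** * Distances to subfields *)

Section Distance.
Context {R : realType} {K : analyticFieldType R}.
Implicit Types (x y z : K) (F : set K).

Definition dist F x : R := inf [set absv (x - b) | b in F].

Lemma dist_le F x b : F b -> dist F x <= absv (x - b).
Proof.
move=> Fb; apply: ge_inf; last by exists b.
by exists 0 => _ [c _ <-]; exact: absv_ge0.
Qed.

Lemma dist_lt F x (t : R) : F !=set0 -> dist F x < t ->
  exists2 b, F b & absv (x - b) < t.
Proof.
move=> [b Fb] dt; have [|_ [c Fc <-] ct] := inf_lt _ dt; last by exists c.
by exists (absv (x - b)); exists b.
Qed.

Lemma dist_ge F x (t : R) : F !=set0 -> (forall b, F b -> t <= absv (x - b)) ->
  t <= dist F x.
Proof.
move=> [b Fb] h; apply: lb_le_inf; first by exists (absv (x - b)); exists b.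
by move=> _ [c Fc <-]; exact: h.
Qed.

Lemma dist_subset F G x : F !=set0 -> F `<=` G -> dist G x <= dist F x.
Proof. by move=> F0 FG; apply: dist_ge => // b /FG; exact: dist_le. Qed.

Lemma dist_gt0 F x : F !=set0 -> closed F -> ~ F x -> 0 < dist F x.
Proof.
move=> F0 /closed_absvP clF nFx; rewrite ltNge; apply/negP => d0; apply: nFx.
apply: clF => e e0; apply: dist_lt => //; exact: le_lt_trans d0 e0.
Qed.

Lemma subfield_nonempty F : subfield F -> F !=set0.
Proof. by move=> /subfield0 ?; exists 0. Qed.

End Distance.

Section GaussNorm.
Context {R : realType} {K : analyticFieldType R}.
Implicit Types (x y z : K) (F : set K) (p q : {poly K}).

Lemma coefXsubCM (r : K) p n :
  (('X - r%:P) * p)`_n = (if n == 0 then 0 else p`_n.-1) - r * p`_n.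
Proof. by rewrite mulrBl coefB coefXM coefCM. Qed.

(* If [x] is, up to the factor [l], as far from [F] as from [0], then
   [|p(x)|] is, up to a power of [l], the Gauss norm of [p] of radius [|x|]. *)
Lemma coef_le_horner F p x (l : R) : subfield F -> alg_closed F ->
  p \is a polyOver (mem F) -> 1 <= l ->
  (forall b, F b -> absv x <= l * absv (x - b)) ->
  forall n, absv p`_n * absv x ^+ n <= l ^+ size p * absv p.[x].
Proof.
move=> sF cF pF l1 hx n; have l0 := le_trans ler01 l1.
have [->|p0] := eqVneq p 0.
  by rewrite coef0 horner0 absv0 mulr0 mul0r.
have [rs rsF pE] := alg_closed_factor sF cF pF.
have lp0 : lead_coef p != 0 by rewrite lead_coef_eq0.
rewrite (size_prod_roots lp0 pE) pE coefZ hornerZ !absvM -mulrA [leRHS]mulrCA.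
rewrite ler_wpM2l ?absv_ge0//.
(* Each linear factor costs one factor [l]; the size of [p] exceeds the number of roots by one. *)
apply: (@le_trans _ _ (l ^+ size rs * absv (\prod_(r <- rs) ('X - r%:P)).[x])); last first.
  by rewrite ler_wpM2r ?absv_ge0// ler_weXn2l.
elim: rs {pE} rsF n => [|r rs IH] rsF n.
  rewrite big_nil coef1 hornerC absv1 expr0 !mulr1.
  by case: n => [|n]; rewrite ?absv1 ?expr0 ?mulr1// absv0 mul0r.
have {}IH n' := IH (fun s srs => rsF s (mem_behead (s := r :: rs) srs)) n'.
have Fr := rsF r (mem_head _ _).
rewrite big_cons coefXsubCM hornerM hornerXsubC absvM /= exprS.
set q := \prod_(s <- rs) _ in IH *.
have rl : absv r <= l * absv (x - r).
  have xr : absv (x - r) <= l * absv (x - r) by rewrite ler_peMl ?absv_ge0.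
  by have := absvB_le (hx r Fr) xr; rewrite subKr.
have aux (a b : K) m : absv a <= l * absv (x - r) ->
    absv b * absv x ^+ m <= l ^+ size rs * absv q.[x] ->
    absv (a * b) * absv x ^+ m <= l * l ^+ size rs * (absv (x - r) * absv q.[x]).
  by move=> ha hb; rewrite absvM -mulrA mulrACA ler_pM ?mulr_ge0 ?exprn_ge0 ?absv_ge0.
have xn0 m : 0 <= absv x ^+ m by rewrite exprn_ge0// absv_ge0.
rewrite (le_trans (ler_wpM2r (xn0 n) (absvB _ _)))//.
rewrite maxr_pMl// ge_max; apply/andP; split; last exact: aux.
case: n => [|n] /=.
  by rewrite absv0 mul0r !mulr_ge0 ?exprn_ge0 ?absv_ge0.
rewrite exprS mulrCA mulrA -(absvM x); apply: aux => //.
exact: hx.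
Qed.

(* The Gauss norm of radius [rho] is multiplicative on linear factors. *)
Lemma horner_le_coef (c : K) (zs : seq K) (rho : R) : 0 < rho -> c != 0 ->
  exists n, absv c * \prod_(z <- zs) Num.max rho (absv z) <=
            absv (c *: \prod_(z <- zs) ('X - z%:P))`_n * rho ^+ n.
Proof.
move=> r0 c0; elim: zs => [|z zs [n IH]].
  by exists 0; rewrite !big_nil coefZ coef1 !mulr1.
rewrite big_cons big_cons scalerAr mulrCA.
set A := absv c * _ in IH *; set q := c *: _ in IH *.
have A0 : 0 < A.
  rewrite mulr_gt0 ?absv_gt0//; apply: prodr_gt0 => w _.
  by rewrite lt_max r0.
apply: contrapT => /forallNP h.
have {}h m : absv ((('X - z%:P) * q)`_m) * rho ^+ m < Num.max rho (absv z) * A.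
  by rewrite ltNge; apply/negP; exact: h.
suff : absv q`_n * rho ^+ n < A by rewrite ltNge IH.
(* The relation [((X - z) q)_(m+1) = q_m - z q_(m+1)] makes all coefficients of [q] small: by
   descent from the degree if [|z| <= rho], and by ascent from 0 if [|z| > rho]. *)
have [zr|rz] := leP (absv z) rho.
  move: h; rewrite (max_idPl zr) => h.
  have {IH} : forall k m, (size q <= m + k)%N -> absv q`_m * rho ^+ m < A.
    elim=> [|k IHk] m; first by rewrite addn0 => qm; rewrite nth_default// absv0 mul0r.
    rewrite addnS -addSn => /IHk {}IHk.
    have := h m.+1; rewrite coefXsubCM /= => hm.
    rewrite -(ltr_pM2l r0) mulrCA -exprS -(subrK (z * q`_m.+1) q`_m).
    rewrite (le_lt_trans (ler_wpM2r _ (absvD _ _))) ?exprn_ge0 ?(ltW r0)//.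
    rewrite maxr_pMl ?exprn_ge0 ?(ltW r0)// gt_max hm absvM -mulrA.
    apply: (@le_lt_trans _ _ (rho * (absv q`_m.+1 * rho ^+ m.+1))).
      by rewrite ler_wpM2r// mulr_ge0 ?exprn_ge0 ?absv_ge0 ?(ltW r0).
    by rewrite ltr_pM2l.
  by apply; exact: leq_addl.
move: h; rewrite (max_idPr (ltW rz)) => h; have z0 := lt_trans r0 rz.
have {IH} : forall m, absv q`_m * rho ^+ m < A.
  elim=> [|m IHm].
    by have := h 0%N; rewrite coefXsubCM sub0r absvN absvM -mulrA ltr_pM2l.
  have := h m.+1; rewrite coefXsubCM /= => hm.
  rewrite -(ltr_pM2l z0) mulrA -absvM -(subKr q`_m (z * _)).
  rewrite (le_lt_trans (ler_wpM2r _ (absvB _ _))) ?exprn_ge0 ?(ltW r0)//.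
  rewrite maxr_pMl ?exprn_ge0 ?(ltW r0)// gt_max hm andbT exprS mulrCA.
  apply: (@le_lt_trans _ _ (absv z * (absv q`_m * rho ^+ m))).
    by rewrite ler_wpM2r ?(ltW rz)// mulr_ge0 ?exprn_ge0 ?absv_ge0 ?(ltW r0).
  by rewrite ltr_pM2l.
exact.
Qed.

(** Distances need not be attained, so the estimates below lose a fixed power of some [l > 1]; this
    lets [l] tend to 1. *)
Lemma exprn_lt_gt1 (t : R) n : 1 < t -> exists2 l : R, 1 < l & l ^+ n < t.
Proof.
move=> t1; elim: n => [|n [l l1 lt]]; first by exists 2; rewrite ?ltr1n.
have l0 : 0 < l ^+ n by rewrite exprn_gt0// (lt_trans ltr01).
have t2 : 1 < t / l ^+ n by rewrite ltr_pdivlMr// mul1r.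
have [m /andP[m1 mt]] : exists m, 1 < m < t / l ^+ n.
  by exists (((1 + t / l ^+ n) / 2)); rewrite midf_lt// andbC midf_lt.
have m0 := lt_trans ltr01 m1; have l0' := lt_trans ltr01 l1.
exists (Num.min l m); first by rewrite lt_min l1.
rewrite exprS; apply: (@le_lt_trans _ _ (m * l ^+ n)); last by rewrite -ltr_pdivlMr.
rewrite ler_pM ?exprn_ge0// ?le_min ?ge_min ?lexx ?orbT ?(ltW m0) ?(ltW l0')//.
by rewrite lerXn2r ?nnegrE ?le_min ?ge_min ?lexx ?orbT ?(ltW m0) ?(ltW l0').
Qed.

Lemma prod_max_gt (s : R) y (zs : seq K) z : 0 < s -> z \in zs -> absv (y - z) < s ->
  \prod_(w <- zs) absv (y - w) < \prod_(w <- zs) Num.max s (absv (y - w)).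
Proof.
move=> s0 zzs yz; rewrite (big_rem z)//= [ltRHS](big_rem z)//=.
apply: (@le_lt_trans _ _
    (absv (y - z) * \prod_(w <- rem z zs) Num.max s (absv (y - w)))).
  rewrite ler_wpM2l ?absv_ge0//; apply: ler_prod => w _.
  by rewrite absv_ge0 le_max lexx orbT.
rewrite ltr_pM2r ?lt_max ?yz//; apply: prodr_gt0 => w _.
by rewrite lt_max s0.
Qed.

Lemma horner_comp_XaddC p x a : (p \Po ('X + a%:P)).[x - a] = p.[x].
Proof. by rewrite horner_comp hornerD hornerX hornerC subrK. Qed.

Lemma size_comp_XaddC p a : size (p \Po ('X + a%:P)) = size p.
Proof. by rewrite size_comp_poly2// -(opprK a%:P) -polyCN size_XsubC. Qed.

End GaussNorm.

(** * Strict decrease of the distance to a generator *)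

Section Rigidity.
Context {R : realType} {K : analyticFieldType R}.
Hypothesis K_closed : alg_closed [set: K].
Implicit Types (x y z : K) (F : set K).

(** Provides the hypothesis of [coef_le_horner] after a translation by an element [c] that attains
    the distance up to the factor [l]. *)
Lemma subfield_shift F x c (l : R) : subfield F -> 0 < l ->
  absv (x - c) <= l * dist F x -> F c ->
  forall b, F b -> absv (x - c) <= l * absv (x - c - b).
Proof.
move=> sF l0 xc Fc b Fb; apply: (le_trans xc); rewrite ler_pM2l//.
by rewrite -addrA -opprD; apply: dist_le; exact: subfieldD.
Qed.

(* Write [P(x, y)] for a polynomial [P] over [F0] such that [P(x, -)] has a root
   [z] with [|y - z| < dist F0 y].  Since [x] is equally far from [F0] and from
   [F], the Gauss norm of [P] on a polydisc around [(x, y)] whose radii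
   are close to the two distances is close to [|P(x, y)|].  It is also at least
   the Gauss norm of [P(x, -)], which is too large because of the root [z]. *)
Lemma span1_dist_eq F0 F x y : acf F0 -> acf F -> F0 `<=` F -> ~ F x ->
  dist F0 x = dist F x -> F y -> ta_span F0 [set x] y -> F0 y.
Proof.
move=> aF0 aF sF0F nFx dx Fy /closure_absvP hy; apply: contrapT => nF0y.
have [sF0 clF0 cF0] := aF0; have [sF clF cF] := aF.
have F0_0 := subfield_nonempty sF0; have F_0 := subfield_nonempty sF.
pose s := dist F0 y; have s0 : 0 < s by exact: dist_gt0.
have r0 : 0 < dist F x by exact: dist_gt0.
have [z /(algebraic_adjoin1 sF0)[P [PF0 G0 Gz]] yz] := hy s s0.
set G := map_poly _ P in G0 Gz.
have [zs _ GE] := acf_factor (acf_setT K_closed)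
  (introT (allP) (fun u _ => mem_set I) : G \is a polyOver (mem [set: K])).
set ell := lead_coef G in GE.
have ell0 : ell != 0 by rewrite lead_coef_eq0.
pose D := maxn (size P) (\max_(j < size P) size (P`_j)%R).
have PD j : (size (P`_j)%R <= D)%N.
  have [jP|jP] := ltnP j (size P); last by rewrite nth_default// size_poly0.
  rewrite leq_max (leq_trans _ (leq_bigmax (Ordinal jP)))// ?orbT//.
(* Up to the factor [|ell|], [A] is the Gauss norm of [G] of radius [s] around [y] and [B] is
   [|G(y)|]; the root [z] makes [B < A]. *)
pose A := \prod_(w <- zs) Num.max s (absv (y - w)).
pose B := \prod_(w <- zs) absv (y - w).
have zzs : z \in zs by move: Gz; rewrite GE rootZ// root_prod_XsubC.
have BA : B < A by exact: prod_max_gt yz.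
have A0 : 0 < A by apply: prodr_gt0 => w _; rewrite lt_max s0.
have Gy : absv G.[y] = absv ell * B.
  rewrite GE hornerZ absvM horner_prod absv_prod; congr (_ * _).
  by apply: eq_bigr => w _; rewrite hornerXsubC.
suff main (l : R) : 1 < l -> A <= l ^+ (D + D) * B.
  have B0 : 0 < B.
    have := main 2; rewrite ltr1n => /(_ isT) /(lt_le_trans A0).
    by rewrite pmulr_rgt0// exprn_gt0.
  have [|l l1] := @exprn_lt_gt1 _ (A / B) (D + D); first by rewrite ltr_pdivlMr// mul1r.
  by rewrite ltr_pdivlMr// ltNge main.
move=> l1; have l0 := lt_trans ltr01 l1.
have approx (E : set K) w : subfield E -> 0 < dist E w ->
    exists2 b, E b & absv (w - b) < l * dist E w.
  move=> sE d0; apply: dist_lt; first exact: subfield_nonempty.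
  by rewrite ltr_pMl.
have [a F0a /ltW xa] := approx F0 x sF0 (eq_ind_r (fun u => 0 < u) r0 dx).
have [c F0c /ltW yc] := approx F0 y sF0 s0.
(* [q m] is the coefficient of [(x - a) ^ m] in [P(x, -)], a polynomial over [F0] in the second
   variable. *)
pose q m : {poly K} := \poly_(n < D) (P`_n \Po ('X + a%:P))`_m.
have qF0 m : q m \is a polyOver (mem F0).
  apply/(polyOver_setP _ (subfield0 sF0)) => n; rewrite coef_poly.
  case: ifP => _; last exact: subfield0.
  by have /(polyOver_setP _ (subfield0 sF0)) := polyOver_comp_XaddC sF0 (PF0 n) F0a.
have GqE : G = \sum_(m < D) (x - a) ^+ m *: q m.
  apply/polyP => n; rewrite coef_map coef_sum /= /horner_eval.
  have [nD|nD] := ltnP n D; last first.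
    rewrite nth_default ?horner0; last by rewrite (leq_trans _ nD)// leq_maxl.
    by rewrite big1// => m _; rewrite coefZ coef_poly ltnNge nD mulr0.
  rewrite -(horner_comp_XaddC _ _ a) (@horner_coef_wide _ D) ?size_comp_XaddC//.
  by apply: eq_bigr => m _; rewrite coefZ coef_poly nD mulrC.
have q1 m n : absv (q m \Po ('X + c%:P))`_n * absv (y - c) ^+ n <=
    l ^+ D * absv (q m).[y].
  rewrite -(horner_comp_XaddC (q m) y c).
  have := @coef_le_horner _ _ F0 (q m \Po ('X + c%:P)) (y - c) l sF0 cF0.
  move=> /(_ (polyOver_comp_XaddC sF0 (qF0 m) F0c) (ltW l1)).
  move=> /(_ (subfield_shift sF0 l0 yc F0c) n)/le_trans; apply.
  rewrite ler_wpM2r ?absv_ge0// ler_weXn2l ?(ltW l1)// size_comp_XaddC.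
  exact: size_poly.
(* As [y] lies in [F], [P(x, y)] is a polynomial in [x - a] over [F], and by the equality of the
   distances the centre [a], chosen in [F0], is nearly optimal for [F] too. *)
have q2 m : (m < D)%N -> absv (q m).[y] * absv (x - a) ^+ m <= l ^+ D * absv G.[y].
  move=> mD; pose g : {poly K} := \poly_(m < D) (q m).[y].
  have gF : g \is a polyOver (mem F).
    apply/(polyOver_setP _ (subfield0 sF)) => n; rewrite coef_poly.
    case: ifP => _; last exact: subfield0.
    apply: subfield_horner => //; apply/(polyOver_setP _ (subfield0 sF)) => u.
    by apply: sF0F; move: u; apply/(polyOver_setP _ (subfield0 sF0)).
  have -> : G.[y] = g.[x - a].
    rewrite GqE horner_sum horner_poly.
    by apply: eq_bigr => u _; rewrite hornerZ mulrC.
  have xa' : absv (x - a) <= l * dist F x by rewrite -dx.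
  have := coef_le_horner sF cF gF (ltW l1) (subfield_shift sF l0 xa' (sF0F _ F0a)) m.
  rewrite coef_poly mD => /le_trans; apply.
  by rewrite ler_wpM2r ?absv_ge0// ler_weXn2l ?(ltW l1)// size_poly.
(* Some term of the expansion of [G] around [c] attains the Gauss norm of radius [|y - c|], which is
   at least [|ell| * A] since [|y - c| >= s]. *)
have [|n hn] := @horner_le_coef _ _ ell [seq w - c | w <- zs] (absv (y - c)) _ ell0.
  by rewrite (lt_le_trans s0)//; exact: dist_le.
have GcE : G \Po ('X + c%:P) = ell *: \prod_(w <- [seq w - c | w <- zs]) ('X - w%:P).
  rewrite GE comp_polyZ big_map; congr (_ *: _).
  rewrite (big_morph (comp_poly ('X + c%:P)) (fun u v => rmorphM _ u v) (rmorph1 _)).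
  apply: eq_bigr => w _; rewrite comp_polyB comp_polyX comp_polyC polyCB.
  by ring.
rewrite -(ler_pM2l (_ : 0 < absv ell)) ?absv_gt0// mulrCA -Gy.
apply: (@le_trans _ _ (absv (G \Po ('X + c%:P))`_n * absv (y - c) ^+ n)).
  rewrite GcE (le_trans _ hn)// big_map ler_wpM2l ?absv_ge0//.
  apply: ler_prod => w _; rewrite le_max ltW ?s0//= ge_max !le_max.
  rewrite dist_le//= -!le_max.
  have -> : y - w = (y - c) - (w - c) by ring.
  exact: absvB.
rewrite [in leLHS]GqE raddf_sum /= coef_sum.
have [<-|y0] := eqVneq 0 (absv (y - c) ^+ n).
  by rewrite mulr0 mulr_ge0 ?absv_ge0// exprn_ge0// ltW.
have {}y0 : 0 < absv (y - c) ^+ n by rewrite lt_neqAle y0 exprn_ge0 ?absv_ge0.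
rewrite -ler_pdivlMr//; apply: absv_sum_le.
  by rewrite divr_ge0 ?(ltW y0)// mulr_ge0 ?absv_ge0// exprn_ge0// ltW.
move=> m _; rewrite comp_polyZ coefZ absvM absvX ler_pdivlMr// -mulrA.
apply: (@le_trans _ _ (absv (x - a) ^+ m * (l ^+ D * absv (q m).[y]))).
  by rewrite ler_wpM2l ?exprn_ge0 ?absv_ge0// q1.
rewrite mulrCA exprD -mulrA ler_pM2l ?exprn_gt0// mulrC.
exact: q2.
Qed.

Lemma dist_span1_lt F0 F B x : acf F0 -> acf F -> B `<=` F0 -> F0 `<=` F ->
  F `<=` ta_span B [set x] -> F0 <> F -> dist F x < dist F0 x.
Proof.
move=> aF0 aF BF0 F0F Fx nF; have [sF0 _ _] := aF0; have [sF clF _] := aF.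
have F0_0 := subfield_nonempty sF0.
rewrite lt_neqAle dist_subset// andbT; apply/negP => /eqP dE; apply: nF.
apply/seteqP; split=> // y Fy.
have xF0 : ta_span B [set x] `<=` ta_span F0 [set x].
  apply: span_min; first exact: span_acf.
    exact: subset_trans BF0 (@sub_spanl _ _ _ _).
  exact: sub_spanr.
have [xF|nxF] := pselect (F x); last first.
  by apply: (span1_dist_eq aF0 aF F0F nxF) => //; apply/xF0/Fx.
(* When [x] is in [F] both distances vanish, so [x] is in [F0], which then contains the span of [x]
   and hence [F]. *)
have F0x : F0 x.
  apply: contrapT => nF0x; have := dist_gt0 F0_0 (let: And3 _ h _ := aF0 in h) nF0x.
  by rewrite -dE ltNge (le_trans (dist_le x xF))// subrr absv0.
exact: (span1_sub aF0 BF0 F0x) (Fx _ Fy).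
Qed.

End Rigidity.

(** * Extension of isometries *)

Section UniqueExtension.
Context {R : realType} {E : fieldType} {K : analyticFieldType R}.
Variable v : {rmorphism E -> K}.
Hypothesis vE : closed (range v).
Implicit Types (f g h : {poly E}) (z : K).

Let eval z g := (map_poly v g).[z].

Let evalB z g h : eval z (g - h) = eval z g - eval z h.
Proof. by rewrite /eval rmorphB hornerD hornerN. Qed.

(* On the finite-dimensional [E]-space spanned by [1, z, ..., z^(n-1)] the
   absolute value is equivalent to the sup norm of the coordinates; [E] being
   complete, the span is closed, which gives the induction step. *)
Lemma coef_le_eval n z :
  (forall g, (size g <= n)%N -> eval z g = 0 -> g = 0) ->
  exists2 c : R, 0 < c & forall g, (size g <= n)%N ->
    forall j, c * absv (v g`_j) <= absv (eval z g).
Proof.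
elim: n => [|n IH] free.
  exists 1 => // g; rewrite leqn0 size_poly_eq0 => /eqP -> j.
  by rewrite coef0 rmorph0 absv0 mulr0 absv_ge0.
have [|c c0 hc] := IH; first by move=> g gn; apply: free; rewrite ltnW.
pose V := [set eval z g | g in [set g : {poly E} | (size g <= n)%N]].
have V_0 : V !=set0 by exists (eval z 0), 0 => //=; rewrite size_poly0.
have clV : closed V.
  apply/closed_absvP => x hx.
  have /choice[g hg] : forall m : nat, exists g : {poly E}, (size g <= n)%N /\
      absv (x - eval z g) < m.+1%:R^-1.
    move=> m; have [|_ [g gn <-] xg] := hx m.+1%:R^-1; last by exists g.
    by rewrite invr_gt0 ltr0n.
  have sB m m' : (size (g m - g m')%R <= n)%N.
    rewrite (leq_trans (size_polyD _ _))// size_polyN geq_max.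
    by rewrite (hg m).1 (hg m').1.
  have gC m m' j : (m <= m')%N -> c * absv (v (g m)`_j - v (g m')`_j) < m.+1%:R^-1.
    move=> mm'; rewrite -rmorphB -coefB (le_lt_trans (hc _ (sB _ _) _))// evalB.
    apply: (@absv_dist_lt _ _ _ _ x); first by rewrite absv_distC (hg m).2.
    by rewrite (lt_le_trans (hg m').2)// lef_pV2 ?posrE ?ltr0n// ler_nat ltnS.
  have /choice[b hb] : forall j, exists b, forall m, c * absv (v (g m)`_j - v b) <= m.+1%:R^-1.
    move=> j; have [|_ [b _ <-] /cvg_absvP vb] := (complete_closed _).2 vE
        (fun m => v (g m)`_j) (fun m => imageT _ _).
      apply/cauchy_absvP => e e0; have [N hN] := small_inv (mulr_gt0 c0 e0).
      have aux m m' : (N <= m)%N -> (m <= m')%N ->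
          absv (v (g m)`_j - v (g m')`_j) < e.
        by move=> Nm mm'; rewrite -(ltr_pM2l c0) (lt_trans (gC _ _ _ mm'))// hN.
      exists N => m m' Nm Nm'; have [mm'|/ltnW mm'] := leqP m m'; first exact: aux.
      by rewrite absv_distC; exact: aux.
    exists b => m; have [|N hN] := vb (m.+1%:R^-1 / c).
      by rewrite divr_gt0// invr_gt0 ltr0n.
    rewrite mulrC -ler_pdivlMr//; apply: (@absv_dist_le _ _ _ _ (v (g (maxn m N))`_j)).
      by rewrite ler_pdivlMr// mulrC ltW// gC// leq_maxl.
    by rewrite ltW// hN// leq_maxr.
  pose G := \poly_(j < n) b j.
  exists G; first exact: size_poly.
  apply/eqP; rewrite -subr_eq0 -[_ == _]negbK -absv_gt0; apply/negP => d0.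
  pose M := Num.max 1 (absv z); have M1 : 1 <= M by rewrite le_max lexx.
  have M0 : 0 < M ^+ n by rewrite exprn_gt0// (lt_le_trans ltr01).
  have [N hN] := small_inv d0.
  have [N' hN'] := small_inv (divr_gt0 (mulr_gt0 c0 d0) M0).
  pose m := maxn N N'.
  suff : absv (eval z G - x) < absv (eval z G - x) by rewrite ltxx.
  apply: (@absv_dist_lt _ _ _ _ (eval z (g m))); last first.
    by rewrite absv_distC (lt_trans (hg m).2)// hN// leq_maxl.
  rewrite -evalB; apply: (@le_lt_trans _ _ (m.+1%:R^-1 / c * M ^+ n)).
    apply: horner_absv_le => //.
    - by rewrite divr_ge0 ?invr_ge0// ltW.
    - by rewrite le_max lexx orbT.
    - rewrite size_map_poly (leq_trans (size_polyD _ _))// size_polyN geq_max.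
      by rewrite size_poly (hg m).1.
    - move=> j; rewrite coef_map coefB raddfB /= absv_distC ler_pdivlMr// mulrC.
      rewrite coef_poly; case: ltnP => [_|nj]; first exact: hb.
      rewrite rmorph0 (nth_default _ (leq_trans (hg m).1 nj)) raddf0 subrr.
      by rewrite absv0 mulr0 invr_ge0.
  by rewrite -ltr_pdivlMr// ltr_pdivrMr// mulrAC [_ * c]mulrC hN'// leq_maxr.
have nVz : ~ V (z ^+ n).
  move=> [g gn]; rewrite -[z ^+ n]hornerXn -(map_polyXn v) => /eqP.
  rewrite -subr_eq0 -evalB => /eqP/free; rewrite (leq_trans (size_polyD _ _)).
    move=> /(_ isT)/(congr1 (fun g : {poly E} => g`_n)).
    rewrite coefB coefXn eqxx nth_default// sub0r coef0 => /eqP.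
    by rewrite oppr_eq0 oner_eq0.
  by rewrite size_polyN size_polyXn geq_max leqnn andbT leqW.
have d0 := dist_gt0 V_0 clV nVz; set d := dist V _ in d0.
(* The distance [d] from [z ^ n] to the span [V] of the lower powers bounds the leading coefficient
   of [g] by [|g(z)| / d]; hence the lower part of [g] has a value at [z] of size at most
   [C * |g(z)|]. *)
pose C := Num.max 1 (absv z ^+ n / d).
have C0 : 0 < C by rewrite lt_max ltr01.
exists (Num.min d (c / C)); first by rewrite lt_min d0 divr_gt0.
move=> g gn j; set a := g`_n.
pose h := \poly_(j < n) g`_j.
have hn : (size h <= n)%N by exact: size_poly.
have gE : g = h + a *: 'X^n.
  apply/polyP => u; rewrite coefD coefZ coefXn coef_poly.
  have [un|un|->] := ltngtP u n; rewrite ?mulr0 ?addr0 ?mulr1 ?add0r//.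
  by rewrite nth_default// (leq_trans gn).
have egE : eval z g = eval z h + v a * z ^+ n.
  by rewrite {1}gE /eval rmorphD /= map_polyZ map_polyXn hornerD hornerZ hornerXn.
have ad : d * absv (v a) <= absv (eval z g).
  have [->|a0] := eqVneq a 0; first by rewrite rmorph0 absv0 mulr0 absv_ge0.
  have va0 : v a != 0 by rewrite fmorph_eq0.
  have -> : eval z g = v a * (z ^+ n - eval z (- (a^-1 *: h))).
    rewrite egE /eval rmorphN /= hornerN opprK map_polyZ hornerZ fmorphV /=.
    by rewrite mulrDr mulrA divff// mul1r addrC.
  rewrite absvM mulrC ler_wpM2l ?absv_ge0//; apply: dist_le.
  by exists (- (a^-1 *: h)); rewrite //= size_polyN (leq_trans (size_scale_leq _ _)).
have ha : absv (eval z h) <= C * absv (eval z g).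
  have -> : eval z h = eval z g - v a * z ^+ n by rewrite egE addrK.
  apply: absvB_le; first by rewrite ler_peMl ?absv_ge0// le_max lexx.
  rewrite absvM absvX; apply: (@le_trans _ _ (absv z ^+ n / d * absv (eval z g))).
    rewrite mulrC -mulrA ler_wpM2l ?exprn_ge0 ?absv_ge0//.
    by rewrite mulrC ler_pdivlMr// mulrC.
  by rewrite ler_wpM2r ?absv_ge0// le_max lexx orbT.
have [jn|nj|jn] := ltngtP j n.
- apply: (@le_trans _ _ (c / C * absv (v g`_j))).
    by rewrite ler_wpM2r ?absv_ge0// ge_min lexx orbT.
  rewrite mulrAC ler_pdivrMr// [leRHS]mulrC (le_trans _ ha)//.
  by have := hc h hn j; rewrite coef_poly jn.
- rewrite nth_default ?rmorph0 ?absv0 ?mulr0 ?absv_ge0//.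
  exact: leq_trans gn nj.
- rewrite jn (le_trans _ ad)// ler_wpM2r ?absv_ge0//.
  by rewrite ge_min lexx.
Qed.

Lemma irreducible_dvd_root f g z : irreducible_poly f -> root (map_poly v f) z ->
  root (map_poly v g) z -> f %| g.
Proof.
move=> [f1 firr] fz gz; have := firr (gcdp f g).
have -> : size (gcdp f g) != 1.
  apply/negP => /Bezout_eq1_coprimepP[[a b] /= /(congr1 (fun p => (map_poly v p).[z]))].
  rewrite rmorphD !rmorphM rmorph1 !hornerE (rootP fz) (rootP gz) !mulr0 addr0.
  by move/eqP; rewrite eq_sym oner_eq0.
move=> /(_ isT (dvdp_gcdl _ _)) /eqp_dvdl <-; exact: dvdp_gcdr.
Qed.

End UniqueExtension.

(** If [a / b > 1], Bernoulli's inequality makes its powers exceed [C]. For multiplicative norms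
    this removes a constant from an inequality. *)
Lemma ler_of_exprn (R : realType) (a b C : R) : 0 <= a -> 0 <= b ->
  (forall m, a ^+ m <= C * b ^+ m) -> a <= b.
Proof.
move=> a0 b0 h; rewrite leNgt; apply/negP => ba.
have C0 : 0 <= C by have := h 0%N; rewrite !expr0 mulr1; exact: le_trans ler01.
have [b00|bn0] := eqVneq b 0.
  by have := h 1%N; rewrite b00 !expr1 mulr0 leNgt -b00 ba.
have {}b0 : 0 < b by rewrite lt0r bn0.
have t1 : 0 < a / b - 1 by rewrite subr_gt0 ltr_pdivlMr// mul1r.
have bern m : 1 + m%:R * (a / b - 1) <= (a / b) ^+ m.
  elim: m => [|m IH]; first by rewrite mul0r addr0 expr0.
  rewrite exprS -{2}(subrK 1 (a / b)).
  apply: (@le_trans _ _ ((a / b - 1 + 1) * (1 + m%:R * (a / b - 1)))).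
    set t := a / b - 1 in t1 *; rewrite -natr1.
    have -> : (t + 1) * (1 + m%:R * t) = 1 + (m%:R + 1) * t + t * (m%:R * t) by ring.
    by rewrite lerDl !mulr_ge0// ltW.
  by rewrite ler_wpM2l// subrK divr_ge0// ltW.
have := h (Num.truncn (C / (a / b - 1))).+1.
set m := _.+1; rewrite -ler_pdivrMr ?exprn_gt0// -expr_div_n leNgt => /negP; apply.
apply: lt_le_trans (bern m); rewrite ltr_wpDl// -ltr_pdivrMr//.
exact: truncnS_gt.
Qed.

Section UniqueExtensionNorm.
Context {R : realType} {E : fieldType} {K : analyticFieldType R}.
Variables (v w : {rmorphism E -> K}).
Hypotheses (vw : forall a, absv (v a) = absv (w a)) (vE : closed (range v)).

(* The bound of [coef_le_eval], applied to all powers of [g], gives one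
   inequality; the inverse of [g] modulo [f] gives the other one. *)
Lemma unique_extension (f : {poly E}) (z z' : K) : irreducible_poly f ->
  root (map_poly v f) z -> root (map_poly w f) z' ->
  forall g, absv (map_poly v g).[z] = absv (map_poly w g).[z'].
Proof.
move=> firr fz fz'; have f1 := firr.1.
have f0 : f != 0 by rewrite -size_poly_gt0 ltnW.
have [|c c0 hc] := @coef_le_eval _ _ _ v vE (size f).-1 z.
  move=> g gf /rootP gz; apply/eqP; apply: contraLR gf => g0.
  rewrite -ltnNge prednK ?(ltnW f1)//; apply: dvdp_leq => //.
  exact: irreducible_dvd_root firr fz gz.
pose M := Num.max 1 (absv z'); have M1 : 1 <= M by rewrite le_max lexx.
have M0 : 0 < M := lt_le_trans ltr01 M1.
have modE (u : {rmorphism E -> K}) y g : root (map_poly u f) y ->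
    (map_poly u g).[y] = (map_poly u (g %% f)).[y].
  move=> fy; rewrite [in LHS](divp_eq g f) rmorphD rmorphM /= hornerD hornerM.
  by rewrite (rootP fy) mulr0 add0r.
have bound g : absv (map_poly w g).[z'] <=
    M ^+ (size f).-1 / c * absv (map_poly v g).[z].
  rewrite (modE w z' g fz') (modE v z g fz); set h := g %% f.
  have hf : (size h <= (size f).-1)%N by rewrite -ltnS prednK ?(ltnW f1)// ltn_modp.
  rewrite mulrAC -mulrA mulrC; apply: horner_absv_le => //.
  - by rewrite divr_ge0 ?absv_ge0// ltW.
  - by rewrite le_max lexx orbT.
  - by rewrite size_map_poly.
  - move=> j; rewrite coef_map /= -vw ler_pdivlMr// mulrC.
    exact: hc.
have le g : absv (map_poly w g).[z'] <= absv (map_poly v g).[z].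
  apply: (@ler_of_exprn _ _ _ (M ^+ (size f).-1 / c)); rewrite ?absv_ge0// => m.
  by rewrite -!absvX -!horner_exp -!rmorphXn bound.
move=> g; apply/eqP; rewrite eq_le le andbT.
have [gz|gz] := boolP (root (map_poly v g) z).
  by rewrite (rootP gz) absv0 absv_ge0.
have cfg : coprimep f g.
  rewrite /coprimep; apply: contraNT gz => /(firr.2 _)/(_ (dvdp_gcdl _ _)) fg.
  have /dvdpP[q ->] : f %| g by rewrite -(eqp_dvdl _ fg) dvdp_gcdr.
  by rewrite rmorphM rootM fz orbT.
have [[a b] /= ab1] := Bezout_eq1_coprimepP _ _ cfg.
have inv (u : {rmorphism E -> K}) y : root (map_poly u f) y ->
    absv (map_poly u b).[y] * absv (map_poly u g).[y] = 1.
  move=> fy; have := congr1 (fun p => absv (map_poly u p).[y]) ab1.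
  by rewrite rmorphD !rmorphM rmorph1 !hornerE (rootP fy) mulr0 add0r absvM absv1.
have iz := inv v z fz; have iz' := inv w z' fz'.
have g'0 : 0 < absv (map_poly w g).[z'].
  rewrite absv_gt0; apply/eqP => e; move: iz'; rewrite e absv0 mulr0 => /eqP.
  by rewrite eq_sym oner_eq0.
have b0 : 0 < absv (map_poly v b).[z].
  rewrite absv_gt0; apply/eqP => e; move: iz; rewrite e absv0 mul0r => /eqP.
  by rewrite eq_sym oner_eq0.
rewrite -(ler_pM2l b0) iz -iz' ler_pM2r//; exact: le.
Qed.

End UniqueExtensionNorm.

(* The second and the last condition make [G] the graph of an injective partial
   map. *)
Definition isometric_graph (R : realType) (K : analyticFieldType R)
    (G : set (K * K)) := [/\ G (1, 1),
  forall a b c d, G (a, b) -> G (c, d) -> G (a - c, b - d),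
  forall a b c d, G (a, b) -> G (c, d) -> G (a / c, b / d) &
  forall a b, G (a, b) -> absv a = absv b].

(** * Partial isometries of [K], handled through their graphs *)

Section IsometricGraphs.
Context {R : realType} {K : analyticFieldType R}.
Implicit Types (G H : set (K * K)) (a b c d : K).

(** By the isometry condition a nonzero element of [G] has no zero component, so [G] is a subfield
    of the ring [K * K], and [v] and [w] are its two projections. *)
Lemma isometric_graph_field G : isometric_graph G ->
  exists (E : fieldType) (v w : {rmorphism E -> K}),
    (forall e, absv (v e) = absv (w e)) /\ G = range (fun e => (v e, w e)).
Proof.
move=> [G1 GB GD Giso].
have unit0 a b : G (a, b) -> a = 0 -> b = 0.
  by move=> /Giso e a0; apply/absv_eq0; rewrite -e a0 absv0.
have unit1 a b : G (a, b) -> a != 0 -> b != 0.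
  by move=> /Giso e a0; rewrite -absv_gt0 -e absv_gt0.
have [||E [v vG]] := @field_of_set (K * K)%type G.
- split=> [|[a b] [c d] /set_mem hx /set_mem hy|[a b] [c d] /set_mem hx /set_mem hy];
    apply: mem_set; [exact: G1|exact: GB|].
  have [c0|c0] := eqVneq c 0.
    have d0 := unit0 _ _ hy c0; have := GD _ _ _ _ hx hy.
    by rewrite c0 d0 !invr0 => h; exact: h.
  suff -> : (c, d)^-1 = (c^-1, d^-1) :> K * K by exact: GD.
  have cd : (c, d) \is a GRing.unit.
    by apply/andP; split; rewrite /= unitfE// (unit1 c).
  apply: (mulrI cd); rewrite divrr//; congr (_, _) => /=; rewrite divff//.
  exact: unit1 hy c0.
- move=> [a b] hx ab0; apply/andP; split; rewrite /= unitfE.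
    by apply: contra ab0 => /eqP a0; rewrite a0 (unit0 _ _ hx a0).
  apply: contra ab0 => /eqP b0; apply/eqP; congr (_, _) => //.
  by apply/eqP; apply: contraT => /(unit1 _ _ hx); rewrite b0 eqxx.
exists E, (fst \o v), (snd \o v); split.
  by move=> e; apply: Giso; rewrite -surjective_pairing -vG; exists e.
by rewrite -vG; apply/seteqP; split=> [_|_] [e _ <-]; exists e => //=;
  rewrite -surjective_pairing.
Qed.

Lemma isometric_graph_fun G a b c : isometric_graph G -> G (a, b) -> G (a, c) -> b = c.
Proof.
move=> [_ GB _ Giso] Gab Gac; apply/eqP; rewrite -subr_eq0.
apply/eqP/absv_eq0; have := Giso _ _ (GB _ _ _ _ Gab Gac).
by rewrite subrr absv0 => <-.
Qed.

Definition graph_closure G : set (K * K) := [set ab | forall e : R, 0 < e ->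
  exists a b, [/\ G (a, b), absv (ab.1 - a) < e & absv (ab.2 - b) < e]].

Lemma sub_graph_closure G : G `<=` graph_closure G.
Proof.
by move=> [a b] Gab e e0; exists a, b; rewrite !subrr absv0; split.
Qed.

Lemma isometric_graph_closure G : isometric_graph G -> isometric_graph (graph_closure G).
Proof.
move=> gG; have [G1 GB GD Giso] := gG.
have GV a b : G (a, b) -> G (a^-1, b^-1) by move/(GD _ _ _ _ G1); rewrite !mul1r.
have GM a b c d : G (a, b) -> G (c, d) -> G (a * c, b * d).
  by move=> hab /GV hcd; have := GD _ _ _ _ hab hcd; rewrite !invrK.
have iso a b : graph_closure G (a, b) -> absv a = absv b.
  move=> cab; apply: contrapT => /eqP; wlog: a b cab / absv a < absv b.
    move=> wl; have [ab|ba|//] := ltgtP (absv a) (absv b).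
      by move=> _; apply: (wl a b) => //; rewrite lt_eqF.
    suff cba : False by [].
    have /= [|c [d [/Giso Gcd ac bd]]] := cab (absv a).
      exact: le_lt_trans (absv_ge0 _) ba.
    have := absv_near ac; rewrite Gcd => e.
    suff : absv d < absv a by rewrite e ltxx.
    by rewrite -(subKr b d) absvB_lt.
  move=> ab _; have /= [|c [d [/Giso Gcd ac bd]]] := cab (absv b).
    exact: le_lt_trans (absv_ge0 _) ab.
  have := absv_near bd; rewrite -Gcd => e.
  suff : absv c < absv b by rewrite e ltxx.
  by rewrite -(subKr a c) absvB_lt.
have cV a b : graph_closure G (a, b) -> graph_closure G (a^-1, b^-1).
  move=> cab; have [a0|a0] := eqVneq a 0.
    suff -> : b^-1 = b by rewrite a0 invr0 -a0.
    suff -> : b = 0 by rewrite invr0.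
    by apply/absv_eq0; rewrite -(iso _ _ cab) a0 absv0.
  have b0 : b != 0 by rewrite -absv_gt0 -(iso _ _ cab) absv_gt0.
  move=> e e0; have [da da0 ha] := absv_invr_near a0 e0.
  have [db db0 hb] := absv_invr_near b0 e0.
  have [|c [d [Gcd]]] := cab (Num.min da db); first by rewrite lt_min da0.
  rewrite !lt_min => /andP[/ha ac _] /andP[_ /hb bd].
  by exists c^-1, d^-1; split; [exact: GV| |].
have cM a b c d : graph_closure G (a, b) -> graph_closure G (c, d) ->
    graph_closure G (a * c, b * d).
  move=> cab ccd e e0; have [d1 d10 h1] := absv_mulr_near a c e0.
  have [d2 d20 h2] := absv_mulr_near b d e0.
  have d0 : 0 < Num.min d1 d2 by rewrite lt_min d10.
  have [a' [b' [G1' aa' bb']]] := cab _ d0; have [c' [d' [G2' cc' dd']]] := ccd _ d0.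
  move: aa' bb' cc' dd'; rewrite !lt_min => /andP[aa' _] /andP[_ bb'] /andP[cc' _] /andP[_ dd'].
  by exists (a' * c'), (b' * d'); split; [exact: GM|exact: h1|exact: h2].
split=> //.
- exact: sub_graph_closure.
- move=> a b c d cab ccd e e0.
  have [a' [b' [G1' aa' bb']]] := cab e e0; have [c' [d' [G2' cc' dd']]] := ccd e e0.
  by exists (a' - c'), (b' - d'); split; [exact: GB|exact: absv_subr_near|exact: absv_subr_near].
- by move=> a b c d cab /cV; exact: cM.
Qed.

Lemma isometric_graph_maximal G0 : isometric_graph G0 ->
  exists G, [/\ isometric_graph G, G0 `<=` G &
    forall H, isometric_graph H -> G `<=` H -> H `<=` G].
Proof.
move=> gG0; pose P G := G = set0 \/ (isometric_graph G /\ G0 `<=` G).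
have [F FP Ftot|G [PG Gmax]] := @Zorn_bigcup (K * K)%type P.
  have [[G [FG Gn0]]|allempty] := pselect (exists G, F G /\ G <> set0); last first.
    left; apply/seteqP; split=> // x [G FG Gx]; apply: allempty.
    by exists G; split=> // G0'; rewrite G0' in Gx.
  have gG : forall H, F H -> H <> set0 -> isometric_graph H /\ G0 `<=` H.
    by move=> H /FP[].
  have [[G1 _ _ _] G0G] := gG _ FG Gn0.
  have up a b c d : (\bigcup_(X in F) X) (a, b) -> (\bigcup_(X in F) X) (c, d) ->
      exists H, [/\ F H, isometric_graph H, H (a, b) & H (c, d)].
    move=> [X FX Xab] [Y FY Ycd].
    have n0 (Z : set (K * K)) z : Z z -> Z <> set0 by move=> Zz Z0; rewrite Z0 in Zz.
    have [XY|YX] := Ftot X Y FX FY.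
      by exists Y; split=> //; [exact: (gG _ FY (n0 _ _ Ycd)).1|exact: XY].
    by exists X; split=> //; [exact: (gG _ FX (n0 _ _ Xab)).1|exact: YX].
  right; split; last by move=> x /G0G; exists G.
  split.
  - by exists G.
  - move=> a b c d /up h /h[H [FH [_ HB _ _] Hab Hcd]].
    by exists H => //; exact: HB.
  - move=> a b c d /up h /h[H [FH [_ _ HD _] Hab Hcd]].
    by exists H => //; exact: HD.
  - by move=> a b /[dup] /up h /h[H [_ [_ _ _ iso] Hab _]]; exact: iso.
have [G_0|[gG G0G]] := PG.
  have [G01 _ _ _] := gG0.
  exfalso; apply: (Gmax G0); last by right; split.
  by rewrite G_0; split=> // /(_ _ G01).
exists G; split=> // H gH GH; apply: contrapT => nHG.
by apply: (Gmax H) => //; right; split=> //; exact: subset_trans GH.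
Qed.

Lemma irreducible_annihilator (E : fieldType) (v : {rmorphism E -> K}) (q : {poly E}) z :
  q != 0 -> root (map_poly v q) z ->
  exists2 f : {poly E}, irreducible_poly f & root (map_poly v f) z.
Proof.
move=> q0 qz; pose Q n := `[< exists f : {poly E},
  [/\ f != 0, size f = n & root (map_poly v f) z] >].
have exQ : exists n, Q n by exists (size q); apply/asboolP; exists q.
have := ex_minnP exQ => -[n /asboolP[f [f0 fn fz]] nmin].
have small (g : {poly E}) : root (map_poly v g) z -> g != 0 -> (size f <= size g)%N.
  by move=> gz g0; rewrite fn; apply: nmin; apply/asboolP; exists g.
exists f => //; split.
  rewrite ltnNge; apply/negP => /size1_polyC fE.
  move: fz; rewrite fE map_polyC rootC fmorph_eq0 => /eqP fc.
  by move: f0; rewrite fE fc eqxx.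
move=> g g1 gf; have [h fE] := dvdpP _ _ gf.
have [g0 h0] : g != 0 /\ h != 0.
  by apply/andP; rewrite -negb_or -mulf_eq0 mulrC -fE.
move: fz; rewrite fE rmorphM rootM => /orP[hz|gz]; last first.
  by rewrite -fE -(dvdp_size_eqp gf) eqn_leq dvdp_leq//= small.
have := small _ hz h0; rewrite {1}fE size_mul//.
case: (size g) g1 (size_poly_gt0 g) => [|[|m]]//; first by rewrite g0.
by move=> _ _; rewrite addnS /= -[X in (_ <= X)%N]addn0 leq_add2l.
Qed.

Hypothesis K_closed : alg_closed [set: K].

(** Any isometry extends to the closure of its domain, by completeness of [K], and then to an
    algebraic element [z], by sending [z] to a root [z'] of the conjugate polynomial:
    [unique_extension] says that this is isometric. *)
Lemma maximal_graph_acf G : isometric_graph G ->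
  (forall H, isometric_graph H -> G `<=` H -> H `<=` G) ->
  acf [set a | exists b, G (a, b)].
Proof.
move=> gG Gmax; have [G1 GB GD Giso] := gG.
set D := [set a | _].
have sD : subfield D.
  apply/subfieldP; split.
  - by exists 1.
  - by move=> a c [b Gab] [d Gcd]; exists (b - d); exact: GB.
  - by move=> a c [b Gab] [d Gcd]; exists (b / d); exact: GD.
have clD : closed D.
  apply/closed_absvP => x hx.
  have /choice[u hu] : forall n : nat, exists cd, G cd /\ absv (x - cd.1) < n.+1%:R^-1.
    move=> n; have [|c [d Gcd] xc] := hx n.+1%:R^-1; last by exists (c, d).
    by rewrite invr_gt0 ltr0n.
  have [|l ul] := @complete_absv _ _ (fun n => (u n).2).
    move=> e /small_inv[N hN]; exists N => n m Nn Nm.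
    have <- := Giso ((u n).1 - (u m).1) ((u n).2 - (u m).2); last first.
      by apply: GB; rewrite -surjective_pairing; apply: (hu _).1.
    apply: (@absv_dist_lt _ _ _ _ x).
      by rewrite absv_distC (lt_trans (hu n).2)// hN.
    by rewrite (lt_trans (hu m).2)// hN.
  exists l; apply: (Gmax _ (isometric_graph_closure gG) (@sub_graph_closure G)).
  move=> e e0; have [N hN] := ul e e0; have [M hM] := small_inv e0.
  exists (u (maxn N M)).1, (u (maxn N M)).2; split.
  - by rewrite -surjective_pairing; exact: (hu _).1.
  - by rewrite (lt_trans (hu _).2)// hM// leq_maxr.
  - by rewrite absv_distC hN// leq_maxl.
split=> //; have [E [v [w [vw GE]]]] := isometric_graph_field gG.
have DE : range v = D.
  rewrite /D GE; apply/seteqP; split=> [_ [e _ <-]|a [b [e _ [<- _]]]]; last by exists e.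
  by exists (w e), e.
apply: (alg_closedP K_closed) => p z; rewrite -{1}DE => /polyOver_range[q ->].
rewrite map_poly_eq0 => q0 /(irreducible_annihilator q0)[f firr fz].
have wfT : map_poly w f \is a polyOver (mem [set: K]) by apply/(polyOver_setP _ _).
have [|z' _ fz'] := K_closed wfT; first by rewrite size_map_poly; exact: firr.1.
have vE : closed (range v) by rewrite DE.
have ext := unique_extension vw vE firr fz fz'.
(* Polynomials in [z] already form a field, since inverses modulo the irreducible [f] exist. *)
pose H : set (K * K) := range (fun g => ((map_poly v g).[z], (map_poly w g).[z'])).
have gH : isometric_graph H.
  split.
  - by exists 1; rewrite // !rmorph1 !hornerC.
  - move=> _ _ _ _ [g _ [<- <-]] [h _ [<- <-]]; exists (g - h) => //.
    by rewrite !rmorphB /= !hornerE.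
  - move=> _ _ _ _ [g _ [<- <-]] [h _ [<- <-]].
    have [hz|hz] := boolP (root (map_poly v h) z).
      have hz' : (map_poly w h).[z'] = 0.
        by apply/absv_eq0; rewrite -ext (rootP hz) absv0.
      exists 0 => //; rewrite (rootP hz) hz' invr0 !mulr0 !rmorph0.
      by rewrite !hornerC.
    have cfh : coprimep f h.
      rewrite /coprimep; apply: contraNT hz => /(firr.2 _)/(_ (dvdp_gcdl _ _)) fh.
      have /dvdpP[r ->] : f %| h by rewrite -(eqp_dvdl _ fh) dvdp_gcdr.
      by rewrite rmorphM rootM fz orbT.
    have [[a b] /= ab1] := Bezout_eq1_coprimepP _ _ cfh.
    have inv (s : {rmorphism E -> K}) y : root (map_poly s f) y ->
        (map_poly s h).[y]^-1 = (map_poly s b).[y].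
      move=> fy; have := congr1 (fun p => (map_poly s p).[y]) ab1.
      rewrite rmorphD !rmorphM rmorph1 !hornerE (rootP fy) mulr0 add0r => e.
      have hy0 : (map_poly s h).[y] != 0.
        by apply/eqP => hy; move: e; rewrite hy mulr0 => /eqP; rewrite eq_sym oner_eq0.
      by apply: (mulIf hy0); rewrite mulVf.
    exists (g * b) => //; rewrite !rmorphM !hornerM.
    by rewrite (inv v z fz) (inv w z' fz').
  - by move=> _ _ [g _ [<- <-]]; exact: ext.
have GH : G `<=` H.
  by rewrite GE => _ [e _ <-]; exists e%:P => //; rewrite !map_polyC !hornerC.
exists z'; apply: (Gmax _ gH GH).
by exists 'X => //; rewrite !map_polyX !hornerX.
Qed.

End IsometricGraphs.

Section Extension.
Context {R : realType} {K : analyticFieldType R}.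
Hypothesis K_closed : alg_closed [set: K].

(** The hypothesis gives [|u - r| = |u' - r|] for [r] in [B]. Polynomials over [B] split into such
    linear factors, so they take values of equal size at [u] and [u']. *)
Lemma fraction_graph (B : set K) (u u' : K) : subfield B -> alg_closed B ->
  (forall b, B b -> absv (u - u') < absv (u - b)) ->
  exists G, [/\ isometric_graph G, G (u, u') & forall b, B b -> G (b, b)].
Proof.
move=> sB cB uu'; have [E [v vE]] := field_of_subfield sB.
have iso (g : {poly E}) : absv (map_poly v g).[u] = absv (map_poly v g).[u'].
  have gB : map_poly v g \is a polyOver (mem B).
    by rewrite -vE; apply/polyOver_range; exists g.
  have [rs rsB ->] := alg_closed_factor sB cB gB.
  rewrite !hornerZ !absvM !horner_prod !absv_prod; congr (_ * _).
  apply: eq_big_seq => r /rsB Br; rewrite !hornerXsubC.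
  by apply/esym/absv_near; rewrite opprB addrA subrK; exact: uu'.
pose G : set (K * K) := [set ab | exists g h : {poly E}, (map_poly v h).[u] != 0 /\
  ab = ((map_poly v g).[u] / (map_poly v h).[u], (map_poly v g).[u'] / (map_poly v h).[u'])].
have nz (h : {poly E}) : (map_poly v h).[u] != 0 -> (map_poly v h).[u'] != 0.
  by rewrite -!absv_gt0 iso.
exists G; split; first split.
- by exists 1, 1; rewrite rmorph1 !hornerC oner_neq0 divr1.
- move=> _ _ _ _ [g [h [h0 [-> ->]]]] [g' [h' [h'0 [-> ->]]]].
  exists (g * h' - g' * h), (h * h'); rewrite rmorphB !rmorphM /= !hornerE mulf_neq0//.
  by split=> //; congr (_, _); field; rewrite ?h0 ?h'0 ?nz.
- move=> _ _ _ _ [g [h [h0 [-> ->]]]] [g' [h' [h'0 [-> ->]]]].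
  have [g'0|g'0] := eqVneq (map_poly v g').[u] 0.
    have g'0' : (map_poly v g').[u'] = 0 by apply/absv_eq0; rewrite -iso g'0 absv0.
    exists 0, 1; rewrite rmorph0 rmorph1 !hornerC oner_neq0 g'0 g'0'.
    by rewrite !(mul0r, invr0, mulr0).
  exists (g * h'), (h * g'); rewrite !rmorphM /= !hornerE mulf_neq0//.
  by split=> //; congr (_, _); field; rewrite ?h0 ?h'0 ?g'0 ?nz.
- move=> _ _ [g [h [h0 [-> ->]]]].
  by rewrite !absv_div -!iso.
- by exists 'X, 1; rewrite rmorph1 map_polyX !hornerX !hornerC oner_neq0 !divr1.
- rewrite -vE => _ [e _ <-]; exists e%:P, 1.
  by rewrite rmorph1 map_polyC !hornerC oner_neq0 !divr1.
Qed.

(** A maximal isometry extending the one of [fraction_graph] has a closed algebraically closed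
    domain containing [B] and [u], which must be [K]. Its image may be smaller. *)
Lemma isometric_extension (B : set K) (u u' : K) : acf B ->
  ta_span B [set u] = [set: K] ->
  (forall b, B b -> absv (u - u') < absv (u - b)) ->
  exists s : {rmorphism K -> K}, [/\ isometric s, s u = u' & forall b, B b -> s b = b].
Proof.
move=> [sB clB cB] uK uu'.
have [G0 [gG0 G0u G0B]] := fraction_graph sB cB uu'.
have [G [gG G0G Gmax]] := isometric_graph_maximal gG0.
have aD := maximal_graph_acf K_closed gG Gmax.
have /choice[s hs] : forall a, exists b, G (a, b).
  move=> a; have : [set: K] a by [].
  rewrite -uK; apply: (span1_sub aD) => [b /G0B/G0G|]; first by exists b.
  by exists u'; exact: G0G.
have [G1 GB GD Giso] := gG.
have sfun a b : G (a, b) -> s a = b by move=> Gab; exact: (isometric_graph_fun gG (hs a)).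
have sB' : zmod_morphism s.
  by move=> a b; apply: sfun; apply: GB.
have s1 : s 1 = 1 by exact: sfun.
have sD a b : s (a / b) = s a / s b by apply: sfun; exact: GD.
have sM : monoid_morphism s.
  split=> // a b; have sV : s b^-1 = (s b)^-1 by rewrite -[b^-1]mul1r sD s1 mul1r.
  by rewrite -{1}(invrK b) sD sV invrK.
pose s' : {rmorphism K -> K} := HB.pack s
  (GRing.isZmodMorphism.Build K K s sB') (GRing.isMonoidMorphism.Build K K s sM).
exists s'; split.
- by move=> a; apply/esym/Giso; exact: hs.
- by apply: sfun; exact: G0G.
- by move=> b /G0B/G0G/sfun.
Qed.

End Extension.

(** * A proper subfield of a field with one generator *)

Section Separation.
Context {R : realType} {K : analyticFieldType R}.
Hypothesis K_closed : alg_closed [set: K].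
Implicit Types (B : set K) (x y z : K).

Lemma horner_lipschitz_coefs (P : {poly {poly K}}) (M : R) : exists2 c : R, 0 < c &
  forall n x y, absv x <= M -> absv y <= M ->
    absv ((P`_n).[x] - (P`_n).[y]) <= c * absv (x - y).
Proof.
have /choice[c hc] : forall n, exists c : R, 0 < c /\ forall x y, absv x <= M ->
    absv y <= M -> absv ((P`_n).[x] - (P`_n).[y]) <= c * absv (x - y).
  by move=> n; have [c c0 hc] := horner_lipschitz P`_n M; exists c.
exists (\big[Num.max/1]_(j < size P) c j).
  by rewrite (lt_le_trans ltr01)// bigmax_ge_id.
move=> n x y xM yM; have [nP|nP] := ltnP n (size P); last first.
  rewrite nth_default// !horner0 subrr absv0 mulr_ge0 ?absv_ge0//.
  by rewrite (le_trans ler01)// bigmax_ge_id.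
rewrite (le_trans ((hc n).2 _ _ xM yM))// ler_wpM2r ?absv_ge0//.
exact: (@le_bigmax _ _ _ 1 (fun j : 'I_(size P) => c j) (Ordinal nP)).
Qed.

(* If [x] were close to a root [z] of [P(y, -)], then all the [s j z] would be
   close to roots of [P(y, -)], two of them to the same one. *)
Lemma notin_span1 B x y (e : R) : subfield B -> 0 < e ->
  (forall d : R, 0 < d -> exists s : nat -> {rmorphism K -> K},
    (forall j, [/\ isometric (s j), forall b, B b -> s j b = b &
                   absv (s j y - y) <= d]) /\
    forall j l, j != l -> e <= absv (s j x - s l x)) ->
  ~ ta_span B [set y] x.
Proof.
move=> sB e0 hs /closure_absvP/(_ e e0)[z /(algebraic_adjoin1 sB)[P [PB G0 Gz]] xz].
set G := map_poly _ P in G0 Gz.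
have GT : G \is a polyOver (mem [set: K]) by apply/(polyOver_setP _ _).
have [zs _ GE] := acf_factor (acf_setT K_closed) GT.
have ell0 : lead_coef G != 0 by rewrite lead_coef_eq0.
have [c c0 hc] := horner_lipschitz_coefs P (absv y).
pose M := Num.max 1 (absv z); have M1 : 1 <= M by rewrite le_max lexx.
have M0 : 0 < M ^+ size P by rewrite exprn_gt0// (lt_le_trans ltr01).
(* With this [d], replacing [y] by [s j y] in [P] changes the value at [s j z] by less than
   [|lead_coef G| * e ^ size zs], the threshold of [root_near]. *)
pose d := absv (lead_coef G) * e ^+ size zs / (c * M ^+ size P) / 2.
have t0 : 0 < absv (lead_coef G) * e ^+ size zs by rewrite mulr_gt0 ?absv_gt0 ?exprn_gt0.
have d0 : 0 < d by rewrite divr_gt0// divr_gt0// mulr_gt0.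
have [s [hsi hsx]] := hs d d0.
have near j : exists2 r, r \in zs & absv (s j z - r) < e.
  have [si sb sy] := hsi j; apply: (root_near (ltW e0) GE).
  have sGz : (map_poly (horner_eval (s j y)) P).[s j z] = 0.
    have -> : map_poly (horner_eval (s j y)) P = map_poly (s j) G.
      apply/polyP => n; rewrite !coef_map /= /horner_eval -horner_map; congr _.[_].
      apply/polyP => m; rewrite coef_map /= sb//; move: m.
      by apply/(polyOver_setP _ (subfield0 sB)).
    by rewrite horner_map (rootP Gz) rmorph0.
  apply: (@le_lt_trans _ _ (c * d * M ^+ size P)).
    rewrite -[G.[_]]subr0 -sGz -hornerN -hornerD.
    apply: horner_absv_le => //.
    - by rewrite mulr_ge0// ltW.
    - by rewrite si le_max lexx orbT.
    - rewrite (leq_trans (size_polyD _ _))// size_polyN geq_max.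
      by rewrite !size_poly.
    - move=> n; rewrite coefB !coef_map /= /horner_eval absv_distC.
      rewrite (le_trans (hc _ _ _ _ _)) ?si// ler_pM2l//.
  suff -> : c * d * M ^+ size P = absv (lead_coef G) * e ^+ size zs / 2.
    by rewrite ltr_pdivrMr// mulr_natr mulr2n ltrDl.
  by rewrite /d; field; rewrite !gt_eqF.
have /choice[r hr] : forall j, exists r, r \in zs /\ absv (s j z - r) < e.
  by move=> j; have [r rzs sr] := near j; exists r.
have lt_idx (j : 'I_(size zs).+1) : (index (r j) zs < size zs)%N.
  by rewrite index_mem; exact: (hr j).1.
have : ~ injective (fun j => Ordinal (lt_idx j)).
  by move=> /leq_card; rewrite !card_ord ltnn.
apply => j l /(congr1 val) /= jl; apply/eqP; apply: contraT => njl.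
have rjl : r j = r l by rewrite -(nth_index 0 (hr j).1) jl nth_index// (hr l).1.
have : absv (s j x - s l x) < e.
  apply: (@absv_dist_lt _ _ _ _ (s j z)).
    by rewrite -rmorphB; have [-> _ _] := hsi j.
  apply: (@absv_dist_lt _ _ _ _ (r j)); first exact: (hr j).2.
  rewrite rjl absv_distC; apply: (@absv_dist_lt _ _ _ _ (s l z)).
    by rewrite absv_distC -rmorphB; have [-> _ _] := hsi l; rewrite absv_distC.
  exact: (hr l).2.
by rewrite ltNge hsx.
Qed.

End Separation.

Section Powers.
Context {R : realType} {K : analyticFieldType R}.
Implicit Types (a b : K).

Lemma absv_nat (n : nat) : absv (n%:R : K) <= 1.
Proof.
elim: n => [|n IH]; first by rewrite absv0.
by rewrite -natr1 absvD_le// absv1.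
Qed.

(** The inner binomial coefficients are divisible by [p]. *)
Lemma absv_expB_prime p a b : prime p -> absv a <= 1 -> absv b <= 1 ->
  absv (a ^+ p - b ^+ p) <= Num.max (absv (p%:R : K) * absv (a - b)) (absv (a - b) ^+ p).
Proof.
move=> pp a1 b1; set d := a - b; have -> : a = b + d by rewrite addrC subrK.
have d1 : absv d <= 1 by exact: absvB_le.
rewrite exprDn; case: p pp => // p pp.
rewrite big_ord_recl big_ord_recr /= subnn expr0 mul1r binn mulr1n.
rewrite mulr1 subn0 mulr1n addrAC subrr add0r.
have b0 j : bump 0 j = j.+1 by [].
apply: absvD_le; last by rewrite absvX le_max lexx orbT.
rewrite le_max; apply/orP; left.
apply: absv_sum_le => [|j _]; first by rewrite mulr_ge0 ?absv_ge0.
have /dvdnP[m ->] : (p.+1 %| 'C(p.+1, bump 0 j))%N.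
  by rewrite b0 prime_dvd_bin//= ltnS.
rewrite b0 -mulr_natl natrM exprS.
have -> : m%:R * p.+1%:R * (b ^+ (p.+1 - j.+1) * (d * d ^+ j)) =
  p.+1%:R * d * (m%:R * b ^+ (p.+1 - j.+1) * d ^+ j) by ring.
rewrite -absvM [leLHS]absvM -[leRHS]mulr1 ler_wpM2l ?absv_ge0// !absvM !absvX.
by rewrite !mulr_ile1 ?mulr_ge0 ?exprn_ge0 ?exprn_ile1 ?absv_nat ?absv_ge0.
Qed.

Lemma exprn_small (t e : R) : 0 <= t -> t < 1 -> 0 < e ->
  exists N, forall n, (N <= n)%N -> t ^+ n < e.
Proof.
move=> t0 t1 e0; suff [N hN] : exists N, t ^+ N < e.
  exists N => n Nn; rewrite (le_lt_trans _ hN)//.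
  by rewrite ler_wiXn2l// ltW.
apply: contrapT => /forallNP h.
suff : 1 <= t by rewrite leNgt t1.
apply: (@ler_of_exprn _ _ _ e^-1) => // m.
by rewrite expr1n ler_pdivlMl// mulr1 leNgt; apply/negP; exact: h.
Qed.

End Powers.

(** * The perturbed tower of [p^2]-th roots *)

Section Tower.
Context {R : realType} {K : analyticFieldType R}.
Hypothesis K_closed : alg_closed [set: K].
(** [beta n] bounds the perturbation [P n] and is also its exact scaling factor on a disc of radius
    [tau]. As [|p| <= tau < beta 0], powers contract such discs more strongly than [P n] does. The
    element [w] serves to produce infinitely many well separated translations of size at most
    [tau]. *)
Variables (B : set K) (p : nat) (P : nat -> {poly K}) (u : nat -> K)
  (beta : nat -> R) (tau : R) (w : K).
Hypotheses (aB : acf B) (p_prime : prime p) (PB : forall n, P n \is a polyOver (mem B)).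
Hypotheses (beta_gt0 : forall n, 0 < beta n) (beta_le1 : forall n, beta n <= 1)
  (betaS : forall n, beta n.+1 ^+ p = beta n) (beta0_lt1 : beta 0%N < 1).
Hypotheses (tau_gt0 : 0 < tau) (p_le_tau : absv (p%:R : K) <= tau)
  (tau_lt : tau < beta 0%N).
Hypotheses (u_le1 : forall n, absv (u n) <= 1)
  (u_eq : forall n, u n = u n.+1 ^+ (p ^ 2) + (P n).[u n.+1])
  (P_le : forall n, absv (P n).[u n.+1] <= beta n)
  (P_scale : forall n v v', absv (v - u n.+1) <= tau -> absv (v' - u n.+1) <= tau ->
     absv ((P n).[v] - (P n).[v']) = beta n * absv (v - v')).
Hypotheses (u0_far : forall b, B b -> beta 0%N < absv (u 0%N - b))
  (w_neq0 : w != 0) (w_lt1 : absv w < 1).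
Hypothesis u0_gen : ta_span B [set u 0%N] = [set: K].

Let p_gt1 : (1 < p)%N := prime_gt1 p_prime.

Let beta_leS n : beta n <= beta n.+1.
Proof.
rewrite -betaS -[leRHS]expr1 ler_wiXn2l//; last exact: ltnW.
exact: ltW.
Qed.

Let beta0_le n : beta 0%N <= beta n.
Proof. by elim: n => [//|n IH]; exact: le_trans (beta_leS n). Qed.

Let p_le_beta0 : absv (p%:R : K) <= beta 0%N.
Proof. exact: le_trans p_le_tau (ltW tau_lt). Qed.

Lemma tower_pow_step1 (a b : K) n : absv a <= 1 -> absv b <= 1 ->
  absv (a - b) <= beta n.+1 -> absv (a ^+ p - b ^+ p) <= beta n.
Proof.
move=> a1 b1 ab; rewrite (le_trans (absv_expB_prime p_prime a1 b1))// ge_max.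
apply/andP; split.
  rewrite (le_trans _ (beta0_le n))// -[leRHS]mulr1 ler_pM ?absv_ge0//.
  exact: le_trans ab (beta_le1 _).
rewrite -betaS lerXn2r ?nnegrE ?absv_ge0//; exact: ltW.
Qed.

Lemma tower_pow_step2 (a b : K) n : absv a <= 1 -> absv b <= 1 ->
  absv (a - b) <= beta 0%N ^+ n.+1 -> absv (a ^+ p - b ^+ p) <= beta 0%N ^+ n.+2.
Proof.
move=> a1 b1 ab; rewrite (le_trans (absv_expB_prime p_prime a1 b1))// ge_max.
apply/andP; split; first by rewrite exprS ler_pM ?absv_ge0.
apply: (@le_trans _ _ ((beta 0%N ^+ n.+1) ^+ p)).
  by rewrite lerXn2r ?nnegrE ?absv_ge0// exprn_ge0// ltW.
rewrite -exprM ler_wiXn2l ?(ltW beta0_lt1) ?(ltW (beta_gt0 _))//.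
by rewrite (@leq_trans (n.+1 * 2))// ?leq_mul2l// muln2 -addnn addSn ltnS leq_addl.
Qed.

Let absvX1 (a : K) n : absv a <= 1 -> absv (a ^+ n) <= 1.
Proof. by move=> a1; rewrite absvX exprn_ile1 ?absv_ge0. Qed.

Lemma tower_pow1 (a b : K) n i : absv a <= 1 -> absv b <= 1 -> absv (a - b) <= beta n ->
  (i <= n)%N -> absv (a ^+ (p ^ i) - b ^+ (p ^ i)) <= beta (n - i)%N.
Proof.
move=> a1 b1 ab; elim: i => [|i IH] iN; first by rewrite subn0.
rewrite expnSr !exprM; apply: tower_pow_step1; rewrite ?absvX1//.
by rewrite -subSn// subSS; exact: IH (ltnW iN).
Qed.

Lemma tower_pow2 (a b : K) n i : absv a <= 1 -> absv b <= 1 ->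
  absv (a - b) <= beta 0%N ^+ n.+1 ->
  absv (a ^+ (p ^ i) - b ^+ (p ^ i)) <= beta 0%N ^+ (n + i).+1.
Proof.
move=> a1 b1 ab; elim: i => [|i IH]; first by rewrite addn0.
by rewrite expnSr !exprM addnS; apply: tower_pow_step2; rewrite ?absvX1.
Qed.

Let y_ n := u n ^+ (p ^ (n + n)).

Lemma tower_approx_step n : absv (y_ n - y_ n.+1) <= beta 0%N ^+ n.+1.
Proof.
have -> : y_ n.+1 = (u n.+1 ^+ (p ^ 2)) ^+ (p ^ (n + n)).
  by rewrite /y_ -exprM -expnD addnS addSn.
(* [tower_pow2] treats the outer exponent [p ^ n] and [tower_pow1] the inner one. *)
rewrite /y_ expnD ![_ ^+ (p ^ n * p ^ n)]exprM -[n in leRHS]add0n; apply: tower_pow2; rewrite ?absvX1//.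
rewrite expr1; have := @tower_pow1 (u n) (u n.+1 ^+ (p ^ 2)) n n.
rewrite subnn; apply; rewrite ?absvX1//.
by rewrite [X in absv (X - _)]u_eq addrC addKr P_le.
Qed.

Lemma tower_limit : exists y, forall n, absv (y_ n - y) <= beta 0%N ^+ n.+1.
Proof.
have beta0n n m : (n <= m)%N -> beta 0%N ^+ m <= beta 0%N ^+ n.
  by move=> nm; rewrite ler_wiXn2l ?(ltW beta0_lt1) ?(ltW (beta_gt0 _)).
have far n k : absv (y_ n - y_ (n + k)%N) <= beta 0%N ^+ n.+1.
  elim: k => [|k IH]; first by rewrite addn0 subrr absv0 exprn_ge0// ltW.
  rewrite addnS; apply: (absv_dist_le IH).
  by rewrite (le_trans (tower_approx_step _))// beta0n// ltnS leq_addr.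
have [|y hy] := @complete_absv _ _ y_.
  move=> e e0; have [N hN] := exprn_small (ltW (beta_gt0 0)) beta0_lt1 e0.
  exists N => n m Nn Nm; apply: (@absv_dist_lt _ _ _ _ (y_ N)).
    by rewrite absv_distC -(subnKC Nn) (le_lt_trans (far _ _))// hN.
  by rewrite -(subnKC Nm) (le_lt_trans (far _ _))// hN.
exists y => n; have [|N hN] := hy (beta 0%N ^+ n.+1); first by rewrite exprn_gt0.
apply: (@absv_dist_le _ _ _ _ (y_ (n + N)%N)); first exact: far.
by rewrite ltW// hN// leq_addl.
Qed.

Let f n v := v ^+ (p ^ 2) + (P n).[v].

(** The [p^2]-th power contributes at most [tau * |v - v'|], less than the contribution of [P n],
    which therefore decides. *)
Lemma tower_contract n v v' : absv v <= 1 -> absv v' <= 1 ->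
  absv (v - u n.+1) <= tau -> absv (v' - u n.+1) <= tau ->
  absv (f n v - f n v') = beta n * absv (v - v').
Proof.
move=> v1 v'1 vu v'u; have [->|vv'] := eqVneq v v'.
  by rewrite !subrr absv0 mulr0.
have d0 : 0 < absv (v - v') by rewrite absv_gt0 subr_eq0.
have dt : absv (v - v') <= tau by apply: (absv_dist_le vu); rewrite absv_distC.
have hstep (a b : K) : absv a <= 1 -> absv b <= 1 -> absv (a - b) <= tau ->
    absv (a ^+ p - b ^+ p) <= tau * absv (a - b).
  move=> a1 b1 ab; rewrite (le_trans (absv_expB_prime p_prime a1 b1))// ge_max.
  rewrite ler_wpM2r ?absv_ge0//=.
  apply: (@le_trans _ _ (absv (a - b) ^+ 2)).
    by rewrite ler_wiXn2l ?absv_ge0// (le_trans ab)// ltW// (lt_trans tau_lt).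
  by rewrite expr2 ler_wpM2r ?absv_ge0.
have t1 : tau <= 1 by rewrite ltW// (lt_trans tau_lt).
have pw : absv (v ^+ (p ^ 2) - v' ^+ (p ^ 2)) <= tau * absv (v - v').
  have h1 := hstep _ _ v1 v'1 dt.
  have h2 : tau * absv (v - v') <= absv (v - v') by rewrite ler_piMl ?absv_ge0.
  rewrite -mulnn !exprM (le_trans (hstep _ _ _ _ _)) ?absvX1//.
    exact: le_trans h1 (le_trans h2 dt).
  rewrite (le_trans (ler_wpM2l (ltW tau_gt0) h1))//.
  by rewrite ler_wpM2l ?(ltW tau_gt0)//.
have -> : f n v - f n v' =
    (v ^+ (p ^ 2) - v' ^+ (p ^ 2)) + ((P n).[v] - (P n).[v']) by rewrite /f; ring.
rewrite -(P_scale vu v'u) absvDr// P_scale//.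
rewrite (le_lt_trans pw)// ltr_pM2r// (lt_le_trans tau_lt)//.
Qed.

(** An element of [B] within [tau] of [u n.+1] would be mapped by [f n] to an element of [B] within
    [tau] of [u n]. This is what allows the translations of [u n] at every level. *)
Lemma tower_far n b : B b -> tau < absv (u n - b).
Proof.
have [sB _ _] := aB; elim: n b => [|n IH] b Bb.
  exact: lt_trans tau_lt (u0_far Bb).
rewrite ltNge; apply/negP => ub; have ub' : absv (b - u n.+1) <= tau by rewrite absv_distC.
have b1 : absv b <= 1.
  rewrite -(subKr (u n.+1) b) absvB_le// (le_trans ub)// ltW//.
  exact: lt_trans tau_lt beta0_lt1.
have : tau < absv (u n - f n b).
  apply: IH; apply: subfieldD => //; first exact: subfieldX.
  exact: subfield_horner.
rewrite u_eq -/(f n _) tower_contract//; last by rewrite subrr absv0 ltW.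
by rewrite ltNge (le_trans _ ub)// ler_piMl ?absv_ge0.
Qed.

Lemma tower_gen n : ta_span B [set u n] = [set: K].
Proof.
apply/seteqP; split=> // x _; move: {x}(x) (I : [set: K] x); rewrite -u0_gen.
have aS := span_acf B [set u n] K_closed; have [sS _ _] := aS.
apply: span1_sub => //; first exact: sub_spanl.
have : ta_span B [set u n] (u n) by exact: mem_ta_span1.
move: (ta_span B [set u n]) sS (@sub_spanl _ _ B [set u n]) => S sS BS.
elim: n {aS} => // n IH Sn; apply: IH; rewrite u_eq.
apply: subfieldD => //; first exact: subfieldX.
apply: subfield_horner => //; apply/(polyOver_setP _ (subfield0 sS)) => m; apply: BS.
have [sB _ _] := aB; move: m; exact/(polyOver_setP _ (subfield0 sB)).
Qed.

Lemma tower_map (s : {rmorphism K -> K}) n : (forall b, B b -> s b = b) ->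
  s (u n) = f n (s (u n.+1)).
Proof.
move=> sb; rewrite {1}u_eq rmorphD rmorphXn /f; congr (_ + _).
rewrite -horner_map; congr _.[_]; apply/polyP => m; rewrite coef_map /= sb//.
have [sB _ _] := aB; move: m; exact/(polyOver_setP _ (subfield0 sB)).
Qed.

Let prod_beta n := \prod_(i < n) beta i.

Lemma prod_beta_ge n : beta 0%N ^+ 2 <= prod_beta n.
Proof.
(* The right-hand side does not decrease with [n], because
   [beta n.+1 ^ 2 >= beta n.+1 ^ p = beta n]. *)
suff h : beta 0%N ^+ 2 <= prod_beta n * beta n ^+ 2.
  rewrite (le_trans h)// ler_piMr//; first by apply: prodr_ge0 => j _; exact: ltW.
  by rewrite exprn_ile1// ltW.
elim: n => [|n IH]; first by rewrite /prod_beta big_ord0 mul1r.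
rewrite (le_trans IH)// /prod_beta big_ord_recr /= -mulrA ler_wpM2l//.
  by apply: prodr_ge0 => j _; exact: ltW.
rewrite expr2 ler_pM2l// -betaS ler_wiXn2l//; exact: ltW.
Qed.

(* The map [v |-> v ^ (p^2) + P_n(v)] scales the distances near [u_(n+1)] by the
   factor [beta n], and the product of these factors is bounded below. *)
Lemma tower_spread n (s t : {rmorphism K -> K}) : isometric s -> isometric t ->
  (forall b, B b -> s b = b) -> (forall b, B b -> t b = b) ->
  absv (s (u n) - u n) <= tau -> absv (t (u n) - u n) <= tau ->
  absv (s (u 0%N) - t (u 0%N)) = prod_beta n * absv (s (u n) - t (u n)).
Proof.
move=> si ti sB tB; elim: n => [|n IH] su tu.
  by rewrite /prod_beta big_ord0 mul1r.
have b1 n' (a : R) : 0 <= a -> beta n' * a <= a by move=> a0; rewrite ler_piMl.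
have close (r : {rmorphism K -> K}) : isometric r -> (forall b, B b -> r b = b) ->
    absv (r (u n.+1) - u n.+1) <= tau -> absv (r (u n) - u n) <= tau.
  move=> ri rB ru; rewrite (tower_map n rB) [X in _ - X]u_eq -/(f n _) tower_contract ?ri//.
    by rewrite (le_trans (b1 _ _ _)) ?absv_ge0.
  by rewrite subrr absv0 ltW.
rewrite IH ?close// !(tower_map n) ?tower_contract ?si ?ti//.
by rewrite /prod_beta big_ord_recr /= mulrA.
Qed.

(** The iterated square roots of [w] have distinct absolute values in [[|w|, 1)], so their
    differences are at least [|w|] in size; a power of [w] scales them below [tau]. *)
Lemma spread_sequence : exists (e : nat -> K) (c : R), [/\ 0 < c,
  forall j, absv (e j) <= tau & forall j l, j != l -> c <= absv (e j - e l)].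
Proof.
have w0 : 0 < absv w by rewrite absv_gt0.
have /choice[sq hsq] : forall a : K, exists b : K, b ^+ 2 = a.
  move=> a; have XaT : 'X^2 - a%:P \is a polyOver (mem [set: K]).
    by apply/(polyOver_setP _ _).
  have [|b _ /rootP] := K_closed XaT; first by rewrite size_XnsubC.
  rewrite !hornerE => /eqP; rewrite subr_eq0 => /eqP ba; by exists b.
pose r := fix r n := if n is m.+1 then sq (r m) else w.
have rE n : absv (r n.+1) ^+ 2 = absv (r n) by rewrite -absvX hsq.
have r01 n : 0 < absv (r n) < 1.
  elim: n => [|n /andP[h0 h1]]; first by rewrite w0.
  rewrite -(@expr_lt1 _ 2)// ?absv_ge0// rE h1 andbT.
  by rewrite lt0r absv_ge0 andbT -sqrf_eq0 rE gt_eqF.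
have rS n : absv (r n) < absv (r n.+1).
  have /andP[h0 h1] := r01 n.+1.
  by rewrite -rE expr2 gtr_pMl.
have rlt n k : absv (r n) < absv (r (n + k.+1)%N).
  elim: k => [|k IH]; first by rewrite addn1.
  by rewrite addnS (lt_trans IH).
have rge n : absv w <= absv (r n) by case: n => [//|n]; exact: ltW (rlt 0%N n).
have [N /(_ N (leqnn N)) hN] := exprn_small (ltW w0) w_lt1 tau_gt0.
have e0 : 0 < absv w ^+ N by rewrite exprn_gt0.
exists (fun j => w ^+ N * r j), (absv w ^+ N * absv w); split.
- by rewrite mulr_gt0.
- move=> j; rewrite absvM absvX (le_trans _ (ltW hN))// ler_piMr ?(ltW e0)//.
  by have /andP[_ /ltW] := r01 j.
move=> j l jl; rewrite -mulrBr absvM absvX ler_pM2l//.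
wlog jl' : j l jl / (j < l)%N.
  move=> wl; have := jl; rewrite neq_ltn => /orP[|] h; first exact: wl.
  by rewrite absv_distC; apply: wl; rewrite // eq_sym.
have := rlt j (l - j.+1)%N; rewrite addnS -addSn subnKC// => h.
by rewrite absvDr ?absvN.
Qed.

Lemma tower_proper : exists2 y, ~ B y & ~ ta_span B [set y] (u 0%N).
Proof.
have [y hy] := tower_limit.
have [e [c [c0 etau ec]]] := spread_sequence.
have [sB _ _] := aB.
exists y.
  (* Since [y_ 0 = u 0], the limit is within [beta 0] of [u 0], too close to be in [B]. *)
  move=> By; have := u0_far By; rewrite ltNge; have := hy 0%N.
  by rewrite /y_ expr1 expr1 => ->.
have b20 : 0 < beta 0%N ^+ 2 by rewrite exprn_gt0.
apply: (@notin_span1 _ _ K_closed _ _ _ (beta 0%N ^+ 2 * c)) => //.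
  by rewrite mulr_gt0.
move=> d d0; have [n /(_ _ (leqnn n)) hn] :=
  exprn_small (ltW (beta_gt0 0)) beta0_lt1 d0.
have /choice[s hs] : forall j, exists s : {rmorphism K -> K},
    [/\ isometric s, s (u n) = u n + e j & forall b, B b -> s b = b].
  move=> j; apply: (isometric_extension K_closed aB (tower_gen n)) => b Bb.
  by rewrite opprD addrA subrr add0r absvN (le_lt_trans (etau j))// tower_far.
exists s; split=> [j|j l jl].
  have [si su sb] := hs j; split=> //.
  have hn' : beta 0%N ^+ n.+1 <= d.
    rewrite (le_trans _ (ltW hn))// ler_wiXn2l//; exact: ltW.
  apply: (@absv_dist_le _ _ _ _ (s j (y_ n))).
    by rewrite isometricB// absv_distC (le_trans (hy n)).
  apply: (@absv_dist_le _ _ _ _ (y_ n)); last by rewrite (le_trans (hy n)).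
  rewrite /y_ rmorphXn; apply: (@le_trans _ _ (beta 0%N ^+ (0 + (n + n)).+1)).
    apply: tower_pow2; rewrite ?si//.
    by rewrite su addrC addKr expr1 (le_trans (etau j))// ltW.
  by rewrite (le_trans _ hn')// ler_wiXn2l ?(ltW beta0_lt1) ?(ltW (beta_gt0 _))// ltnS add0n leq_addr.
have [si su sb] := hs j; have [ti tu tb] := hs l.
rewrite (@tower_spread n) ?su ?tu//; last 2 first.
  by rewrite addrC addKr.
  by rewrite addrC addKr.
have -> : u n + e j - (u n + e l) = e j - e l by ring.
rewrite ler_pM ?(ltW b20) ?(ltW c0)//; [exact: prod_beta_ge|exact: ec].
Qed.

End Tower.

Section ProperSubfield.
Context {R : realType} {K : analyticFieldType R}.
Hypothesis K_closed : alg_closed [set: K].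
Implicit Types (B : set K) (g : {poly K}).

Lemma root_lt1 g n : (size g <= n)%N -> (0 < n)%N -> absv g.[0] < 1 ->
  exists2 v, v ^+ n + g.[v] = 0 & absv v < 1.
Proof.
move=> gn n0 g0; pose f := 'X^n + g.
have fT : f \is a polyOver (mem [set: K]) by apply/(polyOver_setP _ _).
have [rs _ fE] := acf_factor (acf_setT K_closed) fT.
have f1 : lead_coef f = 1 by rewrite lead_coefDl ?lead_coefXn// size_polyXn ltnS.
have [|||v vrs] := @root_near _ _ f rs (lead_coef f) 0 1.
- exact: ler01.
- exact: fE.
- by rewrite f1 absv1 expr1n mulr1 /f hornerD hornerXn expr0n gtn_eqF// add0r.
rewrite sub0r absvN => v1; exists v => //.
have : root f v by rewrite fE f1 scale1r root_prod_XsubC.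
by rewrite /f => /rootP; rewrite hornerD hornerXn.
Qed.

Lemma subfield_root B n (c : K) : acf B -> (0 < n)%N -> B c -> exists2 b, B b & b ^+ n = c.
Proof.
move=> [sB _ cB] n0 Bc; have [||b Bb] := cB ('X^n - c%:P).
- apply/(polyOver_setP _ (subfield0 sB)) => j; rewrite coefB coefXn coefC.
  apply: (subfieldB sB); last by case: eqP => // _; exact: subfield0.
  by case: eqP => _; [exact: subfield1|exact: subfield0].
- by rewrite size_XnsubC.
- by move=> /rootP; rewrite !hornerE => /eqP; rewrite subr_eq0 => /eqP; exists b.
Qed.

(** A root [r] of [c] of high order satisfies [s / t < |r| < 1]; its powers, multiplied by a large
    constant, cannot jump over the interval from [s] to [t]. *)
Lemma value_group_dense B (c : K) (s t : R) : acf B -> B c -> c != 0 -> absv c < 1 ->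
  0 < s -> s < t -> exists d, [/\ B d, s < absv d & absv d < t].
Proof.
move=> aB Bc c0 c1 s0 st; have [sB _ _] := aB.
have t0 := lt_trans s0 st; have ac : 0 < absv c by rewrite absv_gt0.
have st1 : s / t < 1 by rewrite ltr_pdivrMr// mul1r.
have [N hN] := exprn_small (divr_ge0 (ltW s0) (ltW t0)) st1 ac.
have [r Br rE] := subfield_root aB (ltn0Sn N) Bc.
have {}rE : absv r ^+ N.+1 = absv c by rewrite -absvX rE.
have r1 : absv r < 1 by rewrite -(@expr_lt1 _ N.+1) ?absv_ge0// rE.
have rst : s / t < absv r.
  rewrite ltNge; apply/negP => h; have := hN N.+1 (leqnSn N).
  rewrite ltNge -rE lerXn2r ?nnegrE ?absv_ge0//.
  by rewrite divr_ge0 ?ltW.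
have r0 : 0 < absv r by rewrite (lt_trans _ rst)// divr_gt0.
have ti : 0 < t^-1 by rewrite invr_gt0.
have [M /(_ _ (leqnn M)) hM] := exprn_small (ltW ac) c1 ti.
pose D := c^-1 ^+ M; have aD : t < absv D.
  by rewrite absvX absvV exprVn -[ltLHS]invrK ltf_pV2 ?posrE ?exprn_gt0.
have D0 : 0 < absv D := lt_trans t0 aD.
have exj : exists j, absv D * absv r ^+ j < t.
  have [j /(_ _ (leqnn j)) hj] := exprn_small (ltW r0) r1 (divr_gt0 t0 D0).
  by exists j; rewrite mulrC -ltr_pdivlMr.
have := ex_minnP exj => -[[|j] hj jmin].
  by move: hj; rewrite mulr1 ltNge ltW.
exists (D * r ^+ j.+1); split; last by rewrite absvM absvX.
  by apply: subfieldM => //; apply: subfieldX => //; exact: subfieldV.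
rewrite absvM absvX exprS mulrCA; move: rst; rewrite ltr_pdivrMr// => /lt_le_trans; apply.
rewrite ler_pM2l// leNgt; apply/negP => /jmin; by rewrite ltnn.
Qed.

(* The tower with [P_n = b_n X], where [b_(n+1) ^ p = b_n] and [|p| < |b_0| < 1]. *)
Lemma proper_subfield_nontrivial B p (x0 c : K) : acf B -> prime p -> absv (p%:R : K) < 1 ->
  B c -> c != 0 -> absv c < 1 -> ~ B x0 -> ta_span B [set x0] = [set: K] ->
  exists2 y, ~ B y & ta_span B [set y] <> [set: K].
Proof.
move=> aB pp p1 Bc c0 c1 nBx0 x0K; have [sB clB _] := aB.
have p_gt0 := prime_gt0 pp; have p_gt1 := prime_gt1 pp.
have B_0 := subfield_nonempty sB.
have [b0 [Bb0 pb0 b01]] : exists b0, [/\ B b0, absv (p%:R : K) < absv b0 & absv b0 < 1].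
  (* The maximum with [1 / 2] gives a positive bound even when [p] vanishes in [K]. *)
  have s0 : 0 < Num.max (absv (p%:R : K)) 2^-1 by rewrite lt_max invr_gt0 ltr0n orbT.
  have [|d [Bd]] := value_group_dense (t := 1) aB Bc c0 c1 s0.
    by rewrite gt_max p1 invf_lt1// ltr1n.
  by rewrite gt_max => /andP[pd _] d1; exists d.
have gam0 : 0 < absv b0 := le_lt_trans (absv_ge0 _) pb0.
have r0 : 0 < dist B x0 by exact: dist_gt0.
(* An affine change of [x0] over [B] yields [|x| < 1] with [B] farther than [|b0|] from [x]: take
   [a] close to optimal and [|d|] between [|x0 - a|] and [dist B x0 / |b0|]. *)
have rlt : dist B x0 < dist B x0 / absv b0 by rewrite ltr_pdivlMr// gtr_pMr.
have [a Ba xa] := dist_lt B_0 rlt.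
have xa0 : 0 < absv (x0 - a) := lt_le_trans r0 (dist_le x0 Ba).
have [d [Bd xd dr]] := value_group_dense aB Bc c0 c1 xa0 xa.
have ad : 0 < absv d := lt_trans xa0 xd.
have d0 : d != 0 by rewrite -absv_gt0.
pose x := (x0 - a) / d.
have x1 : absv x < 1 by rewrite absv_div ltr_pdivrMr// mul1r.
have xfar b : B b -> absv b0 < absv (x - b).
  move=> Bb; have -> : x - b = (x0 - (a + d * b)) / d by rewrite /x; field.
  rewrite absv_div ltr_pdivlMr// mulrC -ltr_pdivlMr//.
  rewrite (lt_le_trans dr)// ler_pM2r ?invr_gt0//.
  by apply: dist_le; apply: subfieldD => //; exact: subfieldM.
have xK : ta_span B [set x] = [set: K].
  apply/seteqP; split=> // z _; have : [set: K] z by [].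
  have aS := span_acf B [set x] K_closed; have [sS _ _] := aS.
  have BS := @sub_spanl _ _ B [set x].
  rewrite -x0K; apply: (span1_sub aS BS).
  have -> : x0 = a + d * x by rewrite /x; field.
  apply: (subfieldD sS (BS _ Ba)); apply: (subfieldM sS (BS _ Bd)).
  exact: mem_ta_span1.
have /choice[rt hrt] : forall b, exists b', B b -> B b' /\ b' ^+ p = b.
  move=> b; have [Bb|nBb] := pselect (B b); last by exists 0.
  by have [b' Bb' bE] := subfield_root aB p_gt0 Bb; exists b'.
pose bs := fix bs n := if n is m.+1 then rt (bs m) else b0.
have Bbs n : B (bs n) by elim: n => [//|n IH]; exact: (hrt _ IH).1.
have bsE n : bs n.+1 ^+ p = bs n by exact: (hrt _ (Bbs n)).2.
have bs01 n : 0 < absv (bs n) < 1.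
  elim: n => [|n /andP[h0 h1]]; first by rewrite /= gam0.
  move: h0 h1; rewrite -bsE absvX => h0 h1.
  have b'0 : 0 < absv (bs n.+1).
    by rewrite lt0r absv_ge0 andbT; apply: contraTneq h0 => ->; rewrite expr0n gtn_eqF// ltxx.
  by rewrite b'0 -(@expr_lt1 _ p)// ltW.
pose P n : {poly K} := bs n *: 'X.
have /choice[next hnext] : forall nv : nat * K, exists v, absv nv.2 < 1 ->
    nv.2 = v ^+ (p ^ 2) + (P nv.1).[v] /\ absv v < 1.
  move=> [n v] /=; have [v1|] := boolP (absv v < 1); last by exists 0.
  have [|||w wE w1] := @root_lt1 (P n - v%:P) (p ^ 2).
  - rewrite (leq_trans (size_polyD _ _))// size_polyN geq_max.
    have q2 : (2 <= p ^ 2)%N by rewrite -mulnn (leq_trans p_gt1)// leq_pmulr.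
    apply/andP; split; first by rewrite (leq_trans (size_scale_leq _ _))// size_polyX.
    exact: leq_trans (size_polyC_leq1 _) (ltnW q2).
  - by rewrite expn_gt0 p_gt0.
  - by rewrite /P !(hornerE, mulr0, sub0r, add0r, absvN).
  exists w => _; split=> //; apply/eqP; rewrite eq_sym -subr_eq0.
  by move: wE; rewrite hornerD hornerN hornerC addrA => ->.
pose u := fix u n := if n is m.+1 then next (m, u m) else x.
have u1 n : absv (u n) < 1.
  by elim: n => [|n IH] //=; exact: (hnext (n, u n) IH).2.
have uE n : u n = u n.+1 ^+ (p ^ 2) + (P n).[u n.+1] by exact: (hnext (n, u n) (u1 n)).1.
pose tau := Num.max (absv (p%:R : K)) (absv b0 / 2).
have [||||||||||||||||||y nBy nxy] := @tower_proper _ _ K_closed B p P u (fun n => absv (bs n)) tau c.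
- exact: aB.
- exact: pp.
- move=> n; apply/(polyOver_setP _ (subfield0 sB)) => j; rewrite coefZ coefX.
  apply: subfieldM => //; case: eqP => _; [exact: subfield1|exact: subfield0].
- by move=> n; have /andP[] := bs01 n.
- by move=> n; have /andP[_ /ltW] := bs01 n.
- by move=> n; rewrite -absvX bsE.
- exact: b01.
- by rewrite lt_max divr_gt0 ?orbT.
- by rewrite le_max lexx.
- by rewrite gt_max pb0 ltr_pdivrMr// mulr_natr mulr2n ltrDl.
- by move=> n; exact: ltW.
- exact: uE.
- by move=> n; rewrite hornerZ hornerX absvM ler_piMr ?absv_ge0// ltW.
- by move=> n v v' _ _; rewrite !hornerZ !hornerX -mulrBr absvM.
- exact: xfar.
- exact: c0.
- exact: c1.
- exact: xK.
by exists y => // yK; apply: nxy; rewrite yK.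
Qed.

(* The only [b] in [B] with [|b| < 1] is [0], so the tower is built with the perturbation
   [P_n = X ^ (p^(n+3) + 1)], which scales small discs around [u_(n+1)] by the factor
   [|u_(n+1)| ^ (p^(n+3)) = |x| ^ (p^(1-n))]. *)
Lemma proper_subfield_trivial B p (x : K) : acf B -> prime p -> (p%:R : K) = 0 ->
  (forall b, B b -> b != 0 -> absv b = 1) -> x != 0 -> absv x < 1 ->
  ta_span B [set x] = [set: K] -> exists2 y, ~ B y & ta_span B [set y] <> [set: K].
Proof.
move=> aB pp p0 B1 x0 x1 xK; have [sB clB _] := aB.
have p_gt0 := prime_gt0 pp; have p_gt1 := prime_gt1 pp.
have ax : 0 < absv x by rewrite absv_gt0.
(* The shift by 3 makes [be 0 = |x| ^ p] strictly smaller than [|x|], the distance from [x] to the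
   trivially valued [B]; a shift by 2 would give [|x|] itself. *)
pose P n : {poly K} := 'X^((p ^ (n + 3)).+1).
have q2 n : (p ^ 2 < (p ^ (n + 3)).+1)%N by rewrite ltnS leq_exp2l// (leq_trans _ (leq_addl n 3)).
have /choice[next hnext] : forall nv : nat * K, exists v, absv nv.2 < 1 ->
    nv.2 = v ^+ (p ^ 2) + (P nv.1).[v] /\ absv v < 1.
  move=> [n v] /=; have [v1|] := boolP (absv v < 1); last by exists 0.
  have [|||w wE w1] := @root_lt1 ('X^(p ^ 2) - v%:P) (p ^ (n + 3)).+1.
  - by rewrite size_XnsubC ?expn_gt0 ?p_gt0.
  - by [].
  - by rewrite !hornerE expr0n gtn_eqF ?expn_gt0 ?p_gt0// sub0r absvN.
  exists w => _; split=> //; apply/eqP; rewrite eq_sym -subr_eq0.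
  move: wE; rewrite hornerD hornerN hornerC hornerXn => <-.
  by rewrite /P hornerXn; apply/eqP; ring.
pose u := fix u n := if n is m.+1 then next (m, u m) else x.
have u1 n : absv (u n) < 1.
  by elim: n => [|n IH] //=; exact: (hnext (n, u n) IH).2.
have uE n : u n = u n.+1 ^+ (p ^ 2) + (P n).[u n.+1] by exact: (hnext (n, u n) (u1 n)).1.
have auE n : 0 < absv (u n) -> 0 < absv (u n.+1) /\ absv (u n.+1) ^+ (p ^ 2) = absv (u n).
  move=> un; have un1 : 0 < absv (u n.+1).
    rewrite absv_gt0; apply: contraTneq un => un0; rewrite uE un0 hornerXn.
    by rewrite !expr0n gtn_eqF ?expn_gt0 ?p_gt0// addr0 absv0 ltxx.
  split=> //; rewrite [in RHS]uE absvDl ?absvX// hornerXn absvX.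
  have := q2 n; set m := (p ^ (n + 3)).+1 => qm.
  rewrite -(subnK (ltnW qm)) exprD gtr_pMl ?exprn_gt0// exprn_ilt1 ?absv_ge0//.
  by rewrite -lt0n subn_gt0.
have u0 n : 0 < absv (u n) by elim: n => [//|n /auE[]].
have {}auE n : absv (u n.+1) ^+ (p ^ 2) = absv (u n) by have [] := auE n (u0 n).
have xu n : absv x <= absv (u n).
  elim: n => [//|n IH]; rewrite (le_trans IH)// -auE -[leRHS]expr1.
  by rewrite ler_wiXn2l ?absv_ge0 ?expn_gt0 ?p_gt0// ltW.
pose be n := absv (u n.+1) ^+ (p ^ (n + 3)).
have be0 : be 0%N = absv x ^+ p.
  by rewrite /be add0n (expnD p 2 1) exprM auE expn1.
have be_lt : be 0%N < absv x.
  rewrite be0; apply: (@le_lt_trans _ _ (absv x ^+ 2)).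
    by rewrite ler_wiXn2l ?(ltW ax) ?(ltW x1).
  by rewrite expr2 gtr_pMl.
have b0 : 0 < be 0%N by rewrite exprn_gt0.
pose tau := be 0%N / 2.
have tau0 : 0 < tau by rewrite divr_gt0.
have tau_lt : tau < be 0%N by rewrite ltr_pdivrMr// mulr_natr mulr2n ltrDl.
have pw (a b : K) i : absv a <= 1 -> absv b <= 1 ->
    absv (a ^+ (p ^ i) - b ^+ (p ^ i)) <= absv (a - b) ^+ (p ^ i).
  move=> a1 b1; elim: i => [|i IH]; first by rewrite !expr1.
  rewrite expnSr !exprM (le_trans (absv_expB_prime pp _ _)) ?absvX ?exprn_ile1 ?absv_ge0//.
  rewrite p0 absv0 mul0r ge_max !exprn_ge0 ?absv_ge0//=.
  by rewrite lerXn2r ?nnegrE ?exprn_ge0 ?absv_ge0.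
have far b : B b -> be 0%N < absv (x - b).
  move=> Bb; have [->|bn0] := eqVneq b 0; first by rewrite subr0.
  have xb : absv x < absv (- b) by rewrite absvN (B1 b).
  by rewrite absvDr// (lt_trans be_lt).
have [||||||||||||||||||y nBy nxy] := @tower_proper _ _ K_closed B p P u be tau x.
- exact: aB.
- exact: pp.
- move=> n; apply/(polyOver_setP _ (subfield0 sB)) => j; rewrite coefXn.
  by case: eqP => _; [exact: subfield1|exact: subfield0].
- by move=> n; rewrite exprn_gt0.
- by move=> n; rewrite exprn_ile1 ?absv_ge0// ltW.
- by move=> n; rewrite /be -exprM -expnSr (expnD p 2 (n + 3)) exprM auE.
- exact: lt_trans be_lt x1.
- exact: tau0.
- by rewrite p0 absv0 ltW.
- exact: tau_lt.
- by move=> n; exact: ltW.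
- exact: uE.
- by move=> n; rewrite hornerXn absvX exprSr ler_piMr ?exprn_ge0 ?absv_ge0// ltW.
- move=> n v v' vu v'u; rewrite !hornerXn.
  have tu : tau < absv (u n.+1) := lt_le_trans (lt_trans tau_lt be_lt) (xu n.+1).
  have near w : absv (w - u n.+1) <= tau -> absv w = absv (u n.+1).
    by move=> h; apply: absv_near; rewrite absv_distC (le_lt_trans h).
  have [vE v'E] := (near _ vu, near _ v'u).
  have [->|vv'] := eqVneq v v'; first by rewrite !subrr absv0 mulr0.
  have d0 : 0 < absv (v - v') by rewrite absv_gt0 subr_eq0.
  have dt : absv (v - v') < absv (u n.+1).
    rewrite (le_lt_trans _ tu)//; apply: (absv_dist_le vu); by rewrite absv_distC.
  set N := (p ^ (n + 3))%N.
  (* The first term dominates: in characteristic [p] the second is at most [|v - v'| ^ N * |v'|],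
     and [|v - v'| < |v| = |v'|]. *)
  have -> : v ^+ N.+1 - v' ^+ N.+1 = v ^+ N * (v - v') + (v ^+ N - v' ^+ N) * v'.
    by rewrite !exprSr; ring.
  rewrite absvDl; first by rewrite absvM absvX vE.
  rewrite !absvM absvX vE v'E.
  have [m NE] : exists m, N = m.+2.
    have N1 : (1 < N)%N by rewrite -(exp1n (n + 3)) ltn_exp2r// addn3.
    by exists N.-2; case: (N) N1 => [|[|]].
  apply: (@le_lt_trans _ _ (absv (v - v') ^+ N * absv (u n.+1))).
    by rewrite ler_wpM2r ?absv_ge0// pw ?vE ?v'E// ltW.
  have : absv (v - v') ^+ m.+1 < absv (u n.+1) ^+ m.+1 by rewrite ltrXn2r ?absv_ge0.
  rewrite NE !(exprSr _ m.+1) => h; rewrite -mulrA -(mulrA _ (absv (u n.+1))).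
  by rewrite [absv (u n.+1) * _]mulrC ltr_pM2r ?mulr_gt0.
- exact: far.
- exact: x0.
- exact: x1.
- exact: xK.
by exists y => // yK; apply: nxy; rewrite yK.
Qed.

Lemma proper_subfield B p (x0 : K) : acf B -> prime p -> absv (p%:R : K) < 1 ->
  (exists x : K, x != 0 /\ absv x != 1) -> ~ B x0 ->
  ta_span B [set x0] = [set: K] -> exists2 y, ~ B y & ta_span B [set y] <> [set: K].
Proof.
move=> aB pp p1 [x [xn0 x1]] nBx0 x0K; have [sB clB _] := aB.
have small (z : K) : z != 0 -> absv z != 1 -> exists w, [/\ w != 0, absv w < 1 & w = z \/ w = z^-1].
  move=> z0; rewrite neq_lt => /orP[z1|z1]; first by exists z; split=> //; left.
  exists z^-1; split; [by rewrite invr_eq0| |by right].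
  by rewrite absvV invf_lt1// (lt_trans ltr01).
have [[c [Bc c0 c1]]|triv] := pselect (exists c, [/\ B c, c != 0 & absv c != 1]).
  have [w [w0 w1 wE]] := small _ c0 c1.
  have Bw : B w by case: wE => ->; [exact: Bc|exact: subfieldV].
  exact: (proper_subfield_nontrivial aB pp p1 Bw w0 w1 nBx0 x0K).
have {}triv b : B b -> b != 0 -> absv b = 1.
  by move=> Bb b0; apply/eqP; apply: contraT => b1; exfalso; apply: triv; exists b.
have [w [w0 w1 _]] := small _ xn0 x1.
have nBw : ~ B w by move=> /triv/(_ w0) e; move: w1; rewrite e ltxx.
(* Either [w] is already the required element, or it is a generator and the tower can start from
   it. *)
have [wK|wK] := pselect (ta_span B [set w] = [set: K]); last by exists w.
apply: (proper_subfield_trivial aB pp _ triv w0 w1 wK).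
(* [p] lies in the trivially valued field [B], so [|p| < 1] means [p = 0]. *)
apply/eqP; apply: contraT => pn0; move: p1; rewrite triv ?ltxx//.
have [E [v vE]] := field_of_subfield sB.
by rewrite -vE; exists p%:R; rewrite ?rmorph_nat.
Qed.

End ProperSubfield.

(** * Well-orders and the first uncountable ordinal *)

Section WellOrder.
Variables (W : Type) (r : rel W).
Hypothesis rwo : well_order r.

Lemma wo_min (A : set W) : A !=set0 -> exists2 z, A z & forall x, A x -> r z x.
Proof.
move=> [a Aa]; have [|z [[/asboolP Az zmin] _]] := rwo (A := fun x => `[< A x >]).
  by exists a; apply/asboolP.
by exists z => // x Ax; apply: zmin; apply/asboolP.
Qed.

Lemma wo_total x y : r x y \/ r y x.
Proof.
have [|z [->|->] h] := @wo_min [set x; y]; first by exists x; left.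
  by left; apply: h; right.
by right; apply: h; left.
Qed.

Lemma wo_refl x : r x x. Proof. by case: (wo_total x x). Qed.

Lemma wo_anti x y : r x y -> r y x -> x = y.
Proof.
move=> xy yx; have [|z [_ zuniq]] := rwo (A := fun u => `[< u = x \/ u = y >]).
  by exists x; apply/asboolP; left.
have h u : u = x \/ u = y -> minimum_of r (fun u => `[< u = x \/ u = y >]) u.
  move=> uE; split; first exact/asboolP.
  by move=> v /asboolP[->|->]; case: uE => ->//; exact: wo_refl.
by rewrite -(zuniq x (h _ (or_introl erefl))) -(zuniq y (h _ (or_intror erefl))).
Qed.

Lemma wo_trans y x z : r x y -> r y z -> r x z.
Proof.
move=> xy yz; have [|m [[->|->]|->] h] := @wo_min [set x; y; z].
- by exists x; left; left.
- by apply: h; right.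
- by rewrite (wo_anti xy) //; apply: h; left; left.
- by rewrite -(wo_anti yz)//; apply: h; left; right.
Qed.

Definition wo_lt x y := ~ r y x.

Lemma wo_ltW x y : wo_lt x y -> r x y.
Proof. by case: (wo_total x y). Qed.

Lemma wo_ltgt x y : [\/ x = y, wo_lt x y | wo_lt y x].
Proof.
have [xy|nxy] := pselect (r x y); last by constructor 3.
have [yx|nyx] := pselect (r y x); last by constructor 2.
by constructor 1; exact: wo_anti.
Qed.

Lemma wo_lt_wf : well_founded wo_lt.
Proof.
move=> x; apply: contrapT => nx.
have [|z nz zmin] := @wo_min [set x | ~ Acc wo_lt x]; first by exists x.
apply: nz; constructor => y yz; apply: contrapT => ny.
exact: yz (zmin _ ny).
Qed.

(** Transfinite recursion in which a value is constrained only by the set of the earlier ones. *)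
Lemma wo_construct T (Q : set T -> T -> Prop) :
  (forall w, countable [set v | wo_lt v w]) ->
  (forall X, countable X -> exists t, Q X t) ->
  exists f : W -> T, forall w, Q (f @` [set v | wo_lt v w]) (f w).
Proof.
move=> seg QX.
have /choice[pick hpick] : forall X, exists t, countable X -> Q X t.
  move=> X; have [cX|nX] := pselect (countable X); first by have [t] := QX X cX; exists t.
  by have [t _] := QX set0 (countable0 _); exists t.
pose step w (rec : forall v, wo_lt v w -> T) : T :=
  pick [set t | exists v (h : wo_lt v w), rec v h = t].
pose f := Fix wo_lt_wf (fun _ => T) step.
have fE w : f w = pick (f @` [set v | wo_lt v w]).
  rewrite /f Fix_eq; last first.
    move=> v g h gh; congr pick; apply/seteqP.
    by split=> t [z [zv <-]]; exists z, zv; rewrite gh.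
  congr pick; apply/seteqP; split=> [t [v [h <-]]|t [v h <-]]; first by exists v.
  by exists v, h.
exists f => w; rewrite fE; apply: hpick.
by apply: (sub_countable _ (seg w)); exact: card_image_le.
Qed.

(* Send [w] to a rational number between the values of [g] at [w] and at its
   successor. *)
Lemma countable_antitone (R : realType) (D : set W) (g : W -> R) :
  (forall v w, D v -> D w -> wo_lt v w -> g w < g v) -> countable D.
Proof.
move=> gD; pose above w := [set v | D v /\ wo_lt w v].
(* [None] marks a last element of [D], which has no successor. *)
have /choice[q hq] : forall w, exists q : option rat, D w ->
    if q is Some a then ratr a < g w /\ (forall v, above w v -> g v < ratr a)
    else above w = set0.
  move=> w; have [[v0 av0]|nv] := pselect (exists v, above w v); last first.
    by exists None => _; apply/seteqP; split=> // v ?; apply: nv; exists v.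
  have [|s [Ds ws] smin] := @wo_min (above w); first by exists v0.
  have [Dw|nDw] := pselect (D w); last by exists None.
  have [a] := rat_in_itvoo (gD _ _ Dw Ds ws); rewrite in_itv/= => /andP[ga aw].
  exists (Some a) => _; split=> // v [Dv wv].
  have [<-//|sv|vs] := wo_ltgt s v; first exact: lt_trans (gD _ _ Ds Dv sv) ga.
  by have := smin v (conj Dv wv).
apply/countable_injP; exists (fun w => pickle (q w)) => v w /set_mem Dv /set_mem Dw.
move=> /(pcan_inj pickleK) qvw.
wlog vw : v w Dv Dw qvw / wo_lt v w.
  move=> wl; have [//|vw|wv] := wo_ltgt v w; first exact: wl.
  by apply/esym; apply: wl.
have := hq v Dv; have := hq w Dw; rewrite -qvw; case: (q v) => [a|_ e].
  by move=> [aw _] [_ /(_ w (conj Dw vw)) wa]; have := lt_trans aw wa; rewrite ltxx.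
by have : above v w by []; rewrite e.
Qed.

End WellOrder.

Lemma omega1_segment (w : omega1) : countable [set v | wo_lt omega1_le v w].
Proof.
apply: sub_countable (countable_omega1_segment w); apply: subset_card_le => v.
exact: (wo_ltW omega1_le_wo).
Qed.

Lemma countable_setU1 T (x : T) (A : set T) : countable A -> countable (x |` A).
Proof.
move=> cA; have : countable (\bigcup_(b : bool) (if b then A else [set x])).
  by apply: bigcup_countable => // -[].
apply: sub_countable; apply: subset_card_le => y [->|Ay].
  by exists false.
by exists true.
Qed.

(** No countable stage exhausts [A], so recursion along [omega1] can always pick a new element. *)
Lemma omega1_le_uncountable T (A : set T) : ~ countable A -> [set: omega1] #<= A.
Proof.
move=> nA; have [|f hf] := @wo_construct _ _ omega1_le_wo T
    (fun X t => A t /\ ~ X t) omega1_segment.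
  move=> X cX; apply: contrapT => h; apply: nA; apply: sub_countable cX.
  apply: subset_card_le => t At; apply: contrapT => nXt.
  by apply: h; exists t.
have finj : injective f.
  move=> v w vw; have [//|h|h] := wo_ltgt omega1_le_wo v w.
    by have [_ []] := hf w; exists v.
  by have [_ []] := hf v; exists w.
rewrite -(card_le_eql (inj_card_eq (in2W finj))).
by apply: subset_card_le => _ [w _ <-]; exact: (hf w).1.
Qed.

Lemma countable_not_omega1 T (A : set T) : [set: omega1] #<= A -> ~ countable A.
Proof. by move=> h cA; apply: omega1_uncountable; exact: sub_countable cA. Qed.

(** Each [w] goes to the least element of [omega1] not yet taken. A missed [t] would bound the whole
    image and embed [W] into a countable segment. *)
Lemma omega1_iso W (leW : rel W) : well_order leW ->
  (forall w, countable [set v | wo_lt leW v w]) -> ~ countable [set: W] ->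
  order_iso leW omega1_le.
Proof.
move=> wo seg nW.
have [|f hf] := @wo_construct _ _ wo omega1
    (fun X t => ~ X t /\ forall s, ~ X s -> omega1_le t s) seg.
  move=> X cX; have [|t nXt tmin] := @wo_min _ _ omega1_le_wo (~` X); last by exists t.
  apply: contrapT => h; apply: omega1_uncountable; apply: sub_countable cX.
  by apply: subset_card_le => t _; apply: contrapT => nXt; apply: h; exists t.
have flt v w : wo_lt leW v w -> wo_lt omega1_le (f v) (f w).
  move=> vw; have vw' : f v <> f w by move=> e; have [[]] := hf w; exists v.
  have le : omega1_le (f v) (f w).
    apply: (hf v).2 => -[u uv e]; have [[]] := hf w; exists u => //=.
    by move=> wu; apply: uv; exact: (wo_trans wo (wo_ltW wo vw) wu).
  by move=> h; apply: vw'; exact: (wo_anti omega1_le_wo).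
have finj : injective f.
  move=> v w vw; have [//|/flt|/flt] := wo_ltgt wo v w;
    by rewrite vw => /(_ (wo_refl omega1_le_wo _)).
have fsurj t : exists w, f w = t.
  apply: contrapT => nt; apply: nW.
  have ft w : omega1_le (f w) t.
    by apply: (hf w).2 => -[u _ e]; apply: nt; exists u.
  apply: sub_countable (countable_omega1_segment t).
  rewrite -(card_le_eql (inj_card_eq (in2W finj))).
  by apply: subset_card_le => _ [w _ <-]; exact: ft.
have [g hg] := choice fsurj.
exists f; first by exists g => // w; apply: finj; rewrite hg.
move=> v w; apply/idP/idP => [|vw].
  by apply: contraTT => /negP/flt/negP.
have [->|/flt h|/(_ vw)//] := wo_ltgt wo v w; first exact: (wo_refl omega1_le_wo).
exact: (wo_ltW omega1_le_wo).
Qed.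

(** * Baire's theorem for proper closed subfields *)

Section Baire.
Context {R : realType} {K : analyticFieldType R}.
Hypothesis K_nontrivial : exists x : K, x != 0 /\ absv x != 1.

Lemma small_element (e : R) : 0 < e -> exists2 t : K, t != 0 & absv t < e.
Proof.
move=> e0; have [x [x0 x1]] := K_nontrivial.
have [t t0 t1] : exists2 t : K, t != 0 & absv t < 1.
  move: x1; rewrite neq_lt => /orP[x1|x1]; first by exists x.
  by exists x^-1; [rewrite invr_eq0|rewrite absvV invf_lt1// (lt_trans ltr01)].
have [N /(_ _ (leqnn N)) hN] := exprn_small (absv_ge0 t) t1 e0.
by exists (t ^+ N); [rewrite expf_neq0|rewrite absvX].
Qed.

(** A subfield containing a ball contains a ball around 0, and every [z] is a quotient of the two
    small elements [t * z] and [t]. *)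
Lemma subfield_ball (F : set K) x (e : R) : subfield F -> F <> setT -> 0 < e ->
  exists2 z, absv (z - x) < e & ~ F z.
Proof.
move=> sF nF e0; apply: contrapT => h; apply: nF; apply/seteqP; split=> // z _.
have inF y : absv (y - x) < e -> F y.
  by move=> yx; apply: contrapT => nFy; apply: h; exists y.
have Fsmall y : absv y < e -> F y.
  move=> ye; rewrite -(addrK x y); apply: subfieldB => //; apply: inF.
    by rewrite addrK.
  by rewrite subrr absv0.
have z1 : 0 < absv z + 1 by rewrite ltr_wpDl ?absv_ge0.
have [t t0 te] : exists2 t : K, t != 0 & absv t < Num.min e (e / (absv z + 1)).
  by apply: small_element; rewrite lt_min e0 divr_gt0.
move: te; rewrite lt_min => /andP[te tz].
have -> : z = (t * z) / t by rewrite mulrAC divff// mul1r.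
apply: subfield_div => //; apply: Fsmall => //; rewrite absvM.
apply: (@le_lt_trans _ _ (absv t * (absv z + 1))); last by rewrite -ltr_pdivlMr.
by rewrite ler_wpM2l ?absv_ge0// lerDl.
Qed.

(** The usual nested balls; open ones suffice, since the ultrametric inequality makes them
    closed. *)
Lemma baire_subfields (F : nat -> set K) :
  (forall n, [/\ subfield (F n), closed (F n) & F n <> setT]) ->
  exists x, forall n, ~ F n x.
Proof.
move=> hF.
have /choice[next hnext] : forall nxr : nat * (K * R), exists yr : K * R, 0 < nxr.2.2 ->
    [/\ 0 < yr.2, yr.2 <= nxr.2.2, yr.2 <= nxr.1.+1%:R^-1, absv (yr.1 - nxr.2.1) < nxr.2.2 &
      forall z, absv (z - yr.1) < yr.2 -> ~ F nxr.1 z].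
  move=> [n [x r]] /=; have [r0|nr0] := boolP (0 < r); last by exists (0, 0).
  have [sF clF nF] := hF n; have [y yx nFy] := subfield_ball x sF nF r0.
  have d0 := dist_gt0 (subfield_nonempty sF) clF nFy.
  exists (y, Num.min r (Num.min n.+1%:R^-1 (dist (F n) y))) => _ /=; split=> //.
  - by rewrite !lt_min r0 d0 invr_gt0 ltr0n.
  - by rewrite ge_min lexx.
  - by rewrite !ge_min lexx orbT.
  - move=> z; rewrite !lt_min => /and3P[_ _ zy] Fz; move: zy.
    by rewrite ltNge absv_distC dist_le.
pose u := fix u n := if n is m.+1 then next (m, u m) else (0, 1).
have r0 n : 0 < (u n).2.
  by elim: n => [|n IH]; [exact: ltr01|have [] := hnext (n, u n) IH].
have hu n := hnext (n, u n) (r0 n).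
have near n k : absv ((u (n + k)%N).1 - (u n).1) < (u n).2 /\ (u (n + k)%N).2 <= (u n).2.
  elim: k => [|k [IH1 IH2]]; first by rewrite addn0 subrr absv0 r0.
  have [_ h1 _ h2 _] := hu (n + k)%N; rewrite addnS; split.
    by apply: (absv_dist_lt _ IH1); exact: lt_le_trans h2 IH2.
  exact: le_trans h1 IH2.
have [|z hz] := @complete_absv _ _ (fun n => (u n).1).
  move=> e e0; have [N hN] := small_inv e0; exists N.+1 => n m Nn Nm.
  have [_ _ h _ _] := hu N; have uN : (u N.+1).2 < e := le_lt_trans h (hN N (leqnn N)).
  apply: (@absv_dist_lt _ _ _ _ (u N.+1).1).
    by rewrite -(subnKC Nn) (lt_trans (near _ _).1 uN).
  by rewrite absv_distC -(subnKC Nm) (lt_trans (near _ _).1 uN).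
exists z => n; have [_ _ _ _] := hu n; apply.
have [N hN] := hz _ (r0 n.+1).
apply: (@absv_dist_lt _ _ _ _ (u (n.+1 + N)%N).1).
  by rewrite absv_distC hN// leq_addl.
exact: (near _ _).1.
Qed.

Lemma baire_countable (C : set (set K)) : countable C ->
  (forall F, C F -> [/\ subfield F, closed F & F <> setT]) ->
  exists x, forall F, C F -> ~ F x.
Proof.
move=> /countable_injP[f finj] hC.
have [[F0 CF0]|nC] := pselect (exists F, C F); last first.
  by exists 0 => F CF; exfalso; apply: nC; exists F.
have /choice[F hF] : forall n : nat, exists F, C F /\ forall G, C G -> f G = n -> F = G.
  move=> n; have [[G [CG Gn]]|nG] := pselect (exists G, C G /\ f G = n); last first.
    by exists F0; split=> // G CG Gn; exfalso; apply: nG; exists G.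
  by exists G; split=> // H CH Hn; apply: finj; rewrite ?inE// Gn Hn.
have [|x hx] := @baire_subfields F; first by move=> n; apply: hC; exact: (hF n).1.
by exists x => G CG; rewrite -((hF (f G)).2 G CG erefl).
Qed.

End Baire.

(** * The chain of intermediate fields *)

Section Chains.
Context {R : realType} {K : analyticFieldType R}.
Hypothesis K_closed : alg_closed [set: K].
Implicit Types (B F G S : set K) (x y z : K).

Lemma countable_chain B x W (r : rel W) (D : set W) (F : W -> set K) :
  well_order r -> (forall w, D w -> [/\ acf (F w), B `<=` F w & F w `<=` ta_span B [set x]]) ->
  (forall v w, D v -> D w -> wo_lt r v w -> F v `<` F w) -> countable D.
Proof.
move=> rwo hF Fmono; apply: (@countable_antitone _ _ rwo R _ (fun w => dist (F w) x)).
move=> v w Dv Dw vw; have [Fvw nFwv] := Fmono v w Dv Dw vw.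
have [aFv BFv _] := hF v Dv; have [aFw _ Fwx] := hF w Dw.
apply: (dist_span1_lt K_closed aFv aFw BFv Fvw Fwx) => e.
by apply: nFwv; rewrite e.
Qed.

End Chains.

Definition proper_acf (R : realType) (K : analyticFieldType R) (B : set K) :
  set (set K) := [set F | [/\ acf F, B `<` F & F `<` setT]].

Definition no_generator (R : realType) (K : analyticFieldType R) (B : set K) :=
  forall x, ta_span B [set x] <> setT.

Section TotallyOrdered.
Context {R : realType} {K : analyticFieldType R}.
Hypothesis K_closed : alg_closed [set: K].
Hypothesis K_nontrivial : exists x : K, x != 0 /\ absv x != 1.
Variables (B : set K) (x0 : K).
Hypotheses (aB : acf B) (nBx0 : ~ B x0).
Hypothesis tot : forall x y, ta_span B [set x] y \/ ta_span B [set y] x.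
Implicit Types (F G S : set K) (x y z : K).

Local Notation spn x := (ta_span B [set x]).

Let spn_acf x : acf (spn x). Proof. exact: span_acf. Qed.

Let B_spn x : B `<=` spn x. Proof. exact: sub_spanl. Qed.

Lemma proper_neqT F : F `<` setT -> F <> setT.
Proof. by move=> [_ h] e; apply: h; rewrite e. Qed.

Lemma neqT_proper F : F <> setT -> F `<` setT.
Proof. by move=> h; split=> // TF; apply: h; apply/seteqP. Qed.

Lemma sub_span_notin F x : acf F -> B `<=` F -> ~ F x -> F `<=` spn x.
Proof.
move=> aF BF nFx y Fy; have [//|yx] := tot x y.
by exfalso; apply: nFx; exact: (span1_sub aF BF Fy) yx.
Qed.

Lemma acf_comparable F G : acf F -> acf G -> B `<=` F -> B `<=` G ->
  F `<=` G \/ G `<=` F.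
Proof.
move=> aF aG BF BG; have [|nFG] := pselect (F `<=` G); first by left.
right; have [x Fx nGx] : exists2 x, F x & ~ G x.
  by apply: contrapT => h; apply: nFG => x Fx; apply: contrapT => nGx; apply: h; exists x.
exact: subset_trans (sub_span_notin aG BG nGx) (span1_sub aF BF Fx).
Qed.

Lemma span1_proper_acf x : ~ B x -> spn x <> setT -> proper_acf B (spn x).
Proof.
move=> nBx nx; split; [exact: spn_acf| |exact: neqT_proper].
by split; [exact: B_spn|move=> /(_ x (mem_ta_span1 _ _))].
Qed.

Lemma notin_countable_family (C : set (set K)) : countable C ->
  (forall F, C F -> proper_acf B F) -> exists x, ~ B x /\ forall F, C F -> ~ F x.
Proof.
move=> cC hC; have [|F|x hx] := @baire_countable _ _ K_nontrivial (B |` C).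
- exact: countable_setU1.
- move=> [->|/hC[[sF clF _] _ /proper_neqT nF]]; last by split.
  by have [sB clB _] := aB; split=> // BT; apply: nBx0; rewrite BT.
- by exists x; split=> [|F CF]; apply: hx; [left|right].
Qed.

Lemma countable_sub_span1 S : no_generator B -> countable S ->
  exists2 x, ~ B x & forall s, S s -> ~ spn s x.
Proof.
move=> large cS.
have [||x [nBx hx]] := @notin_countable_family ((fun s => spn s) @` [set s | S s /\ ~ B s]).
- apply: sub_countable cS; apply: card_le_trans (card_image_le _ _) _.
  by apply: subset_card_le => s [].
- by move=> _ [s [Ss nBs] <-]; exact: span1_proper_acf.
exists x => // s Ss sx; have [Bs|nBs] := pselect (B s).
  by apply: nBx; exact: (span1_sub aB (@subset_refl _ B) Bs).
by apply: (hx (spn s)) => //; exists s.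
Qed.

(** By Baire some [x] lies outside the span of every [s] in [S]; by comparability the span of [x]
    then contains all of [S], and [x] would be a generator. *)
Lemma countable_not_generating S : no_generator B -> countable S -> ta_span B S <> setT.
Proof.
move=> large cS ST; have [x nBx hx] := countable_sub_span1 large cS.
apply: (large x); apply/seteqP; split=> // z _; move: (I : [set: K] z).
rewrite -ST; apply: span_min => // s Ss.
by have [//|/hx] := tot x s; move/(_ Ss).
Qed.

(** The chain covers [K], since an [x] outside all its members would have all of them inside its
    span, where well-ordered chains are countable. *)
Lemma omega1_chain : no_generator B -> exists f : omega1 -> K,
  [/\ forall w, ~ B (f w), forall v w, wo_lt omega1_le v w -> ~ spn (f v) (f w) &
      forall x, exists w, spn (f w) x].
Proof.
move=> large; have [|f hf] := @wo_construct _ _ omega1_le_wo K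
    (fun X t => ~ B t /\ forall s, X s -> ~ spn s t) omega1_segment.
  by move=> X cX; have [t nBt ht] := countable_sub_span1 large cX; exists t.
have flt v w : wo_lt omega1_le v w -> ~ spn (f v) (f w).
  by move=> vw; apply: (hf w).2; exists v.
exists f; split=> // [w|x]; first exact: (hf w).1.
apply: contrapT => /forallNP hx; apply: omega1_uncountable.
apply: (@countable_chain _ _ K_closed B x _ _ _ (fun w => spn (f w)) omega1_le_wo) => [w _|v w _ _ vw].
  split=> /=; [exact: spn_acf|exact: B_spn|].
  apply: span1_sub; [exact: spn_acf|exact: B_spn|].
  by have [//|/hx] := tot x (f w).
split; last by move=> h; apply: (flt v w vw); apply: h; exact: mem_ta_span1.
apply: span1_sub; [exact: spn_acf|exact: B_spn|].
have [//|h] := tot (f w) (f v); by exfalso; exact: flt vw h.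
Qed.

Lemma omega1_chain_inj (f : omega1 -> K) :
  (forall v w, wo_lt omega1_le v w -> ~ spn (f v) (f w)) -> injective (fun w => spn (f w)).
Proof.
move=> flt v w vw; have [//|/flt h|/flt h] := wo_ltgt omega1_le_wo v w.
  by exfalso; apply: h; have := mem_ta_span1 B (f w); rewrite -vw.
by exfalso; apply: h; have := mem_ta_span1 B (f v); rewrite vw.
Qed.

Lemma generating_family : no_generator B ->
  exists2 S, ta_span B S = setT & S #= [set: omega1].
Proof.
move=> large; have [f [nBf flt fcov]] := omega1_chain large.
exists (range f).
  apply/seteqP; split=> // x _; have [w] := fcov x.
  apply: span1_sub; [exact: span_acf|exact: sub_spanl|].
  by apply: sub_spanr; exists w.
apply: inj_card_eq; apply: in2W => v w vw.
by apply: (omega1_chain_inj flt); rewrite /= vw.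
Qed.

Lemma cofinal_uncountable (C : set (set K)) : no_generator B ->
  cofinal_in (proper_acf B) C -> ~ countable C.
Proof.
move=> large [CI Ccof] cC; have [x [nBx hx]] := notin_countable_family cC CI.
have [G CG xG] := Ccof _ (span1_proper_acf nBx (large x)).
by apply: (hx G CG); apply: xG; exact: mem_ta_span1.
Qed.

Lemma cofinal_omega1 : no_generator B ->
  exists2 C, cofinal_in (proper_acf B) C & C #= [set: omega1].
Proof.
move=> large; have [f [nBf flt fcov]] := omega1_chain large.
exists (range (fun w => spn (f w))); last first.
  by apply: inj_card_eq; apply: in2W; exact: omega1_chain_inj.
split=> [_ [w _ <-]|F [aF [BF _] [_ nTF]]]; first exact: span1_proper_acf.
have [x nFx] : exists x, ~ F x.
  by apply: contrapT => h; apply: nTF => x _; apply: contrapT => nFx; apply: h; exists x.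
have [w fwx] := fcov x; exists (spn (f w)); first by exists w.
apply: subset_trans (sub_span_notin aF BF nFx) _.
exact: span1_sub.
Qed.

Lemma embeds_omega1 : no_generator B -> embeds_in omega1_le (proper_acf B).
Proof.
move=> large; have [f [nBf flt fcov]] := omega1_chain large.
exists (fun w => spn (f w)) => [w|v w]; first exact: span1_proper_acf.
split=> [vw|fvw]; last first.
  apply: contrapT => nvw; apply: (flt w v nvw).
  by apply: fvw; exact: mem_ta_span1.
have [->//|vw'|/(_ vw)//] := wo_ltgt omega1_le_wo v w.
apply: span1_sub; [exact: spn_acf|exact: B_spn|].
have [//|h] := tot (f w) (f v); by exfalso; exact: flt vw' h.
Qed.

(** The fields below [g w] lie in the span of any [x] outside [g w], so initial segments of [W] are
    countable. *)
Lemma embeds_uncountable W (leW : rel W) : well_order leW -> ~ countable [set: W] ->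
  embeds_in leW (proper_acf B) -> order_iso leW omega1_le.
Proof.
move=> wo nW [g gI gle]; apply: omega1_iso => // w.
have [aF [BF _] [_ nTF]] := gI w.
have [x nFx] : exists x, ~ g w x.
  by apply: contrapT => h; apply: nTF => x _; apply: contrapT => nFx; apply: h; exists x.
apply: (@countable_chain _ _ K_closed B x _ _ _ g wo) => [v vw|u v _ _ uv].
  have [aG [BG _] _] := gI v; split=> //.
  apply: subset_trans (sub_span_notin aF BF nFx).
  by apply/gle; exact: wo_ltW vw.
by split; [apply/gle; exact: wo_ltW uv|move=> /gle].
Qed.

Lemma bigcup_proper_acf : no_generator B -> [set: K] = \bigcup_(F in proper_acf B) F.
Proof.
move=> large; apply/seteqP; split=> // x _.
have [Bx|nBx] := pselect (B x).
  by exists (spn x0); [exact: span1_proper_acf|exact: B_spn].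
by exists (spn x); [exact: span1_proper_acf|exact: mem_ta_span1].
Qed.

(** The distance to [x] is strictly decreasing along the chain. Unless it has a minimum, one field
    of distance less than [q] for each rational [q] gives a cofinal family. *)
Lemma countable_cofinal x : spn x = setT ->
  exists2 C, cofinal_in (proper_acf B) C & countable C.
Proof.
move=> xT.
have dlt F G : proper_acf B F -> proper_acf B G -> F `<=` G -> F <> G -> dist G x < dist F x.
  move=> [aF [BF _] _] [aG _ _] FG nFG.
  by apply: (dist_span1_lt K_closed aF aG BF FG) => //; rewrite xT.
have sub F G : proper_acf B F -> proper_acf B G -> dist G x < dist F x -> F `<=` G.
  move=> IF IG d; have [aF [BF _] _] := IF; have [aG [BG _] _] := IG.
  have [//|GF] := acf_comparable aF aG BF BG.
  move: d; rewrite ltNge dist_subset//; apply: subfield_nonempty; exact: acf_subfield.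
have [[F [IF Fmin]]|nmin] := pselect (exists F, proper_acf B F /\
    forall G, proper_acf B G -> dist F x <= dist G x).
  exists [set F].
    split=> [_ ->//|G IG]; exists F => //.
    have [aF [BF _] _] := IF; have [aG [BG _] _] := IG.
    have [//|FG] := acf_comparable aG aF BG BF.
    have [->//|nFG] := pselect (F = G).
    by have := dlt _ _ IF IG FG nFG; rewrite ltNge Fmin.
  by apply: finite_set_countable; exact: finite_set1.
have /choice[h hh] : forall q : rat, exists F, (exists2 G, proper_acf B G & dist G x < ratr q) ->
    proper_acf B F /\ dist F x < ratr q.
  move=> q; have [[G IG Gq]|nG] := pselect (exists2 G, proper_acf B G & dist G x < ratr q).
    by exists G.
  by exists setT.
exists (h @` [set q | exists2 G, proper_acf B G & dist G x < ratr q]); last first.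
  by apply: sub_countable (card_image_le _ _) _; exact: countableP.
split=> [_ [q /hh[Ih _] <-] //|F IF].
have [G IG GF] : exists2 G, proper_acf B G & dist G x < dist F x.
  apply: contrapT => h'; apply: nmin; exists F; split=> // G IG.
  by rewrite leNgt; apply/negP => GF; apply: h'; exists G.
have [q] := rat_in_itvoo GF; rewrite in_itv/= => /andP[Gq qF].
have [|Ih hq] := hh q; first by exists G.
exists (h q); first by exists q => //; exists G.
by apply: sub => //; exact: lt_trans hq qF.
Qed.

Lemma generator_no_chain x : spn x = setT -> ~ embeds_in omega1_le (proper_acf B).
Proof.
move=> xT [g gI gle]; apply: omega1_uncountable.
apply: (@countable_chain _ _ K_closed B x _ _ _ g omega1_le_wo) => [v _|u v _ _ uv].
  by have [aG [BG _] _] := gI v; split=> //; rewrite xT.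
by split; [apply/gle; exact: (wo_ltW omega1_le_wo uv)|move=> /gle].
Qed.

Lemma generator_not_bigcup x : spn x = setT ->
  [set: K] <> \bigcup_(F in proper_acf B) F.
Proof.
move=> xT e; have : [set: K] x by []; rewrite e => -[F [aF [BF _] nF] Fx].
apply: (proper_neqT nF); apply/seteqP; split=> // z _; move: (I : [set: K] z).
by rewrite -xT; exact: span1_sub.
Qed.

(* An element of a proper subfield that is closer to the generator [x] than the
   elements of [B] is the image of [x] under an isometric endomorphism. *)
Lemma generator_endomorphism p x : prime p -> absv (p%:R : K) < 1 -> spn x = setT ->
  exists s : {rmorphism K -> K}, [/\ isometric s, forall b, B b -> s b = b &
    ~ bijective s].
Proof.
move=> pp p1 xT.
have nBx : ~ B x.
  by move=> Bx; apply: nBx0; apply: (span1_sub aB (@subset_refl _ B) Bx); rewrite xT.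
have [y nBy yT] := proper_subfield K_closed aB pp p1 K_nontrivial nBx xT.
have nBspn : B <> spn y by move=> e; apply: nBy; rewrite e; exact: mem_ta_span1.
have dlt : dist (spn y) x < dist B x.
  apply: (dist_span1_lt K_closed aB (spn_acf y) (@subset_refl _ B)) => //.
  by rewrite xT.
have [z yz xz] := dist_lt (subfield_nonempty (acf_subfield (spn_acf y))) dlt.
have [b Bb|s [si sx sb]] := @isometric_extension _ _ K_closed B x z aB xT.
  exact: lt_le_trans xz (dist_le x Bb).
(* The preimage of [spn y] under [s] contains [B] and [x], so it is [K]; surjectivity of [s] would
   give [spn y = K]. *)
exists s; split=> // -[t st ts]; apply: yT; apply/seteqP; split=> // u _.
have : (s @^-1` spn y) (t u).
  move: (I : [set: K] (t u)); rewrite -xT; apply: span1_sub.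
  - exact: acf_preimage.
  - by move=> b Bb; rewrite /preimage /= sb//; exact: B_spn.
  - by rewrite /preimage /= sx.
by rewrite /preimage /= ts.
Qed.

End TotallyOrdered.

Lemma residue_char_absv (R : realType) (k : analyticFieldType R) p :
  p \in [pchar (residue_field k)] -> prime p /\ absv (p%:R : k) < 1.
Proof.
move=> pk; split; first exact: pcharf_prime pk.
have := pcharf0 pk; rewrite -(rmorph_nat (\pi_(Quotient.quot (@vmax R k)))%qT) => e.
have pm : (p%:R : vring k) \in @vmax R k.
  by rewrite -[p%:R]subr0 Quotient.idealrBE e rmorph0.
by move: pm; rewrite unfold_in -(rmorph_nat (val : {rmorphism vring k -> k})).
Qed.

(** * From completed algebraic closures to spans inside [K] *)

Section Translation.
Context {R : realType}.
Implicit Types k K L M : analyticFieldType R.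

Lemma acf_range k K (i : {rmorphism k -> K}) : isometric i ->
  alg_closed [set: k] -> acf (range i).
Proof. by move=> ii kc; apply: acf_image => //; exact: acf_setT. Qed.

Lemma intermediate_acfE k K (i : {rmorphism k -> K}) :
  intermediate_acf i = proper_acf (range i).
Proof.
apply/seteqP; split=> F.
  by move=> [sF /complete_closed clF cF iF FT]; split.
by move=> [[sF clF cF] iF FT]; split=> //; exact/complete_closed.
Qed.

Lemma alg_closure_inT K (F : set K) : F = setT -> alg_closure_in F = setT.
Proof.
move=> ->; apply/seteqP; split=> // x _; apply: sub_alg_closure_in => //.
exact: subfieldT.
Qed.

Lemma range_idfun K : range (idfun : K -> K) = setT.
Proof. by apply/seteqP; split=> // x _; exists x. Qed.

Lemma completed_alg_closure_id K : alg_closed [set: K] ->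
  completed_alg_closure (idfun : {rmorphism K -> K}).
Proof.
move=> cK; split=> //; rewrite (alg_closure_inT (range_idfun K))//.
by move=> O [x Ox] _; exists x.
Qed.

Lemma completed_alg_closed K M (iota : {rmorphism K -> M}) :
  completed_alg_closure iota -> alg_closed [set: M].
Proof.
move=> [_ cA dA]; suff <- : closure (alg_closure_in (range iota)) = setT.
  apply: alg_closed_closure => //.
  exact: subfield_alg_closure_in (subfield_range iota).
apply/seteqP; split=> // x _; apply/closure_absvP => e e0.
have [|a [xa Fa]] := dA (ball x e)° _ (@open_interior _ _).
  by exists x; apply: nbhs_singleton; apply: nbhs_interior; exact: nbhsx_ballx.
by exists a => //; have := interior_subset xa; rewrite ball_absv.
Qed.

(** The image in [M] of the span of [S] is already closed and algebraically closed, so it contains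
    the span of the image of [S]. *)
Lemma ta_generatingP k K (i : {rmorphism k -> K}) (S : set K) :
  isometric i -> alg_closed [set: K] ->
  ta_generating i S <-> ta_span (range i) S = setT.
Proof.
move=> ii cK; split=> [[M [iota [cM ST]]]|ST]; last first.
  exists K, (idfun : {rmorphism K -> K}); split; first exact: completed_alg_closure_id.
  by rewrite -ST /ta_closure image_id.
have [iotai _ _] := cM; apply/seteqP; split=> // x _.
have aS := acf_image iotai (span_acf (range i) S cK).
have : (iota @` ta_span (range i) S) (iota x).
  move: (I : [set: M] (iota x)); rewrite -ST; apply: (span_min aS).
    by move=> _ [a _ <-]; exists (i a) => //; apply: sub_spanl; exists a.
  by move=> _ [s Ss <-]; exists s => //; exact: sub_spanr.
by move=> [y Sy /fmorph_inj <-].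
Qed.

Lemma card_le1_eq T (S : set T) x y : S #<= `I_1 -> S x -> S y -> x = y.
Proof.
rewrite -(card_le_eqr (@card_set1 _ tt)) => /card_le_trans/(_ (card_leT _)).
move=> /pcard_injP[f finj] Sx Sy; by apply: finj; rewrite ?inE//; case: (f x); case: (f y).
Qed.

Lemma trc_comparable k K (i : {rmorphism k -> K}) M (iota : {rmorphism K -> M}) x y :
  completed_alg_closure iota -> (forall S, ta_independent i S -> S #<= `I_1) ->
  ta_span (range (iota \o i)) [set iota x] (iota y) \/
  ta_span (range (iota \o i)) [set iota y] (iota x).
Proof.
move=> cM h; have Mc := completed_alg_closed cM; apply: contrapT => /not_orP[nxy nyx].
(* A proper subset of [{x, y}] misses [x] or [y], and its closure does not contain the missing
   element. *)
have ind : ta_independent i [set x; y].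
  exists M, iota; split=> // S' [S'S nSS'].
  split.
    apply: span_sub => //; first exact: sub_spanl.
    by move=> _ [s /S'S Ss <-]; apply: sub_spanr; exists s.
  have [S'x|nS'x] := pselect (S' x); last first.
    have S'y : ta_closure i iota S' `<=` ta_span (range (iota \o i)) [set iota y].
      apply: span_sub => //; first exact: sub_spanl.
      by move=> _ [s S's <-]; have [sE|->] := S'S _ S's; [rewrite sE in S's|apply: sub_spanr].
    move=> /(_ (iota x)) hx; apply/nyx/S'y/hx; apply: sub_spanr.
    by exists x => //; left.
  have nS'y : ~ S' y by move=> S'y; apply: nSS' => _ [->|->].
  have S'x' : ta_closure i iota S' `<=` ta_span (range (iota \o i)) [set iota x].
    apply: span_sub => //; first exact: sub_spanl.
    by move=> _ [s S's <-]; have [->|sE] := S'S _ S's; [apply: sub_spanr|rewrite sE in S's].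
  move=> /(_ (iota y)) hy; apply/nxy/S'x'/hy; apply: sub_spanr.
  by exists y => //; right.
have xy := card_le1_eq (h _ ind) (or_introl erefl) (or_intror erefl).
by apply: nxy; rewrite xy; exact: mem_ta_span1.
Qed.

(** Otherwise the supremum of the cardinalities would be 0. *)
Lemma trc1_independent k K (i : {rmorphism k -> K}) : is_trc i `I_1 ->
  exists2 S, ta_independent i S & S !=set0.
Proof.
move=> [_ h]; apply: contrapT => nS.
have : `I_1 #<= (set0 : set nat).
  apply: h => S iS; suff -> : S = set0 by exact: card_ge0.
  by apply/seteqP; split=> // x Sx; apply: nS; exists S => //; exists x.
by rewrite card_le0 => /eqP/seteqP[/(_ 0%N (ltn0Sn 0))].
Qed.

End Translation.

Section Degrees.
Context {R : realType} {k K : analyticFieldType R}.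
Variable i : {rmorphism k -> K}.
Hypotheses (i_isometric : isometric i) (k_closed : alg_closed [set: k])
  (K_closed : alg_closed [set: K]) (trc1 : is_trc i `I_1).

Lemma trc1_comparable x y :
  ta_span (range i) [set x] y \/ ta_span (range i) [set y] x.
Proof. exact: (trc_comparable x y (completed_alg_closure_id K_closed) trc1.1). Qed.

Lemma trc1_notin_range : exists x, ~ range i x.
Proof.
have [S [M [iota [cM Sind]]] [s Ss]] := trc1_independent trc1.
have Mc := completed_alg_closed cM.
apply: contrapT => h; have iT x : range i x by apply: contrapT => nx; apply: h; exists x.
have [|_] := Sind set0; first by split=> // /(_ s Ss).
apply; apply: span_sub => //; first exact: sub_spanl.
move=> _ [t _ <-]; apply: sub_spanl; have [a _ <-] := iT t.
by exists a.
Qed.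

Lemma generator_Trc x : ta_span (range i) [set x] = setT -> is_Trc i `I_1.
Proof.
move=> xT; split; first by exists [set x]; [exact/ta_generatingP|exact: card_set1].
move=> S /(ta_generatingP _ i_isometric K_closed) ST.
have [s Ss] : S !=set0.
  apply/set0P/eqP => S0; have [z nz] := trc1_notin_range; apply: nz.
  have : [set: K] z by []; rewrite -ST S0; apply: span_min => //.
  exact: acf_range.
by rewrite -(card_le_eql (@card_set1 _ s)); apply: subset_card_le => _ ->.
Qed.

End Degrees.

Lemma ta_independent_ext (R : realType) (k K : analyticFieldType R)
  (i i' : {rmorphism k -> K}) : i =1 i' -> ta_independent i = ta_independent i'.
Proof.
move=> /funext ii'; apply/funext => S; rewrite /ta_independent /ta_closure.
by apply/propext; split=> -[M [iota h]]; exists M, iota; move: h; rewrite /= ii'.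
Qed.

Section Maximality.
Context {R : realType} {k K L : analyticFieldType R}.
Variables (i : {rmorphism k -> K}) (j : {rmorphism K -> L}).
Hypotheses (j_isometric : isometric j)
  (K_closed : alg_closed [set: K]) (L_trc1 : is_trc (j \o i) `I_1).

Lemma range_eqT_of_omega1 :
  embeds_in omega1_le (proper_acf (range i)) -> range j = [set: L].
Proof.
move=> [g gI gle]; apply/seteqP; split=> // x _; apply: contrapT => nx.
have [_ [M [iota [cM _]]] _] := trc1_independent L_trc1.
have Mc := completed_alg_closed cM; have [iotai _ _] := cM.
have ioj : isometric (iota \o j) by move=> u; rewrite /= iotai j_isometric.
pose F w := (iota \o j) @` (g w).
(* If this failed, comparability would put [iota x] into the span of an element of [K], hence into
   the image of [K]. *)
have inx y : ta_span (range (iota \o (j \o i))) [set iota x] (iota (j y)).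
  have [//|xy] := trc_comparable x (j y) cM L_trc1.1.
  exfalso; apply: nx.
  have aK := acf_image ioj (acf_setT K_closed).
  have BK : range (iota \o (j \o i)) `<=` range (iota \o j).
    by move=> _ [a _ <-]; exists (i a).
  have [|u _ /= /fmorph_inj <-] := span1_sub aK BK _ xy; last by exists u.
  by exists y.
apply: omega1_uncountable.
apply: (@countable_chain _ _ Mc (range (iota \o (j \o i))) (iota x) _ _ _ F omega1_le_wo).
  move=> w _; have [aG [BG _] _] := gI w; split; first exact: acf_image.
    by move=> _ [a _ <-]; exists (i a) => //; apply: BG; exists a.
  by move=> _ [y _ <-]; exact: inx.
move=> v w _ _ vw; have gvw : g v `<=` g w by apply/gle; exact: (wo_ltW omega1_le_wo vw).
split; first exact: image_subset.
move=> Fwv; apply: vw; apply/gle => y gy.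
have [|u gu /= /fmorph_inj/fmorph_inj <-//] := Fwv (iota (j y)).
by exists y.
Qed.

End Maximality.

Theorem theorem4p1p2 (R : realType) (k K : analyticFieldType R)
    (i : {rmorphism k -> K})
    (i_isometric : isometric i)
    (k_closed : alg_closed [set: k])
    (K_closed : alg_closed [set: K])
    (K_nontrivial : exists x : K, x != 0 /\ absv x != 1)
    (trc1 : is_trc i `I_1)
    (residue_char : exists p, p \in [pchar (residue_field k)]) :
  let I := intermediate_acf i in
  [<-> large i;
       exists A : set K, is_Trc i A /\ [set: omega1] #<= A;
       is_Trc i [set: omega1];
       exists C : set (set K), is_cofinality I C /\ ~ countable C;
       is_cofinality I [set: omega1];
       embeds_in omega1_le I /\
         forall (W : Type) (leW : rel W),
           well_order leW -> ~ countable [set: W] -> embeds_in leW I ->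
           order_iso leW omega1_le;
       [set: K] = \bigcup_(F in I) F;
       ~ exists (L : analyticFieldType R) (j : {rmorphism K -> L}),
           [/\ isometric j, range j <> [set: L] & is_trc (j \o i) `I_1];
       forall f : {rmorphism K -> K},
         isometric f -> f \o i =1 i -> bijective f].
Proof.
move=> I; rewrite /I intermediate_acfE {I}.
have aB := acf_range i_isometric k_closed.
have [x0 nBx0] := trc1_notin_range trc1.
have tot := trc1_comparable K_closed trc1.
have gen S := ta_generatingP S i_isometric K_closed.
have nogen : ~ (exists x, ta_span (range i) [set x] = setT) -> no_generator (range i).
  by move=> h x xT; apply: h; exists x.
have nogenW : no_generator (range i) -> large i.
  move=> ng [n [[S /gen ST Sn] _]].
  apply: (countable_not_generating K_closed K_nontrivial aB nBx0 tot ng _ ST).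
  by apply: finite_set_countable; apply/finite_setP; exists n.
have genC x : ta_span (range i) [set x] = setT ->
    forall A : set K, is_Trc i A -> countable A.
  move=> xT A [_ Amin]; apply: sub_countable (Amin [set x] _) _; first exact/gen.
  by apply: finite_set_countable; exact: finite_set1.
have Trc_min S : no_generator (range i) -> ta_generating i S -> [set: omega1] #<= S.
  move=> ng /gen ST; apply: omega1_le_uncountable => cS.
  exact: (countable_not_generating K_closed K_nontrivial aB nBx0 tot ng cS ST).
have cof_min (C : set (set K)) : no_generator (range i) ->
    cofinal_in (proper_acf (range i)) C -> [set: omega1] #<= C.
  move=> ng Ccof; apply: omega1_le_uncountable.
  exact: (cofinal_uncountable K_closed K_nontrivial aB nBx0 ng Ccof).
(* Every implication except the one from (8) to (9) first excludes a single generator and then works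
   with [no_generator]. *)
tfae.
- move=> lg; have ng : no_generator (range i).
    apply: nogen => -[x /(generator_Trc i_isometric k_closed K_closed trc1) h].
    by apply: lg; exists 1%N.
  have [S ST Sw] := generating_family K_closed K_nontrivial aB nBx0 tot ng.
  exists S; rewrite (card_le_eqr Sw); split=> //; split.
    by exists S; [exact/gen|exact: card_eqxx].
  by move=> S' /(Trc_min _ ng); rewrite (card_le_eql Sw).
- move=> [A [TA wA]]; have ng : no_generator (range i).
    by apply: nogen => -[x /genC/(_ A TA)]; exact: countable_not_omega1.
  have [S ST Sw] := generating_family K_closed K_nontrivial aB nBx0 tot ng.
  by split; [exists S => //; exact/gen|move=> S' /(Trc_min _ ng)].
- move=> [[S Sgen Sw] wmin]; have ng : no_generator (range i).
    apply: nogen => -[x xT]; apply: omega1_uncountable.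
    apply: sub_countable (wmin [set x] _) _; first exact/gen.
    by apply: finite_set_countable; exact: finite_set1.
  have [C Ccof Cw] := cofinal_omega1 K_closed K_nontrivial aB nBx0 tot ng.
  exists C; split.
    split; first by exists C => //; exact: card_eqxx.
    by move=> C' /(cof_min _ ng); rewrite (card_le_eql Cw).
  exact: (cofinal_uncountable K_closed K_nontrivial aB nBx0 ng Ccof).
- move=> [C [[_ Cmin] nC]]; have ng : no_generator (range i).
    apply: nogen => -[x /(countable_cofinal K_closed tot)[D Dcof cD]].
    by apply: nC; exact: sub_countable (Cmin D Dcof) cD.
  have [D Dcof Dw] := cofinal_omega1 K_closed K_nontrivial aB nBx0 tot ng.
  by split; [exists D|move=> C' /(cof_min _ ng)].
- move=> [_ wmin]; have ng : no_generator (range i).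
    apply: nogen => -[x /(countable_cofinal K_closed tot)[D Dcof cD]].
    by apply: omega1_uncountable; exact: sub_countable (wmin D Dcof) cD.
  split; first exact: (embeds_omega1 K_closed K_nontrivial aB nBx0 tot ng).
  by move=> W leW; exact: (embeds_uncountable K_closed tot).
- move=> [emb _]; apply: (bigcup_proper_acf K_closed nBx0).
  by apply: nogen => -[x /(generator_no_chain K_closed)]; apply.
- move=> KE [L [j [ji jT Ltrc]]]; apply: jT.
  apply: (range_eqT_of_omega1 ji K_closed Ltrc).
  apply: (embeds_omega1 K_closed K_nontrivial aB nBx0 tot).
  by apply: nogen => -[x /generator_not_bigcup]; apply.
(* A non-surjective [f] would make [K] a proper extension of itself of topological transcendence
   degree one. *)
- move=> maxK f fi fB; have frT : range f = setT.
    apply: contrapT => nT; apply: maxK; exists K, f; split=> //.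
    by rewrite /is_trc (ta_independent_ext (i' := i)).
  have /choice[g gK] : forall y, exists x, f x = y.
    by move=> y; have [x _ xy] : range f y by [rewrite frT]; exists x.
  by exists g => // x; apply: (fmorph_inj f).
- move=> endo; apply: nogenW; apply: nogen => -[x xT].
  have [p /residue_char_absv[pp p1]] := residue_char.
  have pK : absv (p%:R : K) < 1 by rewrite -(rmorph_nat i) i_isometric.
  have [s [si sB ns]] := generator_endomorphism K_closed K_nontrivial aB nBx0 pp pK xT.
  by apply: ns; apply: endo => // a; apply: sB; exists a.
Qed.
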